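(* Let $\alpha\in(0,1)$, and let $u\in C^{1,1}(B_1)\cap W^{2,2}(B_1)$ be a real-valued function on the open unit ball $B_1\subset\mathbb{R}^2$, with $\Lambda=\|Du\|_{C^{0,1}(B_1)}<\infty$, which satisfies on $B_1$ the nonhomogeneous special Lagrangian equation $$F(D^2u)=\theta(x),\qquad F(D^2u)=\operatorname{Im}\log\det(I+iD^2u)=\arctan\lambda_1+\arctan\lambda_2,$$ where $\lambda_1,\lambda_2$ are the eigenvalues of $D^2u$. If $\theta\in C^{\alpha}(B_1)$, then there exists $R\in(0,1)$, depending only on $\Lambda$ and $\alpha$, such that $u\in C^{2,\alpha}(B_R)$ and $$|D^2u|_{C^{\alpha}(B_R)}\le C_1,$$ where, for the given $\alpha$, the constant $C_1$ depends only on $\|u\|_{L^\infty(B_1)}$, $\Lambda$ and $|\theta|_{C^\alpha(B_1)}$.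
   Context: $B_r$ denotes the open ball of radius $r$ centered at the origin in $\mathbb{R}^2$. The $C^{1,1}$ bound of $u$ is $\Lambda=\|u\|_{C^{1,1}(B_1)}=\|Du\|_{C^{0,1}(B_1)}$, where $\|Du\|_{C^{0,1}(B_1)}$ is the supremum of $|Du|$ plus the Lipschitz constant of $Du$ on $B_1$; in particular $-\Lambda I\le D^2u\le\Lambda I$ almost everywhere. The equation $F(D^2u)=\theta$ holds at almost every point of $B_1$ (where $D^2u$ exists). $|\cdot|_{C^\alpha(B)}$ denotes the Hölder norm with exponent $\alpha$ on $B$ (supremum plus Hölder seminorm), and $\theta\in C^\alpha(B_1)$ means this norm is finite. *)

(* Defs.v *)
From HB Require Import structures.
From mathcomp Require Import all_boot all_order all_algebra.
From mathcomp Require Import all_classical all_reals all_analysis.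

Set Implicit Arguments.
Unset Strict Implicit.
Unset Printing Implicit Defensive.

Import Order.TTheory GRing.Theory Num.Theory.
Import numFieldNormedType.Exports.

Local Open Scope classical_set_scope.
Local Open Scope ring_scope.

(* R^2 is the product type R * R, which carries the product Lebesgue measure.
   Its library norm is the sup norm, so the Euclidean one is introduced here;
   the two induce the same topology and notion of differentiability. *)
Definition enorm (R : realType) (x : R * R) : R :=
  Num.sqrt (x.1 ^+ 2 + x.2 ^+ 2).

Definition eball (R : realType) (r : R) : set (R * R) :=
  [set x | enorm x < r].

(* measurableTypeR R is R as the domain type of lebesgue_measure. *)
Definition mplane (R : realType) := (measurableTypeR R * measurableTypeR R)%type.

Definition leb2 (R : realType) : {measure set (mplane R) -> \bar R} :=
  (@lebesgue_measure R \x @lebesgue_measure R)%E.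

Definition mxnorm2 (R : realType) (m n : nat) (A : 'M[R]_(m, n)) : R :=
  Num.sqrt (\sum_(i < m) \sum_(j < n) A i j ^+ 2).

Definition ebase (R : realType) (i : 'I_2) : R * R :=
  ((i == 0 :> nat)%:R, (i == 1 :> nat)%:R).

Definition partial (R : realType) (i : 'I_2) (u : R * R -> R) : R * R -> R :=
  fun x => 'D_(ebase R i) u x.

Definition grad (R : realType) (u : R * R -> R) (x : R * R) : 'rV[R]_2 :=
  \row_(i < 2) partial i u x.

Definition hess (R : realType) (u : R * R -> R) (x : R * R) : 'M[R]_2 :=
  \matrix_(i < 2, j < 2) partial j (partial i u) x.

Section Hoelder.
Context (R : realType) (V : zmodType) (N : V -> R).

Definition sup_norm (A : set (R * R)) (f : R * R -> V) : \bar R :=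
  ereal_sup [set (N (f x))%:E | x in A].

(* Least C such that |f x - f y| <= C |x - y|^a on A; for a = 1 this is the
   Lipschitz constant. *)
Definition holder_seminorm (a : R) (A : set (R * R)) (f : R * R -> V) : \bar R :=
  ereal_sup [set (N (f z.1 - f z.2) / enorm (z.1 - z.2) `^ a)%:E
            | z in [set z | [/\ A z.1, A z.2 & z.1 != z.2]]].

Definition holder_norm (a : R) (A : set (R * R)) (f : R * R -> V) : \bar R :=
  (sup_norm A f + holder_seminorm a A f)%E.

End Hoelder.

(* In C1_holder and C2_holder, A is meant to be open.  Continuity of the
   top-order derivative follows from the finiteness of its Hoelder norm. *)
Definition C1_holder (R : realType) (a : R) (A : set (R * R))
    (u : R * R -> R) : Prop :=
  [/\ forall x, A x -> differentiable u x,
      (sup_norm Num.norm A u < +oo)%E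
    & (holder_norm (@mxnorm2 R 1 2) a A (grad u) < +oo)%E].

Definition C2_holder (R : realType) (a : R) (A : set (R * R))
    (u : R * R -> R) : Prop :=
  [/\ forall x, A x -> differentiable u x /\ differentiable (grad u) x,
      (sup_norm Num.norm A u < +oo)%E,
      (sup_norm (@mxnorm2 R 1 2) A (grad u) < +oo)%E
    & (holder_norm (@mxnorm2 R 2 2) a A (hess u) < +oo)%E].

(* L^p(A) norm of f, as the L^p(R^2) norm of the extension of f by zero. *)
Definition Lp_norm (R : realType) (p : \bar R) (A : set (R * R))
    (f : R * R -> R) : \bar R :=
  'N[leb2 R]_p[EFin \o (f \_ A)].

Definition in_Lp (R : realType) (p : \bar R) (A : set (R * R))
    (f : R * R -> R) : Prop :=
  measurable_fun A f /\ (Lp_norm p A f < +oo)%E.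

(* Smoothness: all iterated partial derivatives exist and are differentiable. *)
Definition test_function (R : realType) (A : set (R * R))
    (phi : R * R -> R) : Prop :=
  (forall (s : seq 'I_2) (x : R * R),
     differentiable (foldr (@partial R) phi s) x) /\
  (exists K : set (R * R),
     [/\ compact K, K `<=` A & forall x, ~ K x -> phi x = 0]).

Definition weak_partial (R : realType) (A : set (R * R)) (i : 'I_2)
    (f g : R * R -> R) : Prop :=
  forall phi, test_function A phi ->
    \int[leb2 R]_(x in A) (f x * partial i phi x) =
    - \int[leb2 R]_(x in A) (g x * phi x).

Fixpoint sobolev (R : realType) (k : nat) (p : \bar R) (A : set (R * R))
    (f : R * R -> R) : Prop :=
  in_Lp p A f /\
  match k with
  | 0%N => True
  | k'.+1 => forall i, exists g, weak_partial A i f g /\ sobolev k' p A g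
  end.

(* The eigenvalues with algebraic multiplicity (the default [::] is only
   reached when the characteristic polynomial does not split over R, which is
   impossible for a symmetric matrix). *)
Definition eigenvalues (R : realType) (n : nat) (H : 'M[R]_n) : seq R :=
  xget [::] [set s : seq R | char_poly H = \prod_(l <- s) ('X - l%:P)].

(* The branch of Im log det (I + i H) given by the sum of the arctangents. *)
Definition slag (R : realType) (n : nat) (H : 'M[R]_n) : R :=
  \sum_(l <- eigenvalues H) atan l.

(* The equation holds at x only if D^2 u exists there, i.e. if Du is
   differentiable at x; this excludes the default values of 'D_v. *)
Definition slag_solution (R : realType) (A : set (R * R))
    (u theta : R * R -> R) : Prop :=
  {ae leb2 R, forall x, A x ->
     differentiable (grad u) x /\ slag (hess u x) = theta x}.

(* Main.v *)
(* Identify Du with g = u_x + i u_y. Near a point z0 rotate the graph of g by half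
   the phase theta(z0): on a disc whose size is controlled by Lambda, alpha and the
   norm of theta, the map w = cos t z + sin t g(z) is bi-Lipschitz, because the
   rotated Hessian has bounded eigenvalues, and the conjugate of the rotated
   gradient is a Lipschitz function of w whose dbar-derivative is almost everywhere
   O(|theta - theta(z0)|) = O(|w - w0|^alpha). Let E be its remainder at w0, scaled
   so that the increment has length 1. The contour integral of E(w) / (w^2 (w - 1))
   bounds E(1); the area integral of Stokes' formula is avoided by adding explicit
   radial barriers that make the integral over every small square nonpositive up to
   a small error, and summing over a Cousin subdivision. This gives
   |Du(x) - Du(x0) - D^2u(x0)(x - x0)| <= C |x - x0|^(1 + alpha) for almost every x0,
   with C uniform. Comparing two such expansions shows that D^2u is Hoelder on a
   dense set, and they extend to every point of the half ball. *)

Require Import Defs.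
From HB Require Import structures.
From mathcomp Require Import all_boot all_order all_algebra.
From mathcomp Require Import all_classical all_reals all_analysis.
From mathcomp Require Import measurable_realfun ring lra.
From mathcomp Require Import complex.

Set Implicit Arguments.
Unset Strict Implicit.
Unset Printing Implicit Defensive.

Import Order.TTheory GRing.Theory Num.Theory.
Import numFieldNormedType.Exports.

Local Open Scope classical_set_scope.
Local Open Scope ring_scope.

(** * Lebesgue measure on the plane *)

(** The second derivatives exist only almost everywhere and carry no modulus of continuity. Every
    passage from almost everywhere to everywhere is therefore a sign statement for a contour
    integral, which is additive under quartering of squares; even the monotonicity of the rotation
    map along a segment is obtained this way, on a thin strip. The kernel is dictated by scaling.
    Since E is o(w) at 0 it may be divided by w^2, and the extra decay makes the boundary term over
    a square of side M of order L / M, where L is the Lipschitz constant of E. For an increment of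
    length d, L is of order d and M of order 1 / d, which gives d^2. The dbar-derivative is at most
    K |w|^alpha with K of order d^(1 + alpha), and |w|^(alpha - 2) / |w - 1| is integrable over the
    whole plane exactly because 0 < alpha < 1, so the bound does not deteriorate as M grows. *)

Section PlaneMeasure.
Context {R : realType}.

Lemma ball_pairE (c : R * R) (r : R) : ball c r = ball c.1 r `*` ball c.2 r.
Proof. by []. Qed.

Lemma open_plane_measurable (U : set (R * R)) :
  open U -> measurable (U : set (mplane R)).
Proof.
move=> oU.
pose F (p : rat * rat * nat) : set (mplane R) :=
  let B := ball ((ratr p.1.1, ratr p.1.2) : R * R) (p.2.+1%:R^-1) in
  if `[< B `<=` U >] then B else set0.
have -> : (U : set (mplane R)) = \bigcup_p F p.
  rewrite eqEsubset; split => [x Ux|x [p _]]; last first.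
    by rewrite /F; case: ifPn => [/asboolP BU /BU|].
  have : nbhs x U by exact: open_nbhs_nbhs.
  rewrite -nbhs_ballE => -[e /= e0 xe].
  have e20 : 0 < e / 2 by rewrite divr_gt0.
  have [n _ /(_ n (leqnn n)) /= ne] := near_infty_natSinv_lt (PosNum e20).
  have n0 : 0 < n.+1%:R^-1 :> R by rewrite invr_gt0.
  have rd (t : R) : exists q : rat, ball (ratr q : R) n.+1%:R^-1 t.
    have [||y [By [q _ qy]]] := @dense_rat R (ball t n.+1%:R^-1).
    - by exists t; exact: ballxx.
    - exact: ball_open.
    by exists q; rewrite qy; apply: ball_sym.
  have [q1 h1] := rd x.1; have [q2 h2] := rd x.2.
  exists ((q1, q2), n) => //; rewrite /F /=.
  case: ifPn => [_|/asboolPn]; first by split.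
  move=> []; move=> y; rewrite ball_pairE => -[/= y1 y2]; apply: xe.
  rewrite ball_pairE; split => /=.
  - by apply: le_ball (ball_triangle (ball_sym h1) y1); apply: ltW; rewrite [ltRHS]splitr ltrD.
  - by apply: le_ball (ball_triangle (ball_sym h2) y2); apply: ltW; rewrite [ltRHS]splitr ltrD.
apply: countable_bigcupT_measurable => [|p]; first exact: countableP.
rewrite /F; case: ifPn => _; last exact: measurable0.
by rewrite ball_pairE; apply: measurableX; apply: open_measurable; exact: ball_open.
Qed.

Lemma closed_plane_measurable (F : set (R * R)) :
  closed F -> measurable (F : set (mplane R)).
Proof.
by move=> cF; rewrite -(setCK F); apply: measurableC; apply: open_plane_measurable; exact: closed_openC.
Qed.

(** Two-sided regularity rather than outer regularity alone: this form is stable under complement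
    and so can define a sigma-algebra. *)
Definition bracketed (m : set (mplane R) -> \bar R) (A : set (mplane R)) :=
  forall e : R, 0 < e -> exists U F : set (R * R),
    [/\ open U, closed F, F `<=` A, A `<=` U & (m (U `\` F) < e%:E)%E].

Variable m : {finite_measure set (mplane R) -> \bar R}.

Lemma bracketedC A : bracketed m A -> bracketed m (~` A).
Proof.
move=> rA e e0; have [U [F [oU cF FA AU mUF]]] := rA e e0.
exists (~` F), (~` U); split; [exact: closed_openC|exact: open_closedC| | |].
- exact: subsetC.
- exact: subsetC.
- by rewrite setDE setCK setIC -setDE.
Qed.

(** An infinite union of closed sets need not be closed, so only finitely many inner sets are kept;
    continuity from above, which uses that [m] is finite, makes the omitted part small. *)
Lemma bracketed_bigcup (A : (set (mplane R))^nat) :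
  (forall n, bracketed m (A n)) -> bracketed m (\bigcup_n A n).
Proof.
move=> rA e e0.
(* These errors sum to at most e / 2, which leaves room for the truncation at [N]. *)
have e4 n : 0 < e / 2 / (2 ^ n.+1)%:R by rewrite !divr_gt0.
have /choice [U] : forall n, exists UF : set (R * R) * set (R * R),
  [/\ open UF.1, closed UF.2, UF.2 `<=` A n, A n `<=` UF.1 &
   (m (UF.1 `\` UF.2) < (e / 2 / (2 ^ n.+1)%:R)%:E)%E].
  by move=> n; have [U [F UF]] := rA n _ (e4 n); exists (U, F).
move=> UF.
pose V := \bigcup_n (U n).1.
have oV : open V by apply: bigcup_open => n _; case: (UF n).
pose G n := \big[setU/set0]_(i < n) (U i).2.
have cG n : closed (G n) by apply: closed_bigsetU => i _; case: (UF i).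
have GE n : G n = \bigcup_(i < n) (U i).2 by rewrite (bigcup_mkord n (fun i => (U i).2)).
pose D n : set (mplane R) := V `\` G n.
have mD n : measurable (D n).
  apply: measurableD; first exact: open_plane_measurable.
  exact: closed_plane_measurable.
have mDoo : measurable (\bigcap_n D n) by exact: bigcapT_measurable.
have Dcvg : (m \o D) x @[x --> \oo] --> m (\bigcap_n D n).
  apply: nonincreasing_cvg_mu => //.
  - by rewrite ltey_eq fin_num_measure.
  - move=> i j ij; apply/subsetPset; apply: setDS.
    rewrite !GE; apply: bigcup_sub => k /= ki.
    by apply: (bigcup_sup (i := k)) => /=; exact: leq_trans ki ij.
have Doo : (m (\bigcap_n D n) <= (e / 2)%:E)%E.
  have : (m (\bigcap_n D n) <= \sum_(n <oo) m ((U n).1 `\` (U n).2))%E.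
    apply: measure_sigma_subadditive => //.
      move=> n; apply: measurableD.
        by apply: open_plane_measurable; case: (UF n).
      by apply: closed_plane_measurable; case: (UF n).
    move=> x Dx; have [[n _ Un] _] := Dx 0%N I; exists n => //; split => // Fn.
    have [_] := Dx n.+1 I; apply; rewrite GE; by exists n => /=.
  move/le_trans; apply.
  apply: le_trans (@epsilon_trick0 R (e/2) xpredT _); last by rewrite divr_ge0// ltW.
  apply: lee_nneseries => // n _.
  by apply: ltW; case: (UF n).
have Doolt : (m (\bigcap_n D n) < e%:E)%E.
  by apply: le_lt_trans Doo _; rewrite lte_fin; lra.
have [N NP] : exists N, (m (D N) < e%:E)%E.
  have /= := Dcvg [set x | (x < e%:E)%E] (open_ereal_lt' Doolt).
  by case=> N _ /(_ N (leqnn N)) /=; exists N.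
exists V, (G N); split => //.
- by rewrite GE => x [i _ Fi]; exists i => //; case: (UF i) => _ _ /(_ _ Fi).
- by move=> x [i _ Ai]; exists i => //; case: (UF i) => _ _ _ /(_ _ Ai).
Qed.

Lemma bracketed_set0 : bracketed m set0.
Proof.
move=> e e0; exists set0, set0; split => //; do ?[exact: open0|exact: closed0].
by rewrite setD0 measure0 lte_fin.
Qed.

Lemma sigma_algebra_bracketed : sigma_algebra setT [set A | bracketed m A].
Proof.
split => /=; first exact: bracketed_set0.
  by move=> A rA; rewrite setTD; exact: bracketedC.
exact: bracketed_bigcup.
Qed.

(** The inner closed sets are [a + n.+1%:R^-1 <= p x]; the strips left out decrease to the empty
    set. *)
Lemma bracketed_halfplane (p : R * R -> R) (a : R) : continuous p ->
  bracketed m [set x | a < p x].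
Proof.
move=> cp e e0.
pose S n : set (mplane R) := [set x | a < p x < a + n.+1%:R^-1].
have oU : open [set x | a < p x].
  exact: (open_comp (f := p) (D := [set y | a < y]) (fun x _ => cp x) (@open_gt _ a)).
have cF n : closed [set x | a + n.+1%:R^-1 <= p x].
  exact: (closed_comp (f := p) (D := [set y | a + n.+1%:R^-1 <= y]) (fun x _ => cp x) (@closed_ge _ _)).
have SE n : S n = [set x | a < p x] `\` [set x | a + n.+1%:R^-1 <= p x].
  rewrite eqEsubset; split => x /=; first by move=> /andP[? ?]; split => //; apply/negP; rewrite -ltNge.
  by move=> [h1 /negP]; rewrite -ltNge => h2; apply/andP.
have mS n : measurable (S n).
  rewrite SE; apply: measurableD; first exact: open_plane_measurable.
  exact: closed_plane_measurable.
have S0 : \bigcap_n S n = set0.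
  rewrite -subset0 => x Sx.
  have px : 0 < p x - a by have /andP[] := Sx 0%N I; rewrite subr_gt0.
  have [n _ /(_ n (leqnn n)) /= ne] := near_infty_natSinv_lt (PosNum px).
  by have /andP[_] := Sx n I; rewrite -ltrBlDl => /(lt_trans ne); rewrite ltxx.
have Scvg : (m \o S) x @[x --> \oo] --> m (\bigcap_n S n).
  apply: nonincreasing_cvg_mu => //.
  - by rewrite ltey_eq fin_num_measure.
  - exact: bigcapT_measurable.
  - move=> i j ij; apply/subsetPset => x /andP[h1 h2]; apply/andP; split => //.
    by apply: (lt_le_trans h2); rewrite lerD2l lef_pV2 ?posrE// ler_nat.
rewrite S0 measure0 in Scvg.
have e0' : (0 < e%:E)%E by rewrite lte_fin.
have /= := Scvg [set x | (x < e%:E)%E] (open_ereal_lt' e0').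
case=> N _ /(_ N (leqnn N)) /= NP.
exists [set x | a < p x], [set x | a + N.+1%:R^-1 <= p x]; split => //.
- by move=> x /=; apply: lt_le_trans; rewrite ltrDl invr_gt0.
- by rewrite -SE.
Qed.

Lemma bracketed_preimage (p : R * R -> R) (A : set (measurableTypeR R)) :
  continuous p -> measurable A -> bracketed m (p @^-1` A).
Proof.
move=> cp mA.
have : <<s (@RGenOInfty.G R) >> A by exact: (match RGenOInfty.measurableE R in _ = G return G A with erefl => mA end).
have [b0 bC bU] := sigma_algebra_bracketed.
apply: (@smallest_sub _ _ _ [set A | bracketed m (p @^-1` A)]).
  split => /=.
  - by rewrite preimage_set0; exact: b0.
  - by move=> B; rewrite setTD preimage_setC; exact: bracketedC.
  - by move=> B rB; rewrite preimage_bigcup; exact: bracketed_bigcup.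
move=> _ [a ->] /=.
have -> : p @^-1` `]a, +oo[ = [set x | a < p x].
  by rewrite eqEsubset; split => x /=; rewrite in_itv /= andbT.
exact: bracketed_halfplane.
Qed.

Lemma measurable_bracketed (A : set (mplane R)) : measurable A -> bracketed m A.
Proof.
rewrite measurable_prod_measurableType.
apply: smallest_sub; first exact: sigma_algebra_bracketed.
move=> _ [B mB [C mC <-]] /=.
have rB : bracketed m (fst @^-1` B).
  by apply: bracketed_preimage mB => x; exact: cvg_fst.
have rC : bracketed m (snd @^-1` C).
  by apply: bracketed_preimage mC => x; exact: cvg_snd.
(* The intersection is written as the complement of a countable union, to reuse the two closure
   properties. *)
have -> : B `*` C = ~` \bigcup_n (if n == 0%N then ~` (fst @^-1` B) else ~` (snd @^-1` C)).
  rewrite eqEsubset; split => [x [/= Bx Cx] [n _]|x h]; first by case: eqP.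
  split; apply: contrapT => nx; apply: h; [by exists 0%N|by exists 1%N].
apply: bracketedC; apply: bracketed_bigcup => n; case: eqP => _; exact: bracketedC.
Qed.

End PlaneMeasure.

Lemma leb2_ball (R : realType) (c : R * R) (r : R) : 0 <= r ->
  leb2 R (ball c r) = (4 * r ^+ 2)%:E.
Proof.
move=> r0.
have mb (t : R) : measurable (ball t r : set (measurableTypeR R)).
  by apply: open_measurable; exact: ball_open.
have := product_measure1E (@lebesgue_measure R) (@lebesgue_measure R) (mb c.1) (mb c.2).
move=> h; rewrite /leb2 [LHS]h.
apply: etrans (f_equal2 mule (lebesgue_measure_ball c.1 r0) (lebesgue_measure_ball c.2 r0)) _.
rewrite -EFinM; congr (_%:E); ring.
Qed.

(** Lebesgue measure restricted to a ball is finite, so the regularity of finite measures applies to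
    it. *)
Lemma negligible_open_cover (R : realType) (N : set (mplane R)) (r e : R) :
  (leb2 R).-negligible N -> 0 < e ->
  exists U : set (R * R), [/\ open U, N `&` ball (0 : R * R) r `<=` U, U `<=` ball (0 : R * R) r &
    (leb2 R U < e%:E)%E].
Proof.
move=> [A [mA A0 NA]] e0.
pose B : set (mplane R) := ball (0 : R * R) r.
have mB : measurable B by apply: open_plane_measurable; exact: ball_open.
have Bfin : (leb2 R B < +oo)%E.
  have [r0|r0] := leP 0 r; first by rewrite /B leb2_ball// ltry.
  rewrite (_ : B = set0) ?measure0// /B ball_pairE ((ball0 _ r).2 (ltW r0)).
  by rewrite eqEsubset; split => x [].
have := @measurable_bracketed R (mfrestr mB Bfin) A mA e e0.
move=> [U [F [oU cF FA AU]]]; rewrite /mfrestr /mrestr => mUF.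
have oB : open (ball (0 : R * R) r) by exact: ball_open.
exists (U `&` B); split.
- exact: openI.
- by move=> x [/NA/AU Ux Bx]; split.
- by move=> x [].
have mU : measurable (U : set (mplane R)) by exact: open_plane_measurable.
have mF : measurable (F : set (mplane R)) by exact: closed_plane_measurable.
apply: le_lt_trans mUF.
have -> : U `&` B = ((U `\` F) `&` B) `|` (F `&` B).
  rewrite eqEsubset; split => x; last by case=> [[[? ?] ?]|[/FA/AU ? ?]].
  by move=> [Ux Bx]; have [Fx|Fx] := pselect (F x); [right|left].
have F0 : (leb2 R (F `&` B) = 0)%E.
  apply/eqP; rewrite -measure_le0 -A0; apply: le_measure; rewrite ?inE//; first exact: measurableI.
  by move=> x [/FA].
have m1 : measurable ((U `\` F) `&` B : set (mplane R)).
  by apply: measurableI => //; exact: measurableD.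
have := measureU2 (leb2 R) m1 (measurableI _ _ mF mB).
by rewrite [X in (_ + X)%E]F0 adde0.
Qed.

(** * Subdivision of squares and null sets *)

(** Bisection: a square with [Psi > 0] has a quarter with [Psi > 0], and the nested squares shrink
    to a point near which the local hypothesis forbids this. [P] says which squares are
    admissible. *)
Lemma cousin_squares (R : realType) (P : R -> R -> R -> Prop)
    (Psi : R -> R -> R -> R) (a0 c0 h0 : R) :
  0 < h0 -> P a0 c0 h0 ->
  (forall a c h, 0 < h -> P a c (h * 2) ->
    [/\ P a c h, P (a + h) c h, P a (c + h) h, P (a + h) (c + h) h &
     Psi a c (h * 2) <= Psi a c h + Psi (a + h) c h + Psi a (c + h) h
                        + Psi (a + h) (c + h) h]) ->
  (forall x y, a0 <= x <= a0 + h0 -> c0 <= y <= c0 + h0 ->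
    exists2 d, 0 < d & forall a c h, P a c h -> 0 < h < d ->
      a <= x <= a + h -> c <= y <= c + h -> Psi a c h <= 0) ->
  Psi a0 c0 h0 <= 0.
Proof.
move=> h00 P0 sub loc; rewrite leNgt; apply/negP => Psi0.
pose bad (s : R * R * R) := [/\ P s.1.1 s.1.2 s.2, 0 < s.2 & 0 < Psi s.1.1 s.1.2 s.2].
have /choice [f fP] : forall s : R * R * R, exists s', bad s ->
    bad s' /\ [/\ s'.2 = s.2 / 2, s.1.1 <= s'.1.1, s'.1.1 + s'.2 <= s.1.1 + s.2,
     s.1.2 <= s'.1.2 & s'.1.2 + s'.2 <= s.1.2 + s.2].
  move=> [[a c] h]; have [bs|nbs] := pselect (bad (a, c, h)); last by exists (a, c, h).
  have [/= Ps hs Psis] := bs.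
  have k0 : 0 < h / 2 by rewrite divr_gt0.
  have hk : h = h / 2 * 2 by lra.
  rewrite hk in Ps Psis *; move: k0 Ps Psis; set k := h / 2; move=> k0 Ps Psis.
  have kk : k * 2 / 2 = k by lra.
  have [P1 P2 P3 P4 le4] := sub a c k k0 Ps.
  have [l1|g1] := ltP 0 (Psi a c k).
    by exists (a, c, k) => _; split; split => //=; lra.
  have [l2|g2] := ltP 0 (Psi (a + k) c k).
    by exists (a + k, c, k) => _; split; split => //=; lra.
  have [l3|g3] := ltP 0 (Psi a (c + k) k).
    by exists (a, c + k, k) => _; split; split => //=; lra.
  exists (a + k, c + k, k) => _; split; split => //=; lra.
pose s n := iter n f (a0, c0, h0).
have bs n : bad (s n).
  by elim: n => [|n IH] //=; case: (fP _ IH).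
have sS n : [/\ (s n.+1).2 = (s n).2 / 2, (s n).1.1 <= (s n.+1).1.1,
     (s n.+1).1.1 + (s n.+1).2 <= (s n).1.1 + (s n).2,
     (s n).1.2 <= (s n.+1).1.2 & (s n.+1).1.2 + (s n.+1).2 <= (s n).1.2 + (s n).2].
  by case: (fP _ (bs n)).
have sh n : (s n).2 = h0 / 2 ^+ n.
  elim: n => [|n IH]; first by rewrite expr0 divr1.
  by have [-> _ _ _ _] := sS n; rewrite IH exprS; field; rewrite expf_neq0.
have mon (p : R * R * R -> R) : (forall n, p (s n) <= p (s n.+1) /\
    p (s n.+1) + (s n.+1).2 <= p (s n) + (s n).2) ->
  exists x, forall n, p (s n) <= x <= p (s n) + (s n).2.
  move=> pS.
  have up n k : p (s n) <= p (s (n + k)%N).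
    elim: k => [|k IH]; first by rewrite addn0.
    by rewrite addnS; apply: le_trans IH _; case: (pS (n + k)%N).
  have dn n k : p (s (n + k)%N) + (s (n + k)%N).2 <= p (s n) + (s n).2.
    elim: k => [|k IH]; first by rewrite addn0.
    by rewrite addnS; apply: le_trans IH; case: (pS (n + k)%N).
  have ub n k : p (s n) <= p (s k) + (s k).2.
    apply: le_trans (up n k) _; rewrite addnC; apply: le_trans (dn k n).
    by rewrite lerDl; case: (bs (k + n)%N) => _ /ltW.
  exists (sup [set p (s n) | n in setT]) => n; apply/andP; split.
    apply: sup_upper_bound; last by exists n.
    split; first by exists (p (s n)); exists n.
    by exists (p (s n) + (s n).2) => _ [k _ <-].
  apply: ge_sup; first by exists (p (s n)); exists n.
  by move=> _ [k _ <-].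
have [x xP] := mon (fun s => s.1.1) (fun n => let: And5 _ h1 h2 _ _ := sS n in conj h1 h2).
have [y yP] := mon (fun s => s.1.2) (fun n => let: And5 _ _ _ h1 h2 := sS n in conj h1 h2).
have [d d0 dP] := loc x y (xP 0%N) (yP 0%N).
have dh0 : 0 < d / h0 by rewrite divr_gt0.
(* After n + 1 halvings the side is h0 / 2^(n + 1), at most h0 / (n + 1) and hence below d. *)
have [n _ /(_ n (leqnn n)) /= nd] := near_infty_natSinv_lt (PosNum dh0).
have [Pn hn Psin] := bs n.+1.
have : Psi (s n.+1).1.1 (s n.+1).1.2 (s n.+1).2 <= 0.
  apply: dP => //; rewrite hn sh andTb.
  rewrite -ltr_pdivlMl// mulrC; apply: le_lt_trans nd.
  rewrite lef_pV2 ?posrE ?exprn_gt0// -natrX ler_nat.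
  exact: ltnW (ltn_expl _ _).
by move/(lt_le_trans Psin); rewrite ltxx.
Qed.

Definition subsquare (R : realType) (a0 c0 h0 a c h : R) :=
  [/\ a0 <= a, a + h <= a0 + h0, c0 <= c & c + h <= c0 + h0].

(* The form in which null sets enter the subdivision argument [cousin_squares]. *)
Definition cousin_null (R : realType) (a0 c0 h0 : R) (bad : R -> R -> Prop) :=
  forall e, 0 < e -> exists nu : R -> R -> R -> R,
    [/\ forall a c h, subsquare a0 c0 h0 a c h -> nu a c h <= e,
     forall a c h, 0 < h -> subsquare a0 c0 h0 a c (h * 2) ->
       nu a c h + nu (a + h) c h + nu a (c + h) h + nu (a + h) (c + h) h <= nu a c (h * 2),
     forall a c h, 0 <= nu a c h &
     forall x y, a0 <= x <= a0 + h0 -> c0 <= y <= c0 + h0 -> bad x y ->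
       exists2 d, 0 < d & forall a c h, subsquare a0 c0 h0 a c h -> 0 < h < d ->
         a <= x <= a + h -> c <= y <= c + h -> h ^+ 2 <= nu a c h].

Lemma subsquare_trans (R : realType) (a0 c0 h0 a1 c1 h1 a c h : R) :
  subsquare a0 c0 h0 a1 c1 h1 -> subsquare a1 c1 h1 a c h -> subsquare a0 c0 h0 a c h.
Proof. by move=> [? ? ? ?] [? ? ? ?]; split; lra. Qed.

Lemma subsquare_itv (R : realType) (a0 c0 h0 a c h x y : R) : subsquare a0 c0 h0 a c h ->
  a <= x <= a + h -> c <= y <= c + h -> a0 <= x <= a0 + h0 /\ c0 <= y <= c0 + h0.
Proof. by move=> [? ? ? ?] /andP[? ?] /andP[? ?]; split; apply/andP; split; lra. Qed.

Lemma cousin_null_sub (R : realType) (a0 c0 h0 a1 c1 h1 : R) bad :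
  subsquare a0 c0 h0 a1 c1 h1 -> cousin_null a0 c0 h0 bad -> cousin_null a1 c1 h1 bad.
Proof.
move=> s1 n0 e e0; have [nu [nu1 nu2 nu3 nu4]] := n0 e e0.
exists nu; split => //.
- by move=> a c h s; apply: nu1; exact: subsquare_trans s.
- by move=> a c h hh s; apply: nu2 => //; exact: subsquare_trans s.
move=> x y xP yP bxy; have [x0P y0P] := subsquare_itv s1 xP yP.
have [d d0 dP] := nu4 x y x0P y0P bxy.
by exists d => // a c h s; apply: dP; exact: subsquare_trans s.
Qed.

Section Midpoint.
Context {R : realType}.
Implicit Types b t h d : R.

Lemma itv_half_lo b t h : 0 < h -> b < t < b + h -> b < t < b + h * 2.
Proof. by move=> h0 /andP[? ?]; apply/andP; split; lra. Qed.

Lemma itv_half_hi b t h : 0 < h -> b + h < t < b + h + h -> b < t < b + h * 2.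
Proof. by move=> h0 /andP[? ?]; apply/andP; split; lra. Qed.

Lemma midpoint_itv b h b0 h0 : 0 < h -> b0 <= b -> b + h <= b0 + h0 ->
  b0 <= b + h / 2 <= b0 + h0.
Proof. by move=> hh ? ?; apply/andP; split; lra. Qed.

Lemma midpoint_near b t h d : h < d -> b <= t -> t <= b + h -> `|t - (b + h / 2)| < d.
Proof. by move=> hd ? ?; rewrite ltr_norml; apply/andP; split; lra. Qed.

Lemma near_midpoint b t h : 0 < h -> `|b + h / 2 - t| <= h / 4 -> b < t < b + h.
Proof. by move=> h0; rewrite ler_norml => /andP[? ?]; apply/andP; split; lra. Qed.

End Midpoint.

Section NullImage.
Variables (R : realType) (N D : set (R * R)) (r : R) (W : R * R -> R * R) (X : R -> R -> R * R).
Variables (a0 c0 h0 L : R).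
Hypothesis N0 : (leb2 R).-negligible (N : set (mplane R)).
Hypothesis oD : open D.
Hypothesis Dr : D `<=` ball (0 : R * R) r.
Hypothesis L0 : 0 < L.
Hypothesis Wlip : forall z z' e, D z -> D z' -> ball z e z' ->
  `|(W z).1 - (W z').1| <= L * e /\ `|(W z).2 - (W z').2| <= L * e.
Hypothesis XD : forall x y, a0 <= x <= a0 + h0 -> c0 <= y <= c0 + h0 ->
  D (X x y) /\ W (X x y) = (x, y).
Hypothesis Xcont : forall x y, a0 <= x <= a0 + h0 -> c0 <= y <= c0 + h0 ->
  forall e, 0 < e -> exists2 d, 0 < d & forall x' y', a0 <= x' <= a0 + h0 ->
    c0 <= y' <= c0 + h0 -> `|x - x'| < d -> `|y - y'| < d -> ball (X x y) e (X x' y').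

(** Open squares, so that the sets attached to the four quarters are disjoint. *)
Let O (a c h : R) := [set z | D z /\ (a < (W z).1 < a + h /\ c < (W z).2 < c + h)].

Let open_O a c h : open (O a c h).
Proof.
rewrite openE => z [Dz [/andP[z1 z2] /andP[z3 z4]]].
have : nbhs z D by exact: open_nbhs_nbhs.
rewrite -nbhs_ballE => -[e /= e0 eD].
pose t := Num.min (Num.min ((W z).1 - a) (a + h - (W z).1)) (Num.min ((W z).2 - c) (c + h - (W z).2)).
have t0 : 0 < t by rewrite !lt_min !subr_gt0 z1 z2 z3 z4.
have [[t1 t2] [t3 t4]] : (t <= (W z).1 - a /\ t <= a + h - (W z).1) /\ (t <= (W z).2 - c /\ t <= c + h - (W z).2).
  by rewrite /t !ge_min !lexx ?orbT.
pose u := Num.min e (t / (2 * L)).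
have u0 : 0 < u by rewrite lt_min e0 divr_gt0// mulr_gt0.
have uL : L * u <= t / 2.
  have : u <= t / (2 * L) by rewrite /u ge_min lexx orbT.
  rewrite -(ler_pM2l L0); congr (_ <= _); field; exact: lt0r_neq0.
apply/nbhs_ballP; exists u => //= z' zz'.
have Dz' : D z' by apply: eD; apply: le_ball zz'; rewrite /u ge_min lexx.
have [] := Wlip Dz Dz' zz'; rewrite !ler_norml => /andP[? ?] /andP[? ?].
by split => //; split; apply/andP; split; lra.
Qed.

(** The weight of a square is 4 L^2 times the measure of the part of a small open cover [U] of [N]
    that [W] maps into it. It dominates the area h^2 because a ball of radius h / (4 L) around the
    preimage of the centre is mapped into the square. Only continuity of the inverse [X] is
    required, and no image of a null set has to be measured. *)
Lemma cousin_null_image : cousin_null a0 c0 h0 (fun x y => N (X x y)).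
Proof.
move=> e e0.
have k0 : 0 < 4 * L ^+ 2 by rewrite mulr_gt0// exprn_gt0.
have [U [oU NU Ur mU]] := negligible_open_cover r N0 (divr_gt0 e0 k0).
pose S a c h : set (mplane R) := U `&` O a c h.
have oS a c h : open (S a c h : set (R * R)) by exact: openI.
have mS a c h : measurable (S a c h) by exact: open_plane_measurable.
have mmU : measurable (U : set (mplane R)) by exact: open_plane_measurable.
have leU (A : set (mplane R)) : measurable A -> A `<=` U -> (leb2 R A <= leb2 R U)%E.
  by move=> mA AU; apply: le_measure; rewrite ?inE.
have finU (A : set (mplane R)) : measurable A -> A `<=` U -> leb2 R A \is a fin_num.
  move=> mA AU; rewrite ge0_fin_numE//; apply: le_lt_trans (leU _ mA AU) _.
  by apply: lt_trans mU _; rewrite ltry.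
pose m (A : set (mplane R)) := fine (leb2 R A).
have mono (A B : set (mplane R)) : measurable A -> measurable B -> A `<=` B -> B `<=` U -> m A <= m B.
  move=> mA mB AB BU; apply: fine_le; [exact: finU (subset_trans AB BU)|exact: finU|].
  by apply: le_measure; rewrite ?inE.
have madd (A B : set (mplane R)) : measurable A -> measurable B -> A `<=` U -> B `<=` U -> A `&` B = set0 ->
    m A + m B = m (A `|` B).
  move=> mA mB AU BU AB0; rewrite /m measureU//.
  by rewrite (fineD (finU _ mA AU) (finU _ mB BU)).
exists (fun a c h => 4 * L ^+ 2 * m (S a c h)); split.
- move=> a c h _; rewrite mulrC -ler_pdivlMr// -lee_fin /m fineK.
    by apply: ltW; apply: le_lt_trans mU; apply: leU => // z [].
  by apply: finU => // z [].
- move=> a c h hh _; rewrite -!mulrDr ler_pM2l//.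
  rewrite madd//; [|by move=> z []|by move=> z []|]; last first.
    rewrite -subset0 => z [[_ [_ [/andP[h1 h2] _]]] [_ [_ [/andP[h3 h4] _]]]].
    by have := lt_trans h2 h3; rewrite ltxx.
  rewrite madd//; [|exact: measurableU|by move=> z [[]|[]]|by move=> z []|]; last first.
    by rewrite -subset0 => z [[[_ [_ [/andP[? ?] /andP[? ?]]]]|[_ [_ [/andP[? ?] /andP[? ?]]]]] [_ [_ [/andP[? ?] /andP[? ?]]]]]; lra.
  rewrite madd//; [|by do 2?apply: measurableU|by move=> z [[[]|[]]|[]]|by move=> z []|]; last first.
    by rewrite -subset0 => z [[[[_ [_ [/andP[? ?] /andP[? ?]]]]|[_ [_ [/andP[? ?] /andP[? ?]]]]]|[_ [_ [/andP[? ?] /andP[? ?]]]]] [_ [_ [/andP[? ?] /andP[? ?]]]]]; lra.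
  apply: mono => //; [by do 3?apply: measurableU| |by move=> z []].
  have lo (b t : R) : b < t < b + h -> b < t < b + h * 2.
    exact: itv_half_lo.
  have hi (b t : R) : b + h < t < b + h + h -> b < t < b + h * 2.
    exact: itv_half_hi.
  by move=> z [[[[Uz [Dz [za zc]]]|[Uz [Dz [za zc]]]]|[Uz [Dz [za zc]]]]|[Uz [Dz [za zc]]]];
    split => //; split => //; split; (exact: lo || exact: hi).
- by move=> a c h; rewrite mulr_ge0// ?(ltW k0)// fine_ge0.
move=> x y xP yP Nxy.
have [Dxy Wxy] := XD xP yP.
have Uxy : U (X x y) by apply: NU; split => //; exact: Dr.
have : nbhs (X x y) (U `&` D) by apply: open_nbhs_nbhs; split => //; exact: openI.
rewrite -nbhs_ballE => -[s /= s0 sUD].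
have s20 : 0 < s / 2 by rewrite divr_gt0.
have [d d0 dP] := Xcont xP yP s20.
exists (Num.min d (s * L)); first by rewrite lt_min d0 mulr_gt0.
move=> a c h [q1 q2 q3 q4] /andP[hh]; rewrite lt_min => /andP[hd hs] /andP[x1 x2] /andP[y1 y2].
(* The centre of the square is used instead of the bad point, which may lie on the boundary. *)
pose x' := a + h / 2; pose y' := c + h / 2.
have x'P : a0 <= x' <= a0 + h0 by exact: midpoint_itv.
have y'P : c0 <= y' <= c0 + h0 by exact: midpoint_itv.
have [Dx' Wx'] := XD x'P y'P.
have bx : ball (X x y) (s / 2) (X x' y').
  by apply: dP => //; exact: midpoint_near.
pose t := h / (4 * L).
have t0 : 0 < t by rewrite divr_gt0// mulr_gt0.
have ts : t <= s / 2.
  rewrite /t ler_pdivrMr ?mulr_gt0//; lra.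
have tS : ball (X x' y') t `<=` S a c h.
  move=> z zP.
  have [Uz Dz] : (U `&` D) z.
    apply: sUD; rewrite [s]splitr; apply: ball_triangle bx _.
    exact: le_ball zP.
  split => //; split => //.
  have := Wlip Dx' Dz zP; rewrite Wx' /=.
  have -> : L * t = h / 4 by rewrite /t; field; exact: lt0r_neq0.
  by move=> [za zc]; split; apply: near_midpoint.
have mt : m (ball (X x' y') t) <= m (S a c h).
  apply: mono => //; last by move=> z [].
  by apply: open_plane_measurable; exact: ball_open.
apply: le_trans (ler_wpM2l (ltW k0) mt).
rewrite /m leb2_ball ?(ltW t0)//= /t le_eqVlt; apply/orP; left; apply/eqP.
field; exact: lt0r_neq0.
Qed.

End NullImage.

(** * Contour integrals over squares *)

Section ComplexModulus.
Context {R : rcfType}.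
Implicit Types z w : R[i].

Definition mkC (x y : R) : R[i] := Complex x y.
Definition cre z : R := complex.Re z.
Definition cim z : R := complex.Im z.
Definition cconj z : R[i] := mkC (cre z) (- cim z).
(** Real valued, unlike the norm of [R[i]], whose values lie in [R[i]]; all estimates take place in
    [R]. *)
Definition cabs z : R := Num.sqrt (cre z ^+ 2 + cim z ^+ 2).

Lemma cabsE z : cabs z = ComplexField.Normc.normc z.
Proof. by case: z. Qed.

Lemma mkC_eta z : mkC (cre z) (cim z) = z. Proof. by case: z. Qed.
Lemma creD z w : cre (z + w) = cre z + cre w. Proof. by case: z; case: w. Qed.
Lemma cimD z w : cim (z + w) = cim z + cim w. Proof. by case: z; case: w. Qed.
Lemma creN z : cre (- z) = - cre z. Proof. by case: z. Qed.
Lemma cimN z : cim (- z) = - cim z. Proof. by case: z. Qed.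
Lemma creM z w : cre (z * w) = cre z * cre w - cim z * cim w. Proof. by case: z; case: w. Qed.
Lemma cimM z w : cim (z * w) = cre z * cim w + cim z * cre w. Proof. by case: z; case: w. Qed.
Lemma cre1 : cre 1 = 1. Proof. by []. Qed.
Lemma cim1 : cim 1 = 0. Proof. by []. Qed.
Lemma cre0 : cre 0 = 0. Proof. by []. Qed.
Lemma cim0 : cim 0 = 0. Proof. by []. Qed.
Lemma cre_mk x y : cre (mkC x y) = x. Proof. by []. Qed.
Lemma cim_mk x y : cim (mkC x y) = y. Proof. by []. Qed.
Definition cE := (creD, cimD, creN, cimN, creM, cimM, cre1, cim1, cre0, cim0, cre_mk, cim_mk).

Lemma cplx_eq z w : cre z = cre w -> cim z = cim w -> z = w.
Proof. by case: z; case: w => a b c d /= -> ->. Qed.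

Lemma cconjE z : (cre (cconj z) = cre z) * (cim (cconj z) = - cim z). Proof. by []. Qed.

Lemma cconjM z w : cconj (z * w) = cconj z * cconj w.
Proof. by apply: cplx_eq; rewrite !(cE, cconjE); ring. Qed.
Lemma cconjD z w : cconj (z + w) = cconj z + cconj w.
Proof. by apply: cplx_eq; rewrite !(cE, cconjE); ring. Qed.
Lemma cconjN z : cconj (- z) = - cconj z.
Proof. by apply: cplx_eq; rewrite !(cE, cconjE); ring. Qed.

Lemma cabs_ge0 z : 0 <= cabs z. Proof. exact: sqrtr_ge0. Qed.
Lemma cabs0 : cabs 0 = 0. Proof. by rewrite cabsE ComplexField.Normc.normc0. Qed.
Lemma cabs1 : cabs 1 = 1. Proof. by rewrite cabsE ComplexField.Normc.normc1. Qed.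
Lemma cabsM z w : cabs (z * w) = cabs z * cabs w.
Proof. by rewrite !cabsE; exact: ComplexField.Normc.normcM. Qed.
Lemma cabsV z : cabs z^-1 = (cabs z)^-1.
Proof. by rewrite !cabsE; exact: ComplexField.Normc.normcV. Qed.
Lemma cabsN z : cabs (- z) = cabs z.
Proof. by rewrite /cabs !cE !sqrrN. Qed.
Lemma cabsJ z : cabs (cconj z) = cabs z.
Proof. by rewrite /cabs !cconjE sqrrN. Qed.
Lemma cabsD z w : cabs (z + w) <= cabs z + cabs w.
Proof. by rewrite !cabsE; exact: le_normcD. Qed.
Lemma cabsB z w : cabs (z - w) <= cabs z + cabs w.
Proof. by rewrite -(cabsN w); exact: cabsD. Qed.
Lemma cabsC z w : cabs (z - w) = cabs (w - z).
Proof. by rewrite -cabsN opprB. Qed.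
Lemma cabs_eq0 z : (cabs z == 0) = (z == 0).
Proof.
apply/eqP/eqP => [|->]; last exact: cabs0.
by rewrite cabsE => /ComplexField.Normc.eq0_normc.
Qed.
Lemma cabs_gt0 z : (0 < cabs z) = (z != 0).
Proof. by rewrite lt_neqAle cabs_ge0 andbT eq_sym cabs_eq0. Qed.
Lemma cabs_sqr z : cabs z ^+ 2 = cre z ^+ 2 + cim z ^+ 2.
Proof. by rewrite sqr_sqrtr// addr_ge0 ?sqr_ge0. Qed.
Lemma cre_le z : `|cre z| <= cabs z.
Proof. by rewrite -ler_sqr ?nnegrE ?cabs_ge0// cabs_sqr real_normK ?num_real// lerDl sqr_ge0. Qed.
Lemma cim_le z : `|cim z| <= cabs z.
Proof. by rewrite -ler_sqr ?nnegrE ?cabs_ge0// cabs_sqr real_normK ?num_real// lerDr sqr_ge0. Qed.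
Lemma cabs_le z : cabs z <= `|cre z| + `|cim z|.
Proof.
rewrite -ler_sqr ?nnegrE ?cabs_ge0 ?addr_ge0// cabs_sqr sqrrD !real_normK ?num_real//.
by rewrite -addrA lerD2l lerDr mulrn_wge0// mulr_ge0.
Qed.
Lemma cabs_real (x : R) : cabs (mkC x 0) = `|x|.
Proof. by rewrite /cabs !cE expr0n addr0 sqrtr_sqr. Qed.
Lemma cabsBB z w : cabs z - cabs w <= cabs (z - w).
Proof. by rewrite lerBlDr; apply: le_trans (cabsD _ _); rewrite subrK. Qed.
End ComplexModulus.

Section LineIntegral.
Context {R : realType}.
Implicit Types (g : R -> R) (a b : R).

Definition lint g a b : R := \int[@lebesgue_measure R]_(x in `[a, b]) g x.

Definition cont_on g a b := forall x, a <= x <= b -> {for x, continuous g}.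

Lemma cont_on_integrable g a b : cont_on g a b ->
  (@lebesgue_measure R).-integrable `[a, b] (EFin \o g).
Proof.
move=> cg; apply: continuous_compact_integrable; first exact: segment_compact.
apply: continuous_in_subspaceT => x; rewrite inE /= in_itv /= => xab; exact: cg.
Qed.

Lemma lint_split g a b c : a <= b -> b <= c -> cont_on g a c ->
  lint g a c = lint g a b + lint g b c.
Proof.
move=> ab bc cg; have ig := cont_on_integrable cg.
have := Rintegral_itvB (x := b) ig; rewrite !bnd_simp => /(_ ab bc) h.
apply/eqP; rewrite addrC -subr_eq; apply/eqP; apply: etrans h _.
apply: Rintegral_itv_obnd_cbnd.
apply: (integrableS _ _ _ ig) => //=.
by move=> x /=; rewrite !in_itv /= => /andP[bx ->]; rewrite (le_trans ab)// ltW.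
Qed.

Lemma lintB_le g1 g2 a b M : a <= b -> cont_on g1 a b -> cont_on g2 a b ->
  (forall x, a <= x <= b -> g1 x - g2 x <= M) ->
  lint g1 a b - lint g2 a b <= M * (b - a).
Proof.
move=> ab c1 c2 gM.
have i1 := cont_on_integrable c1; have i2 := cont_on_integrable c2.
have ic : (@lebesgue_measure R).-integrable `[a, b] (EFin \o (cst M)).
  by apply: cont_on_integrable => x _; exact: cvg_cst.
have -> : M * (b - a) = \int[@lebesgue_measure R]_(x in `[a, b]) (cst M x).
  rewrite Rintegral_cst//= lebesgue_measure_itv /= lte_fin.
  move: ab; rewrite le_eqVlt => /predU1P[->|->]; last by rewrite -EFinB.
  by rewrite ltxx subrr !mulr0.
rewrite -RintegralB//; apply: le_Rintegral => //.
have := integrableB _ i1 i2; rewrite (_ : (_ \- _)%E = EFin \o (fun x => g1 x - g2 x)) //.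
by apply.
Qed.

Lemma lint_le g a b M : a <= b -> cont_on g a b ->
  (forall x, a <= x <= b -> g x <= M) -> lint g a b <= M * (b - a).
Proof.
move=> ab cg gM; have c0 : cont_on (cst 0 : R -> R) a b by move=> x _; exact: cvg_cst.
have := lintB_le (M := M) ab cg c0; rewrite [lint (cst 0) _ _]Rintegral_cst// mul0r subr0.
by apply=> x xab; rewrite subr0 gM.
Qed.

Lemma lint_ge g a b M : a <= b -> cont_on g a b ->
  (forall x, a <= x <= b -> M <= g x) -> M * (b - a) <= lint g a b.
Proof.
move=> ab cg gM; have c0 : cont_on (cst 0 : R -> R) a b by move=> x _; exact: cvg_cst.
have := lintB_le (M := - M) ab c0 cg; rewrite [lint (cst 0) _ _]Rintegral_cst// mul0r sub0r.
rewrite mulNr lerN2; apply=> x xab; rewrite sub0r lerN2; exact: gM.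
Qed.

End LineIntegral.

Section Contour.
Context {R : realType}.
Implicit Types (f : R[i] -> R[i]) (p : R[i]).

Definition ccont f p := forall e, 0 < e ->
  exists2 d, 0 < d & forall q, cabs (q - p) < d -> cabs (f q - f p) < e.

(* [be] is the value of dbar f at p. *)
Definition cdiff f p be := exists al : R[i], forall e, 0 < e ->
  exists2 d, 0 < d & forall h, cabs h < d ->
    cabs (f (p + h) - f p - al * h - be * cconj h) <= e * cabs h.

Definition loclip f p := exists L d, [/\ 0 < L, 0 < d & forall q q',
  cabs (q - p) < d -> cabs (q' - p) < d -> cabs (f q - f q') <= L * cabs (q - q')].

Lemma loclip_cont f p : loclip f p -> ccont f p.
Proof.
move=> [L [d [L0 d0 fL]]] e e0; exists (Num.min d (e / L)); first by rewrite lt_min d0 divr_gt0.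
move=> q; rewrite lt_min => /andP[qd qe].
apply: le_lt_trans (fL q p qd _) _; first by rewrite subrr cabs0.
by rewrite mulrC -ltr_pdivlMr.
Qed.

(* Imaginary part of the counterclockwise integral of f dz over the boundary of the square of corner a + i c and side h. *)
Definition coint f a c h : R :=
  lint (fun x => cim (f (mkC x c))) a (a + h)
  - lint (fun x => cim (f (mkC x (c + h)))) a (a + h)
  + (lint (fun y => cre (f (mkC (a + h) y))) c (c + h)
  - lint (fun y => cre (f (mkC a y))) c (c + h)).

(** Continuity is asked on the boundary only, so that poles may lie inside the square. *)
Definition edge_cont f a c h := forall x y, a <= x <= a + h -> c <= y <= c + h ->
  (x = a \/ x = a + h) \/ (y = c \/ y = c + h) -> ccont f (mkC x y).

Lemma ccont_hor f a b c : (forall x, a <= x <= b -> ccont f (mkC x c)) ->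
  cont_on (fun x => cim (f (mkC x c))) a b /\ cont_on (fun x => cre (f (mkC x c))) a b.
Proof.
move=> cf; split => x xab; apply/cvgrPdist_lt => e e0;
  have [d d0 dP] := cf x xab e e0; apply/nbhs_ballP; exists d => //= t; rewrite /ball /= => xt.
- rewrite -cimN -cimD; apply: le_lt_trans (cim_le _) _; rewrite cabsC; apply: dP.
  have -> : mkC t c - mkC x c = mkC (t - x) 0 by apply: cplx_eq; rewrite !cE; ring.
  by rewrite cabs_real distrC.
- rewrite -creN -creD; apply: le_lt_trans (cre_le _) _; rewrite cabsC; apply: dP.
  have -> : mkC t c - mkC x c = mkC (t - x) 0 by apply: cplx_eq; rewrite !cE; ring.
  by rewrite cabs_real distrC.
Qed.

Lemma cabs_imag (x : R) : cabs (mkC 0 x) = `|x|.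
Proof. by rewrite /cabs !cE expr0n add0r sqrtr_sqr. Qed.

Lemma ccont_ver f a b c : (forall x, a <= x <= b -> ccont f (mkC c x)) ->
  cont_on (fun x => cre (f (mkC c x))) a b.
Proof.
move=> cf x xab; apply/cvgrPdist_lt => e e0;
  have [d d0 dP] := cf x xab e e0; apply/nbhs_ballP; exists d => //= t; rewrite /ball /= => xt.
rewrite -creN -creD; apply: le_lt_trans (cre_le _) _; rewrite cabsC; apply: dP.
have -> : mkC c t - mkC c x = mkC 0 (t - x) by apply: cplx_eq; rewrite !cE; ring.
by rewrite cabs_imag distrC.
Qed.

Lemma edge_cont_lint f a c h : 0 <= h -> edge_cont f a c h ->
  [/\ cont_on (fun x => cim (f (mkC x c))) a (a + h),
      cont_on (fun x => cim (f (mkC x (c + h)))) a (a + h),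
      cont_on (fun y => cre (f (mkC (a + h) y))) c (c + h) &
      cont_on (fun y => cre (f (mkC a y))) c (c + h)].
Proof.
move=> h0 ef.
have ch : c <= c <= c + h /\ c <= c + h <= c + h by split; apply/andP; split; lra.
have ah : a <= a <= a + h /\ a <= a + h <= a + h by split; apply/andP; split; lra.
split.
- by have [] := @ccont_hor f a (a + h) c => // x xP; apply: ef => //; [tauto|right; left].
- by have [] := @ccont_hor f a (a + h) (c + h) => // x xP; apply: ef => //; [tauto|right; right].
- by apply: ccont_ver => y yP; apply: ef => //; [tauto|left; right].
- by apply: ccont_ver => y yP; apply: ef => //; [tauto|left; left].
Qed.

(** Each inner edge is traversed twice in opposite directions. *)
Lemma coint_split f a c h : 0 < h -> edge_cont f a c (h * 2) -> edge_cont f a c h ->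
  edge_cont f (a + h) c h -> edge_cont f a (c + h) h -> edge_cont f (a + h) (c + h) h ->
  coint f a c (h * 2) = coint f a c h + coint f (a + h) c h + coint f a (c + h) h
                        + coint f (a + h) (c + h) h.
Proof.
move=> h0 e0 e1 e2 e3 e4.
have [b1 b2 b3 b4] := edge_cont_lint (ltW (mulr_gt0 h0 (ltr0n R 2))) e0.
have m1 (t : R) : t <= t + h by rewrite lerDl ltW.
have m2 (t : R) : t + h <= t + h * 2 by lra.
have s1 := lint_split (m1 a) (m2 a) b1.
have s2 := lint_split (m1 a) (m2 a) b2.
have s3 := lint_split (m1 c) (m2 c) b3.
have s4 := lint_split (m1 c) (m2 c) b4.
rewrite /coint s1 s2 s3 s4.
have ea : a + h * 2 = a + h + h by ring.
have ec : c + h * 2 = c + h + h by ring.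
rewrite !ea !ec; ring.
Qed.

Lemma coint_le f a c h M1 M2 : 0 <= h -> edge_cont f a c h ->
  (forall x, a <= x <= a + h -> cim (f (mkC x c)) - cim (f (mkC x (c + h))) <= M1) ->
  (forall y, c <= y <= c + h -> cre (f (mkC (a + h) y)) - cre (f (mkC a y)) <= M2) ->
  coint f a c h <= (M1 + M2) * h.
Proof.
move=> h0 ef f1 f2; have [b1 b2 b3 b4] := edge_cont_lint h0 ef.
have ah : a <= a + h by lra.
have ch : c <= c + h by lra.
rewrite mulrDl; apply: lerD.
  by have := lintB_le ah b1 b2 f1; rewrite (_ : a + h - a = h)//; ring.
by have := lintB_le ch b3 b4 f2; rewrite (_ : c + h - c = h)//; ring.
Qed.

(** Opposite sides are paired, and each pair costs [L * h] per unit of length. This crude bound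
    serves on the squares that meet the exceptional null set. *)
Lemma coint_lip f a c h L : 0 <= h -> edge_cont f a c h ->
  (forall x y x' y', a <= x <= a + h -> c <= y <= c + h -> a <= x' <= a + h -> c <= y' <= c + h ->
    cabs (f (mkC x y) - f (mkC x' y')) <= L * cabs (mkC x y - mkC x' y')) ->
  coint f a c h <= 2 * L * h ^+ 2.
Proof.
move=> h0 ef fL.
have -> : 2 * L * h ^+ 2 = (L * h + L * h) * h by ring.
have ch : c <= c <= c + h /\ c <= c + h <= c + h by split; apply/andP; split; lra.
have ah : a <= a <= a + h /\ a <= a + h <= a + h by split; apply/andP; split; lra.
apply: coint_le => // [x xP|y yP].
  have /= := fL x c x (c + h) xP ch.1 xP ch.2.
  have -> : mkC x c - mkC x (c + h) = mkC 0 (- h) by apply: cplx_eq; rewrite !cE; ring.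
  rewrite cabs_imag normrN ger0_norm//; apply: le_trans.
  by rewrite -cimN -cimD; apply: le_trans (cim_le _); exact: ler_norm.
have /= := fL (a + h) y a y ah.2 yP ah.1 yP.
have -> : mkC (a + h) y - mkC a y = mkC h 0 by apply: cplx_eq; rewrite !cE; ring.
rewrite cabs_real ger0_norm//; apply: le_trans.
by rewrite -creN -creD; apply: le_trans (cre_le _); exact: ler_norm.
Qed.

Lemma cabs_insq (x y x' y' h : R) : `|x - x'| <= h -> `|y - y'| <= h ->
  cabs (mkC x y - mkC x' y') <= 2 * h.
Proof.
by move=> hx hy; apply: le_trans (cabs_le _) _; rewrite !cE mulr_natl mulr2n; apply: lerD.
Qed.

(** The affine part contributes exactly 2 h^2 Re(be): constants and [al] z integrate to zero, and
    the integral of conj z dz is 2 i times the area. *)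
Lemma coint_cdiff f x y be e : cdiff f (mkC x y) be -> cre be <= 0 -> 0 < e ->
  exists2 d, 0 < d & forall a c h, edge_cont f a c h -> 0 < h < d ->
    a <= x <= a + h -> c <= y <= c + h -> coint f a c h <= e * h ^+ 2.
Proof.
move=> [al fd] be0 e0.
(* Points of the square lie within 2 h of the point of expansion, so each remainder is at most (e /
   4) h and the four sides together give e h^2. *)
have e80 : 0 < e / 8 by rewrite divr_gt0.
have [d d0 dP] := fd _ e80.
exists (d / 2); first by rewrite divr_gt0.
move=> a c h ef /andP[h0 hd] xP yP.
have est x' y' : a <= x' <= a + h -> c <= y' <= c + h ->
    cabs (f (mkC x' y') - f (mkC x y) - al * (mkC x' y' - mkC x y) - be * cconj (mkC x' y' - mkC x y)) <= e / 4 * h.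
  move=> x'P y'P.
  have hk : cabs (mkC x' y' - mkC x y) <= 2 * h.
    apply: cabs_insq; rewrite ler_norml; apply/andP; lra.
  have := dP (mkC x' y' - mkC x y); rewrite [mkC x y + _]addrC subrK => /(_ _)/le_trans; apply.
    by apply: le_lt_trans hk _; lra.
  have -> : e / 4 * h = e / 8 * (2 * h) by field.
  by rewrite ler_pM2l.
pose a1 := cre al; pose b1 := cre be.
apply: (@le_trans _ _ ((- (h * (a1 - b1)) + e / 2 * h + (h * (a1 + b1) + e / 2 * h)) * h)).
  have ch : c <= c <= c + h /\ c <= c + h <= c + h by split; apply/andP; split; lra.
  have ah : a <= a <= a + h /\ a <= a + h <= a + h by split; apply/andP; split; lra.
  apply: coint_le => //; first exact: ltW.
    move=> t tP; have := est t c tP ch.1; have := est t (c + h) tP ch.2.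
    move=> /(le_trans (cim_le _)) + /(le_trans (cim_le _)).
    rewrite !(cE, cconjE) !ler_norml => /andP[h1 h2] /andP[h3 h4].
    by rewrite /a1 /b1; nra.
  move=> t tP; have := est a t ah.1 tP; have := est (a + h) t ah.2 tP.
  move=> /(le_trans (cre_le _)) + /(le_trans (cre_le _)).
  rewrite !(cE, cconjE) !ler_norml => /andP[h1 h2] /andP[h3 h4].
  by rewrite /a1 /b1; nra.
have -> : (- (h * (a1 - b1)) + e / 2 * h + (h * (a1 + b1) + e / 2 * h)) * h = e * h ^+ 2 + 2 * b1 * h ^+ 2 by field.
rewrite gerDl pmulr_lle0 ?exprn_gt0// pmulr_rle0//.
Qed.

End Contour.

Definition dyadic_closed (R : realType) (P : R -> R -> R -> Prop) := forall a c h, 0 < h ->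
  P a c (h * 2) -> [/\ P a c h, P (a + h) c h, P a (c + h) h & P (a + h) (c + h) h].

Lemma subsquare_refl (R : realType) (a c h : R) : subsquare a c h a c h.
Proof. by split. Qed.

Lemma subsquare_closed (R : realType) (a0 c0 h0 : R) : dyadic_closed (subsquare a0 c0 h0).
Proof. by move=> a c h hh [? ? ? ?]; split; split; lra. Qed.

Lemma finite_points_away (R : realType) (S : seq (R * R)) x y : (x, y) \notin S ->
  exists2 d : R, 0 < d & forall s, s \in S -> d <= cabs (mkC s.1 s.2 - mkC x y).
Proof.
elim: S => [|s S IH]; first by exists 1.
rewrite inE negb_or => /andP[xs /IH [d d0 dP]].
exists (Num.min d (cabs (mkC s.1 s.2 - mkC x y))).
  rewrite lt_min d0 cabs_gt0 subr_eq0; apply: contra xs => /eqP [<- <-].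
  by case: s.
move=> t; rewrite inE => /predU1P[->|/dP]; first by rewrite ge_min lexx orbT.
by rewrite ge_min => ->.
Qed.

(** * Sign of contour integrals from the sign of the dbar-derivative *)

Section Stokes.
Context {R : realType}.
Variables (f : R[i] -> R[i]) (P : R -> R -> R -> Prop) (bad : R -> R -> Prop).
Hypothesis Pclosed : dyadic_closed P.
Hypothesis Pedge : forall a c h, P a c h -> edge_cont f a c h.

(** Bisection is applied to the integral minus [e1 * h ^+ 2] minus [2 * L * nu]. At a good point the
    first correction absorbs the differentiation error; at a bad point the second dominates the
    Lipschitz bound. On the whole square the corrections amount to at most [e]. *)
Lemma stokes_regular a0 c0 h0 L : 0 < h0 -> P a0 c0 h0 -> 0 < L ->
  cousin_null a0 c0 h0 bad ->
  (forall x y x' y', a0 <= x <= a0 + h0 -> c0 <= y <= c0 + h0 ->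
    a0 <= x' <= a0 + h0 -> c0 <= y' <= c0 + h0 ->
    cabs (f (mkC x y) - f (mkC x' y')) <= L * cabs (mkC x y - mkC x' y')) ->
  (forall x y, a0 <= x <= a0 + h0 -> c0 <= y <= c0 + h0 -> bad x y \/
     exists2 be, cdiff f (mkC x y) be & cre be <= 0) ->
  coint f a0 c0 h0 <= 0.
Proof.
move=> h00 P0 L0 nbad fL good.
apply/ler_addgt0Pl => e e0; rewrite addr0.
have k0 : 0 < h0 ^+ 2 by rewrite exprn_gt0.
pose e1 := e / 2 / h0 ^+ 2.
have e10 : 0 < e1 by rewrite !divr_gt0.
pose e2 := e / 2 / (2 * L).
have L20 : 0 < 2 * L by rewrite mulr_gt0.
have e20 : 0 < e2 by rewrite !divr_gt0.
have [nu [nu1 nu2 nu3 nu4]] := nbad e2 e20.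
pose P' a c h := P a c h /\ subsquare a0 c0 h0 a c h.
have : coint f a0 c0 h0 - e1 * h0 ^+ 2 - 2 * L * nu a0 c0 h0 <= 0.
  apply: (@cousin_squares R P' (fun a c h => coint f a c h - e1 * h ^+ 2 - 2 * L * nu a c h)) => //.
  - move=> a c h h0' [Ph sh].
    have [p1 p2 p3 p4] := Pclosed h0' Ph.
    have [s1 s2 s3 s4] := subsquare_closed h0' sh.
    split => //; rewrite coint_split//; do ?exact: Pedge.
    have := nu2 a c h h0' sh; rewrite -(ler_pM2l L20) exprMn; lra.
  - move=> x y xP yP.
    have := good x y xP yP => -[bxy|[be fd be0]].
      have [d d0 dP] := nu4 x y xP yP bxy.
      exists d => // a c h [Ph sh] hd xa yc.
      have := dP a c h sh hd xa yc; rewrite -(ler_pM2l L20).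
      have : coint f a c h <= 2 * L * h ^+ 2.
        case/andP: hd => hh _.
        apply: coint_lip; [exact: ltW|exact: Pedge|].
        move=> x1 y1 x2 y2 x1P y1P x2P y2P; have [? ?] := subsquare_itv sh x1P y1P.
        by have [? ?] := subsquare_itv sh x2P y2P; exact: fL.
      by have := mulr_ge0 (ltW e10) (sqr_ge0 h); lra.
    have [d d0 dP] := coint_cdiff fd be0 e10.
    exists d => // a c h [Ph sh] hd xa yc.
    have := dP a c h (Pedge Ph) hd xa yc.
    by have := mulr_ge0 (ltW L20) (nu3 a c h); lra.
have -> : e1 * h0 ^+ 2 = e / 2 by rewrite /e1; field; exact: lt0r_neq0.
have := nu1 a0 c0 h0 (subsquare_refl _ _ _); rewrite -(ler_pM2l L20).
have -> : 2 * L * e2 = e / 2 by rewrite /e2; field; exact: lt0r_neq0.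
lra.
Qed.

Variable S : seq (R * R).
Hypothesis Sedge : forall a c h s, P a c h -> s \in S -> s.1 != a + h /\ s.2 != c + h.

(** Each singular point is charged the amount [e1], counted in half-open squares so that the count
    is additive under quartering. [Sedge] keeps these points off the right and top sides, so an
    admissible square containing one really counts it. *)
Lemma stokes_singular a0 c0 h0 : 0 < h0 -> P a0 c0 h0 ->
  cousin_null a0 c0 h0 bad ->
  (forall x y, a0 <= x <= a0 + h0 -> c0 <= y <= c0 + h0 -> (x, y) \notin S ->
    loclip f (mkC x y) /\ (bad x y \/ exists2 be, cdiff f (mkC x y) be & cre be <= 0)) ->
  (forall x y, a0 <= x <= a0 + h0 -> c0 <= y <= c0 + h0 -> (x, y) \in S ->
    forall e, 0 < e -> exists2 d, 0 < d & forall a c h, P a c h -> subsquare a0 c0 h0 a c h ->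
      0 < h < d -> a <= x <= a + h -> c <= y <= c + h -> coint f a c h <= e) ->
  coint f a0 c0 h0 <= 0.
Proof.
move=> h00 P0 nbad reg sing.
apply/ler_addgt0Pl => e e0; rewrite addr0.
pose ind (s : R * R) a c h : R := ((a <= s.1 < a + h) && (c <= s.2 < c + h))%:R.
(* One more than the number of points, to allow the division when [S] is empty. *)
pose N : R := (size S).+1%:R.
have N0 : 0 < N by rewrite ltr0n.
pose cnt a c h := \sum_(s <- S) ind s a c h.
have cnt0 a c h : 0 <= cnt a c h by apply: sumr_ge0 => s _; rewrite ler0n.
have e10' : 0 < e / N by rewrite divr_gt0.
have [e1 e10 e1E] : exists2 e1, 0 < e1 & e1 = e / N by exists (e / N).
pose P' a c h := P a c h /\ subsquare a0 c0 h0 a c h.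
have : coint f a0 c0 h0 - e1 * cnt a0 c0 h0 <= 0.
  apply: (@cousin_squares R P' (fun a c h => coint f a c h - e1 * cnt a c h)) => //.
  - move=> a c h h0' [Ph sh].
    have [p1 p2 p3 p4] := Pclosed h0' Ph.
    have [s1 s2 s3 s4] := subsquare_closed h0' sh.
    split => //; rewrite coint_split//; do ?exact: Pedge.
    have : cnt a c h + cnt (a + h) c h + cnt a (c + h) h + cnt (a + h) (c + h) h <= cnt a c (h * 2).
      rewrite /cnt -!big_split /=; apply: ler_sum => s _; rewrite /ind.
      have -> : a + h + h = a + h * 2 by ring.
      have -> : c + h + h = c + h * 2 by ring.
      have half (b t : R) : (b <= t)%R%:R * (t < b + h * 2)%R%:R =
          (b <= t)%R%:R * (t < b + h)%R%:R + (b + h <= t)%R%:R * (t < b + h * 2)%R%:R :> R.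
        by case: (leP b t); case: (leP (b + h) t); case: (ltP t (b + h * 2)) => /= *; lra.
      have andM (A B : bool) : (A && B)%:R = A%:R * B%:R :> R by rewrite -natrM mulnb.
      rewrite !andM !half.
      by rewrite le_eqVlt; apply/orP; left; apply/eqP; ring.
    by rewrite -(ler_pM2l e10); lra.
  - move=> x y xP yP.
    have [sS|sS] := boolP ((x, y) \in S).
      have [d d0 dP] := sing x y xP yP sS _ e10.
      exists d => // a c h [Ph sh] hd xa yc.
      have := dP a c h Ph sh hd xa yc.
      suff : 1 <= cnt a c h by rewrite -(ler_pM2l e10); lra.
      have [/= n1 n2] := Sedge Ph sS.
      rewrite /cnt (big_rem _ sS) /= /ind /=.
      have -> : (a <= x < a + h) && (c <= y < c + h).
        case/andP: xa => -> xa; case/andP: yc => -> yc.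
        by rewrite !lt_neqAle n1 n2 xa yc.
      by rewrite lerDl; apply: sumr_ge0 => s _; rewrite ler0n.
    (* Small squares near a regular point avoid [S] and carry a Lipschitz bound, so the regular case
       applies to them directly. *)
    have [[L [d [L0 d0 fL]]] good] := reg x y xP yP sS.
    have [t t0 tP] := finite_points_away sS.
    exists (Num.min d t / 2); first by rewrite divr_gt0// lt_min d0.
    move=> a c h [Ph sh] /andP[hh hd] xa yc.
    suff : coint f a c h <= 0 by have := mulr_ge0 (ltW e10) (cnt0 a c h); lra.
    have ind_ x' y' : a <= x' <= a + h -> c <= y' <= c + h -> cabs (mkC x' y' - mkC x y) < Num.min d t.
      move=> x'P y'P; apply: (@le_lt_trans _ _ (2 * h)); last by lra.
      by apply: cabs_insq; rewrite ler_norml; lra.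
    apply: (@stokes_regular a c h L) => //.
    + exact: cousin_null_sub sh nbad.
    + move=> x1 y1 x2 y2 x1P y1P x2P y2P.
      have := ind_ _ _ x1P y1P; have := ind_ _ _ x2P y2P.
      by rewrite !lt_min => /andP[+ _] /andP[+ _] => ? ?; apply: fL.
    move=> x1 y1 x1P y1P.
    have x1S : (x1, y1) \notin S.
      apply/negP => /tP /=; have := ind_ _ _ x1P y1P; rewrite lt_min => /andP[_].
      by move=> /lt_le_trans lt /lt; rewrite ltxx.
    have [x1P' y1P'] := subsquare_itv sh x1P y1P.
    by have [_] := reg x1 y1 x1P' y1P' x1S.
have cntS : cnt a0 c0 h0 <= N.
  rewrite /cnt /N; apply: (@le_trans _ _ (size S)%:R); last by rewrite ler_nat.
  elim: S => [|s T IH]; first by rewrite big_nil.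
  by rewrite big_cons /= mulrSr addrC lerD// /ind lern1 leq_b1.
have : e1 * cnt a0 c0 h0 <= e1 * N by rewrite ler_pM2l.
have -> : e1 * N = e by rewrite e1E; field; exact: lt0r_neq0.
lra.
Qed.

End Stokes.

(** * Rules for local Lipschitz bounds and dbar-derivatives *)

Section RealCalculus.
Context {R : realType}.
Implicit Types (phi : R -> R) (t : R).

Definition lip1 phi t := exists L d, [/\ 0 < L, 0 < d & forall x y,
  `|x - t| < d -> `|y - t| < d -> `|phi x - phi y| <= L * `|x - y|].

Definition der1 phi t k := forall e, 0 < e -> exists2 d, 0 < d & forall s, `|s| < d ->
  `|phi (t + s) - phi t - k * s| <= e * `|s|.

Lemma is_derive_der1 phi t k : is_derive t 1 phi k -> der1 phi t k.
Proof.
move=> [dphi pk] e e0.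
have : h^-1 *: (phi (h *: 1 + t) - phi t) @[h --> 0^'] --> k.
  by rewrite -pk; exact: dphi.
move/cvgrPdist_le => /(_ e e0); rewrite near_withinE => /nbhs_ballP[d /= d0 dP].
exists d => // s sd; have [->|s0] := eqVneq s 0; first by rewrite addr0 mulr0 !subrr normr0 mulr0.
have := dP s; rewrite /ball /= sub0r normrN => /(_ sd s0).
rewrite -(ler_pM2r (x := `|s|)) ?normr_gt0// -normrM distrC mulrBl.
have -> : s^-1 *: (phi (s *: 1 + t) - phi t) * s = phi (t + s) - phi t.
  by rewrite /GRing.scale /= mulr1 mulrC mulrA divff// mul1r (addrC s).
by [].
Qed.

Lemma is_derive_lip1 phi (psi : R -> R) t d : 0 < d ->
  (forall x, `|x - t| < d -> is_derive x 1 phi (psi x)) -> {for t, continuous psi} ->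
  lip1 phi t.
Proof.
move=> d0 dphi cpsi.
move/cvgrPdist_lt : cpsi => /(_ 1 ltr01) /nbhs_ballP[r /= r0 rP].
exists (`|psi t| + 1), (Num.min d r); split; [by rewrite ltr_wpDl|by rewrite lt_min d0|].
have key x y : x <= y -> `|x - t| < Num.min d r -> `|y - t| < Num.min d r ->
    `|phi x - phi y| <= (`|psi t| + 1) * `|x - y|.
  move=> xy; rewrite !lt_min => /andP[xd xr] /andP[yd yr].
  have bet c : x <= c <= y -> `|c - t| < d /\ `|c - t| < r.
    by move: xd xr yd yr; rewrite !ltr_norml => *; split; lra.
  have [||c] := @MVT_segment R phi psi x y xy.
  - by move=> c; rewrite in_itv /= => /andP[xc cy]; apply: dphi; have [] := bet c; rewrite ?ltW.
  - apply: continuous_in_subspaceT => c; rewrite inE /= in_itv /= => xcy.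
    have [cd _] := bet c xcy.
    by apply: differentiable_continuous; apply/derivable1_diffP; have [] := dphi c cd.
  rewrite in_itv /= => /bet[_ cr] h.
  rewrite distrC h normrM (distrC y); apply: ler_wpM2r => //.
  have := rP c; rewrite /ball /= distrC => /(_ cr) h1.
  have := lerB_normD (psi c) (psi t); have := ler_normB (psi t) (psi t - psi c).
  rewrite opprB addrCA subrr addr0; lra.
move=> x y xd yd; have [xy|/ltW yx] := leP x y; first exact: key.
by rewrite distrC (distrC x); exact: key.
Qed.

Lemma powR_lip1 (a t : R) : 0 < t -> lip1 (fun x => x `^ a) t.
Proof.
move=> t0; apply: (@is_derive_lip1 _ (fun x => a * x `^ (a - 1)) t t) => //.
  by move=> x; rewrite ltr_norml => /andP[h _]; apply: is_derive1_powR; lra.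
have ct : {for t, continuous (fun x : R => x `^ (a - 1))}.
  by apply: differentiable_continuous; apply/derivable1_diffP; have [] := is_derive1_powR (a - 1) t0.
by apply: cvgM; [exact: cvg_cst|exact: ct].
Qed.

Lemma lip1_comp (phi psi : R -> R) t : lip1 psi t -> lip1 phi (psi t) -> lip1 (phi \o psi) t.
Proof.
move=> [L [d [L0 d0 dP]]] [M [e [M0 e0 eP]]].
exists (M * L), (Num.min d (e / L)); split; [exact: mulr_gt0|by rewrite lt_min d0 divr_gt0|].
have near x : `|x - t| < Num.min d (e / L) -> `|psi x - psi t| < e.
  rewrite lt_min => /andP[xd xe]; apply: le_lt_trans (dP x t xd _) _; first by rewrite subrr normr0.
  by rewrite mulrC -ltr_pdivlMr.
move=> x y xd yd; apply: le_trans (eP _ _ (near _ xd) (near _ yd)) _.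
rewrite -mulrA ler_pM2l//; apply: dP; by move: xd yd; rewrite !lt_min => /andP[? _] /andP[? _].
Qed.

End RealCalculus.

Section ComplexCalculus.
Context {R : realType}.
Implicit Types (f g : R[i] -> R[i]) (p v be : R[i]).

Lemma cdiff_const (k p : R[i]) : cdiff (fun=> k) p 0.
Proof.
exists 0 => e e0; exists 1 => // h _.
by rewrite subrr !mul0r !subr0 cabs0 mulr_ge0 ?cabs_ge0// ltW.
Qed.

Lemma loclip_const (k p : R[i]) : loclip (fun=> k) p.
Proof. by exists 1, 1; split => // q q' _ _; rewrite subrr cabs0 mul1r cabs_ge0. Qed.

Lemma cdiffD f g p be be' : cdiff f p be -> cdiff g p be' ->
  cdiff (fun w => f w + g w) p (be + be').
Proof.
move=> [a fa] [b gb]; exists (a + b) => e e0.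
have e20 : 0 < e / 2 by rewrite divr_gt0.
have [d1 d10 P1] := fa _ e20; have [d2 d20 P2] := gb _ e20.
exists (Num.min d1 d2); first by rewrite lt_min d10.
move=> h; rewrite lt_min => /andP[/P1 h1 /P2 h2].
have -> : f (p + h) + g (p + h) - (f p + g p) - (a + b) * h - (be + be') * cconj h =
  (f (p + h) - f p - a * h - be * cconj h) + (g (p + h) - g p - b * h - be' * cconj h) by ring.
apply: le_trans (cabsD _ _) _; lra.
Qed.

Lemma loclipD f g p : loclip f p -> loclip g p -> loclip (fun w => f w + g w) p.
Proof.
move=> [L [d [L0 d0 dP]]] [M [e [M0 e0 eP]]].
exists (L + M), (Num.min d e); split; [exact: addr_gt0|by rewrite lt_min d0|].
move=> q q'; rewrite !lt_min => /andP[q1 q2] /andP[q'1 q'2].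
have -> : f q + g q - (f q' + g q') = (f q - f q') + (g q - g q') by ring.
by apply: le_trans (cabsD _ _) _; rewrite mulrDl lerD// ?dP ?eP.
Qed.

Lemma loclip_bounded f p : loclip f p -> exists B d, [/\ 0 < B, 0 < d & forall q,
  cabs (q - p) < d -> cabs (f q) <= B].
Proof.
move=> [L [d [L0 d0 dP]]]; exists (cabs (f p) + L * d), d; split => //.
  by rewrite ltr_wpDl ?cabs_ge0// mulr_gt0.
move=> q qd; have := dP q p qd; rewrite subrr cabs0 => /(_ d0) h.
have : L * cabs (q - p) <= L * d by rewrite ler_pM2l// ltW.
have := cabsBB (f q) (f p); lra.
Qed.

Lemma loclipM f g p : loclip f p -> loclip g p -> loclip (fun w => f w * g w) p.
Proof.
move=> lf lg; have [A [d1 [A0 d10 P1]]] := loclip_bounded lf; have [B [d2 [B0 d20 P2]]] := loclip_bounded lg.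
have [L [d [L0 d0 dP]]] := lf; have [M [e [M0 e0 eP]]] := lg.
exists (A * M + L * B), (Num.min (Num.min d1 d2) (Num.min d e)); split.
- by rewrite addr_gt0// mulr_gt0.
- by rewrite !lt_min d10 d20 d0 e0.
move=> q q'; rewrite !lt_min => /andP[/andP[q1 q2] /andP[q3 q4]] /andP[/andP[q'1 q'2] /andP[q'3 q'4]].
have -> : f q * g q - f q' * g q' = f q * (g q - g q') + (f q - f q') * g q' by ring.
apply: le_trans (cabsD _ _) _; rewrite !cabsM [leRHS]mulrDl; apply: lerD.
  by rewrite -mulrA; apply: ler_pM; rewrite ?cabs_ge0 ?P1 ?eP.
by rewrite mulrAC; apply: ler_pM; rewrite ?cabs_ge0 ?P2 ?dP.
Qed.

(** The Leibniz rule; the Lipschitz bounds make the product of the two increments quadratic in h. *)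
Lemma cdiffM f g p be be' : loclip f p -> loclip g p -> cdiff f p be -> cdiff g p be' ->
  cdiff (fun w => f w * g w) p (f p * be' + be * g p).
Proof.
move=> lf lg [a fa] [b gb]; exists (f p * b + a * g p) => e e0.
have [L [d [L0 d0 dP]]] := lf; have [M [r [M0 r0 rP]]] := lg.
pose B := 1 + cabs (f p) + cabs (g p).
have B0 : 0 < B by rewrite /B; have := cabs_ge0 (f p); have := cabs_ge0 (g p); lra.
have e10 : 0 < e / 2 / B by rewrite !divr_gt0.
have LM : 0 < L * M by rewrite mulr_gt0.
have [d1 d10 P1] := fa _ e10; have [d2 d20 P2] := gb _ e10.
exists (Num.min (Num.min d1 d2) (Num.min (Num.min d r) (e / 2 / (L * M)))).
  by rewrite !lt_min d10 d20 d0 r0 !divr_gt0.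
move=> h; rewrite !lt_min => /andP[/andP[/P1 h1 /P2 h2] /andP[/andP[hd hr] hLM]].
have [h3 h4] : cabs (f (p + h) - f p) <= L * cabs h /\ cabs (g (p + h) - g p) <= M * cabs h.
  have E : h = p + h - p by rewrite addrC addKr.
  split; rewrite {2}E; [apply: dP|apply: rP]; by rewrite ?subrr ?cabs0// -E.
have -> : f (p + h) * g (p + h) - f p * g p - (f p * b + a * g p) * h - (f p * be' + be * g p) * cconj h =
  f p * (g (p + h) - g p - b * h - be' * cconj h) + (f (p + h) - f p - a * h - be * cconj h) * g p
  + (f (p + h) - f p) * (g (p + h) - g p) by ring.
apply: le_trans (cabsD _ _) _.
have b1 : cabs (f p * (g (p + h) - g p - b * h - be' * cconj h) +
     (f (p + h) - f p - a * h - be * cconj h) * g p) <= e / 2 * cabs h.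
  apply: le_trans (cabsD _ _) _; rewrite !cabsM.
  have := ler_wpM2l (cabs_ge0 (f p)) h2; have := ler_wpM2r (cabs_ge0 (g p)) h1.
  have : e / 2 / B * cabs h * B = e / 2 * cabs h by field; exact: lt0r_neq0.
  have : 0 <= e / 2 / B * cabs h by rewrite mulr_ge0 ?cabs_ge0 ?(ltW e10).
  by rewrite {3}/B; set u := e / 2 / B * cabs h; lra.
have b2 : cabs ((f (p + h) - f p) * (g (p + h) - g p)) <= e / 2 * cabs h.
  rewrite cabsM; apply: le_trans (ler_pM (cabs_ge0 _) (cabs_ge0 _) h3 h4) _.
  rewrite mulrACA mulrA ler_wpM2r ?cabs_ge0// mulrC -ler_pdivlMr//; exact: ltW.
lra.
Qed.

Lemma inv_sub (x y : R[i]) : x != 0 -> y != 0 -> x^-1 - y^-1 = (y - x) * x^-1 * y^-1.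
Proof. by move=> x0 y0; field; rewrite x0 y0. Qed.

Lemma loclip_inv (s p : R[i]) : p != s -> loclip (fun w => (w - s)^-1) p.
Proof.
move=> ps; pose r := cabs (p - s).
have r0 : 0 < r by rewrite cabs_gt0 subr_eq0.
have low q : cabs (q - p) < r / 2 -> r / 2 < cabs (q - s).
  move=> h; have := cabsBB (p - s) (p - q); rewrite (cabsC p q) -/r.
  have -> : p - s - (p - q) = q - s by ring.
  lra.
exists (4 / r ^+ 2), (r / 2); split; [by rewrite divr_gt0// exprn_gt0|by rewrite divr_gt0|].
move=> q q' /low h /low h'.
have q0 : q - s != 0 by rewrite -cabs_gt0; lra.
have q'0 : q' - s != 0 by rewrite -cabs_gt0; lra.
rewrite inv_sub// !cabsM !cabsV.
have -> : q' - s - (q - s) = q' - q by ring.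
rewrite (cabsC q') -mulrA mulrC; apply: ler_wpM2r; first exact: cabs_ge0.
have -> : 4 / r ^+ 2 = (r / 2)^-1 * (r / 2)^-1 by field; exact: lt0r_neq0.
have r20 : 0 < r / 2 by rewrite divr_gt0.
by apply: ler_pM; rewrite ?invr_ge0 ?cabs_ge0// lef_pV2 ?posrE; lra.
Qed.

Lemma cdiff_inv (s p : R[i]) : p != s -> cdiff (fun w => (w - s)^-1) p 0.
Proof.
move=> ps; pose v := p - s; pose r := cabs v.
have v0 : v != 0 by rewrite subr_eq0.
have r0 : 0 < r by rewrite cabs_gt0.
exists (- (v^-1 * v^-1)) => e e0.
have k0 : 0 < r ^+ 3 * e / 2 by rewrite divr_gt0// mulr_gt0// exprn_gt0.
exists (Num.min (r / 2) (r ^+ 3 * e / 2)); first by rewrite lt_min divr_gt0.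
move=> h; rewrite lt_min => /andP[hr he].
have low : r / 2 < cabs (v + h).
  have := cabsBB v (- h); rewrite cabsN opprK -/r; lra.
have vh0 : v + h != 0 by rewrite -cabs_gt0; lra.
have -> : (p + h - s)^-1 - (p - s)^-1 - - (v^-1 * v^-1) * h - 0 * cconj h =
   h * h * (v^-1 * v^-1 * (v + h)^-1).
  have -> : p + h - s = v + h by rewrite /v; ring.
  by rewrite -/v; field; rewrite v0 vh0.
rewrite !cabsM !cabsV -/r.
have -> : cabs h * cabs h * (r^-1 * r^-1 * (cabs (v + h))^-1) =
  (r^-1 * r^-1 * (cabs (v + h))^-1 * cabs h) * cabs h by ring.
apply: ler_wpM2r; first exact: cabs_ge0.
have i1 : (cabs (v + h))^-1 <= (r / 2)^-1 by rewrite lef_pV2 ?posrE; lra.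
have r2 : 0 < r^-1 * r^-1 by rewrite mulr_gt0// invr_gt0.
have h1 := ler_wpM2l (ltW r2) i1.
apply: le_trans (ler_wpM2r (cabs_ge0 _) h1) _.
have -> : e = r^-1 * r^-1 * (r / 2)^-1 * (r ^+ 3 * e / 2) by field; exact: lt0r_neq0.
apply: ler_wpM2l; last exact: ltW.
by rewrite mulr_ge0 ?(ltW r2)// invr_ge0 divr_ge0// ltW.
Qed.

(** Radial functions are written in the squared modulus because it is polynomial, hence
    differentiable at its centre as well. *)
Definition csq (v : R[i]) : R := cre v ^+ 2 + cim v ^+ 2.

Lemma csqD (v h : R[i]) : csq (v + h) = csq v + (2 * cre (cconj v * h) + csq h).
Proof. by rewrite /csq !(cE, cconjE); ring. Qed.

Lemma csqE (v : R[i]) : csq v = cabs v ^+ 2. Proof. by rewrite cabs_sqr. Qed.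

Lemma csq_step_le (v h : R[i]) : cabs h <= 1 ->
  `|2 * cre (cconj v * h) + csq h| <= (2 * cabs v + 1) * cabs h.
Proof.
move=> h1; apply: le_trans (ler_normD _ _) _.
rewrite normrM ger0_norm// [leRHS]mulrDl; apply: lerD.
  rewrite -mulrA ler_pM2l//; apply: le_trans (cre_le _) _.
  by rewrite cabsM cabsJ.
by rewrite csqE ger0_norm ?sqr_ge0// mul1r expr2 ler_piMl ?cabs_ge0.
Qed.

Lemma loclip_radial (phi : R -> R) (s p : R[i]) : lip1 phi (csq (p - s)) ->
  loclip (fun w => mkC (phi (csq (w - s))) 0) p.
Proof.
move=> [L [d [L0 d0 dP]]]; pose B := 2 * cabs (p - s) + 5.
have B0 : 0 < B by rewrite /B; have := cabs_ge0 (p - s); lra.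
have lip q q' : cabs (q - p) < 1 -> cabs (q' - p) < 1 ->
    `|csq (q - s) - csq (q' - s)| <= B * cabs (q - q').
  move=> q1 q'1.
  have -> : csq (q - s) - csq (q' - s) = cre (cconj (q + q' - s *+ 2) * (q - q')).
    by rewrite mulr2n /csq !(cE, cconjE); ring.
  apply: le_trans (cre_le _) _; rewrite cabsM cabsJ ler_wpM2r ?cabs_ge0//.
  have -> : q + q' - s *+ 2 = (q - p) + (q' - p) + ((p - s) + (p - s)) by rewrite mulr2n; ring.
  apply: le_trans (cabsD _ _) _; have := cabsD (q - p) (q' - p); have := cabsD (p - s) (p - s).
  rewrite /B; lra.
exists (L * B), (Num.min 1 (d / B)); split; [exact: mulr_gt0|by rewrite lt_min ltr01 divr_gt0|].
have near q : cabs (q - p) < Num.min 1 (d / B) -> `|csq (q - s) - csq (p - s)| < d.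
  rewrite lt_min => /andP[q1 qd]; apply: le_lt_trans (lip q p q1 _) _; first by rewrite subrr cabs0.
  by rewrite mulrC -ltr_pdivlMr.
move=> q q' qd q'd.
have -> : mkC (phi (csq (q - s))) 0 - mkC (phi (csq (q' - s))) 0 =
  mkC (phi (csq (q - s)) - phi (csq (q' - s))) 0 by apply: cplx_eq; rewrite !cE ?subrr.
rewrite cabs_real; apply: le_trans (dP _ _ (near _ qd) (near _ q'd)) _.
rewrite -mulrA ler_pM2l//; apply: lip; by move: qd q'd; rewrite !lt_min => /andP[? _] /andP[? _].
Qed.

(** The differential of |w - s|^2 is 2 Re(conj(w - s) h), whose conj h coefficient is w - s. *)
Lemma cdiff_radial (phi : R -> R) (k : R) (s p : R[i]) : der1 phi (csq (p - s)) k ->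
  cdiff (fun w => mkC (phi (csq (w - s))) 0) p (mkC k 0 * (p - s)).
Proof.
move=> dphi; set v := p - s; exists (mkC k 0 * cconj v) => e e0.
pose B := 2 * cabs v + 1.
have B0 : 0 < B by rewrite /B; have := cabs_ge0 v; lra.
have k0 : 0 < `|k| + 1 by rewrite ltr_wpDl.
have e10 : 0 < e / 2 / B by rewrite !divr_gt0.
have [d d0 dP] := dphi _ e10.
exists (Num.min (Num.min 1 (d / B)) (e / 2 / (`|k| + 1))).
  by rewrite !lt_min ltr01 !divr_gt0.
move=> h; rewrite !lt_min => /andP[/andP[h1 hd] he].
set t := 2 * cre (cconj v * h) + csq h.
have tB : `|t| <= B * cabs h by apply: csq_step_le; exact: ltW.
have td : `|t| < d by apply: le_lt_trans tB _; rewrite mulrC -ltr_pdivlMr.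
have -> : mkC (phi (csq (p + h - s))) 0 - mkC (phi (csq v)) 0 - mkC k 0 * cconj v * h - mkC k 0 * v * cconj h
   = mkC (phi (csq v + t) - phi (csq v) - k * t) 0 + mkC (k * csq h) 0.
  have -> : p + h - s = v + h by rewrite /v; ring.
  by rewrite csqD -/t; apply: cplx_eq; rewrite /t /csq !(cE, cconjE); ring.
apply: le_trans (cabsD _ _) _; rewrite !cabs_real.
have h2 : `|phi (csq v + t) - phi (csq v) - k * t| <= e / 2 * cabs h.
  apply: le_trans (dP t td) _.
  have -> : e / 2 * cabs h = e / 2 / B * (B * cabs h) by field; exact: lt0r_neq0.
  by rewrite ler_pM2l.
have h3 : `|k * csq h| <= e / 2 * cabs h.
  rewrite normrM csqE (ger0_norm (sqr_ge0 _)) expr2 mulrA ler_wpM2r ?cabs_ge0//.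
  apply: (@le_trans _ _ ((`|k| + 1) * cabs h)); first by rewrite ler_wpM2r ?cabs_ge0// lerDl.
  by rewrite mulrC -ler_pdivlMr// ltW.
lra.
Qed.

End ComplexCalculus.

(** * Radial barriers and the pointwise estimate *)

Section Profiles.
Context {R : realType}.
Implicit Types (a b t r s al : R).

(** The profiles of the barriers, to be taken at t = |w - s|^2. Both stay in [0, 1]. The derivative
    of [prof a] is of order t^(a - 1) near t = 0, and that of [tail b] is of order t^(- b - 1) at
    infinity; these derivatives become the dbar-derivatives of the barriers. *)
Definition prof a t : R := (t / (1 + t)) `^ a.
Definition prof' a t : R := a * (t / (1 + t)) `^ (a - 1) * (1 + t) ^- 2.
Definition tail b t : R := 1 - (1 + t) `^ (- b).
Definition tail' b t : R := b * (1 + t) `^ (- b - 1).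

Lemma is_derive_frac t : 0 < t -> is_derive t 1 (fun x : R => x / (1 + x)) ((1 + t) ^- 2).
Proof.
move=> t0; have t1 : 1 + t != 0 by rewrite lt0r_neq0// addr_gt0.
have d1 : is_derive t 1 (fun x : R => 1 + x) 1.
  by apply: is_derive_eq (is_deriveD (is_derive_cst (1 : R) t 1) (is_derive_id t 1)) _; rewrite add0r.
have dV := is_deriveV t1 d1.
apply: is_derive_eq (is_deriveM (is_derive_id t 1) dV) _.
by rewrite /GRing.scale /=; field.
Qed.

Lemma frac_gt0 t : 0 < t -> 0 < t / (1 + t).
Proof. by move=> t0; rewrite divr_gt0// addr_gt0. Qed.

Lemma der1_prof a t : 0 < t -> der1 (prof a) t (prof' a t).
Proof.
move=> t0; apply: is_derive_der1.
exact: (@is_derive1_comp R (fun x => x `^ a) (fun x => x / (1 + x)) t _ _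
  (is_derive1_powR a (frac_gt0 t0)) (is_derive_frac t0)).
Qed.

Lemma lip1_prof a t : 0 < t -> lip1 (prof a) t.
Proof.
move=> t0; apply: (@lip1_comp _ (fun x => x `^ a) (fun x => x / (1 + x))); last first.
  exact: powR_lip1 (frac_gt0 t0).
exists 1, t; split => // x y; rewrite !ltr_norml => /andP[x0 _] /andP[y0 _].
have x1 : 1 <= 1 + x by lra.
have y1 : 1 <= 1 + y by lra.
have -> : x / (1 + x) - y / (1 + y) = (x - y) * ((1 + x)^-1 * (1 + y)^-1).
  by field; rewrite !lt0r_neq0//; lra.
rewrite normrM mulrC ler_wpM2r// ger0_norm ?mulr_ge0 ?invr_ge0//; try lra.
by apply: mulr_ile1; rewrite ?invr_ge0 ?invf_le1//; lra.
Qed.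

Lemma der1_tail b t : 0 < t -> der1 (tail b) t (tail' b t).
Proof.
move=> t0; apply: is_derive_der1.
have t1 : 0 < 1 + t by rewrite addr_gt0.
have d1 : is_derive t 1 (fun x : R => 1 + x) 1.
  by apply: is_derive_eq (is_deriveD (is_derive_cst (1 : R) t 1) (is_derive_id t 1)) _; rewrite add0r.
have dp := @is_derive1_comp R (fun x => x `^ (- b)) (fun x => 1 + x) t _ _
  (is_derive1_powR (- b) t1) d1.
apply: is_derive_eq (is_deriveB (is_derive_cst (1 : R) t 1) dp) _.
by rewrite /tail'; ring.
Qed.

Lemma lip1_tail b t : 0 < t -> lip1 (tail b) t.
Proof.
move=> t0; have t1 : 0 < 1 + t by rewrite addr_gt0.
have [|L [d [L0 d0 dP]]] := @lip1_comp _ (fun x => x `^ (- b)) (fun x => 1 + x) t _ (powR_lip1 (- b) t1).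
  by exists 1, 1; split => // x y _ _; rewrite mul1r opprD addrACA subrr add0r.
exists L, d; split => // x y xd yd; have := dP x y xd yd; rewrite /= /tail.
rewrite -[leLHS]normrN; congr (`|_| <= _); ring.
Qed.

Lemma powR_le1 (x a : R) : 0 <= x -> x <= 1 -> 0 <= a -> x `^ a <= 1.
Proof.
move=> x0 x1 a0; have := @ge0_ler_powR R a a0 x 1; rewrite powR1; apply => //.
by rewrite nnegrE.
Qed.

Lemma frac_01 t : 0 <= t -> 0 <= t / (1 + t) <= 1.
Proof.
move=> t0; have t1 : 0 < 1 + t by rewrite ltr_pwDl.
by rewrite divr_ge0 ?(ltW t1)//= ler_pdivrMr// mul1r lerDr.
Qed.

Lemma prof_01 a t : 0 <= a -> 0 <= t -> 0 <= prof a t <= 1.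
Proof.
by move=> a0 t0; have /andP[? ?] := frac_01 t0; rewrite powR_ge0 powR_le1.
Qed.

Lemma tail_01 b t : 0 <= b -> 0 <= t -> 0 <= tail b t <= 1.
Proof.
move=> b0 t0; rewrite /tail powRN subr_ge0.
have t1 : 0 < 1 + t by rewrite ltr_pwDl.
rewrite invf_le1 ?powR_gt0// lerBlDr lerDl invr_ge0 powR_ge0 andbT.
by have := @ge0_ler_powR R b b0 1 (1 + t); rewrite powR1; apply; rewrite ?nnegrE ?lerDl// ltW.
Qed.

Lemma powR_anti (x y a : R) : 0 < x -> x <= y -> a <= 0 -> y `^ a <= x `^ a.
Proof.
move=> x0 xy a0; have y0 := lt_le_trans x0 xy.
rewrite -(opprK a) (powRN x) (powRN y) lef_pV2 ?posrE ?powR_gt0//.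
by apply: (@ge0_ler_powR R (- a) _ x y); rewrite ?nnegrE ?oppr_ge0 ?(ltW x0) ?(ltW y0).
Qed.

Lemma prof'_ge0 a t : 0 <= a -> 0 <= prof' a t.
Proof. by move=> a0; rewrite !mulr_ge0 ?powR_ge0 ?invr_ge0 ?sqr_ge0. Qed.

Lemma tail'_ge0 b t : 0 <= b -> 0 <= tail' b t.
Proof. by move=> a0; rewrite mulr_ge0 ?powR_ge0. Qed.

Lemma sqr_powR r (a : R) : 0 <= r -> (r ^+ 2) `^ a = r `^ (2 * a).
Proof. by move=> r0; rewrite powRrM -powR_mulrn. Qed.

Lemma powR_sq_quot r al : 0 < r -> (r ^+ 2) `^ (al / 2 - 1) = r `^ al / r ^+ 2.
Proof.
move=> r0; have r20 : 0 < r ^+ 2 by rewrite exprn_gt0.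
have : r `^ al = (r ^+ 2) `^ (al / 2) by rewrite sqr_powR ?ltW//; congr (_ `^ _); field.
move=> ->.
have -> : (r ^+ 2) `^ (al / 2) = (r ^+ 2) `^ (al / 2 - 1) * (r ^+ 2) `^ 1.
  by rewrite -powRD ?subrK// lt0r_neq0 ?implybT.
by rewrite powRr1 ?ltW// mulfK// lt0r_neq0.
Qed.

(** For t = r^2 <= 1 / 4 the factor (1 + t)^-2 is at least 1 / 2, and 4 / al times al / 2
    compensates for it. *)
Lemma prof'_lower al r : 0 < al -> al <= 1 -> 0 < r -> r <= 1 / 2 ->
  r `^ al / r ^+ 2 <= 4 / al * prof' (al / 2) (r ^+ 2).
Proof.
move=> al0 al1 r0 r1; rewrite -powR_sq_quot// /prof'.
set t := r ^+ 2; have t0 : 0 < t by rewrite exprn_gt0.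
have t1 : t <= 1 / 4 by rewrite /t; nra.
have h : t `^ (al / 2 - 1) <= (t / (1 + t)) `^ (al / 2 - 1).
  apply: powR_anti; [exact: frac_gt0| |lra].
  by rewrite ler_pdivrMr ?addr_gt0// ler_peMr ?lerDl ?(ltW t0).
have k : 1 / 2 <= (1 + t) ^- 2.
  rewrite -[1 / 2]invrK lef_pV2 ?posrE ?invr_gt0//; last by rewrite exprn_gt0// addr_gt0.
  rewrite mul1r invrK; nra.
apply: le_trans h _; set u := powR _ _; have u0 : 0 <= u by exact: powR_ge0.
have -> : 4 / al * (al / 2 * u * (1 + t) ^- 2) = u * (2 * (1 + t) ^- 2).
  by field; rewrite !lt0r_neq0 ?addr_gt0.
by rewrite ler_peMr//; lra.
Qed.

(** For r >= 1 / 2 one has 1 + r^2 <= 5 r^2, and 5^(-b - 1) >= 1 / 25 since b <= 1; the constant is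
    25 / b. *)
Lemma tail'_lower al r : 0 < al -> al < 1 -> 1 / 2 <= r ->
  r `^ al / r ^+ 2 / r <= 50 / (1 - al) * tail' ((1 - al) / 2) (r ^+ 2).
Proof.
move=> al0 al1 r1; have r0 : 0 < r by lra.
set b := (1 - al) / 2; have b0 : 0 < b by rewrite divr_gt0// subr_gt0.
have r20 : 0 < r ^+ 2 by rewrite exprn_gt0.
have -> : r `^ al / r ^+ 2 / r = (r ^+ 2) `^ (- b - 1).
  have h : r `^ al = (r ^+ 2) `^ (- b - 1) * r ^+ 3.
    rewrite sqr_powR ?ltW// -(powR_mulrn 3) ?ltW// -powRD; last by rewrite lt0r_neq0 ?implybT.
    by congr (_ `^ _); rewrite /b; field.
  by rewrite h; field; rewrite lt0r_neq0.
have h : (5 * r ^+ 2) `^ (- b - 1) <= (1 + r ^+ 2) `^ (- b - 1).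
  apply: powR_anti; [by rewrite addr_gt0| |lra].
  nra.
rewrite (powRM _ _ (ltW r20)) // in h.
have k : 25^-1 <= (5 : R) `^ (- b - 1).
  have -> : (25^-1 : R) = 5 `^ (- 2).
    by rewrite powRN powR_mulrn//; congr (_^-1); ring.
  by apply: ler_powR; rewrite ?ler1n//; rewrite /b; lra.
rewrite /tail'.
have -> : 50 / (1 - al) * (b * (1 + r ^+ 2) `^ (- b - 1)) = 25 * (1 + r ^+ 2) `^ (- b - 1).
  by rewrite /b; field; rewrite subr_eq0 gt_eqF.
have p0 : 0 <= (r ^+ 2) `^ (- b - 1) by exact: powR_ge0.
have := le_trans (ler_wpM2r p0 k) h; lra.
Qed.

(** Here [r] and [s] stand for |w| and |w - 1|. Up to constants the kernel is r^(al - 2) near 0, 1 /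
    s near 1 and r^(al - 3) at infinity, and there is one barrier for each regime. *)
Lemma kernel_bound al r s : 0 < al -> al < 1 -> 0 < r -> 0 < s -> r <= s + 1 -> 1 <= r + s ->
  r `^ al / r ^+ 2 / s <= (150 / (1 - al) + 8 / al + 16) *
    (prof' (al / 2) (r ^+ 2) + tail' ((1 - al) / 2) (r ^+ 2) + prof' (1 / 2) (s ^+ 2)).
Proof.
move=> al0 al1 r0 s0 rs1 rs2.
set C := _ + _ + _; set p := prof' _ _; set q := tail' _ _; set w := prof' _ _.
have p0 : 0 <= p by apply: prof'_ge0; lra.
have q0 : 0 <= q by apply: tail'_ge0; lra.
have w0 : 0 <= w by apply: prof'_ge0; lra.
have x1 : 0 < 50 / (1 - al) by rewrite divr_gt0 ?subr_gt0.
have x2 : 0 < 4 / al by rewrite divr_gt0.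
have CE : C = 3 * (50 / (1 - al)) + 2 * (4 / al) + 16.
  by rewrite /C; field; rewrite !lt0r_neq0 ?subr_gt0.
have [r1|r1] := leP r (1 / 2).
  have h := prof'_lower al0 (ltW al1) r0 r1.
  have si : s^-1 <= 2 by rewrite -[2]invrK lef_pV2 ?posrE ?invr_gt0//; lra.
  have k0 : 0 <= r `^ al / r ^+ 2 by rewrite divr_ge0 ?powR_ge0 ?sqr_ge0.
  apply: le_trans (ler_wpM2l k0 si) _.
  rewrite CE; move: h x1 x2; rewrite -/p; set u := 50 / _; set v := 4 / al; set k := _ / _ => *.
  nra.
(* Near 1 the factor r^(al - 2) is at most 4, and [prof'_lower] with exponent 1 bounds 1 / s by 4
   times the third profile: this is the 16. *)
have [s1|s1] := leP s (1 / 2).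
  have := @prof'_lower 1 s ltr01 (lexx _) s0 s1; rewrite (powRr1 (ltW s0)) -/w.
  have -> : s / s ^+ 2 = s^-1 by field; rewrite lt0r_neq0.
  rewrite divr1 => h.
  have k4 : r `^ al / r ^+ 2 <= 4.
    have := @powR_anti (1/4) (r ^+ 2) (al / 2 - 1); rewrite powR_sq_quot// => k.
    apply: le_trans (k _ _ _) _; [lra|nra|lra|].
    have h4 : 0 < (1 / 4 : R) <= 1 by lra.
    have h5 : al / 2 - 1 >= -1 by lra.
    by apply: le_trans (ger_powR h4 h5) _; rewrite powR_inv1; lra.
  have si0 : 0 <= s^-1 by rewrite invr_ge0 ltW.
  apply: le_trans (ler_wpM2r si0 k4) _.
  rewrite CE; move: h x1 x2; set u := 50 / _; set v := 4 / al => *.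
  nra.
(* Both distances exceed 1 / 2, so r <= s + 1 <= 3 s. *)
have h := tail'_lower al0 al1 (ltW r1).
have si : s^-1 <= 3 * r^-1.
  rewrite -[3]invrK -invfM lef_pV2 ?posrE ?mulr_gt0 ?invr_gt0//; lra.
have k0 : 0 <= r `^ al / r ^+ 2 by rewrite divr_ge0 ?powR_ge0 ?sqr_ge0.
apply: le_trans (ler_wpM2l k0 si) _.
rewrite mulrCA CE; move: h x1 x2; rewrite -/q; set u := 50 / _; set v := 4 / al; set k := _ / _ / r => *.
nra.
Qed.

End Profiles.

Section ContourBounds.
Context {R : realType}.
Implicit Types (f : R[i] -> R[i]) (v w s : R[i]).

Lemma coint_le4 f (a c h b : R) : 0 <= h -> edge_cont f a c h ->
  (forall x, a <= x <= a + h -> cim (f (mkC x c)) <= b /\ - b <= cim (f (mkC x (c + h)))) ->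
  (forall y, c <= y <= c + h -> cre (f (mkC (a + h) y)) <= b /\ - b <= cre (f (mkC a y))) ->
  coint f a c h <= 4 * b * h.
Proof.
move=> h0 ef hx hy.
have -> : 4 * b * h = (2 * b + 2 * b) * h by ring.
apply: coint_le => // [x /hx|y /hy] [? ?]; lra.
Qed.

(** The surplus [k] is asked on the right side only; this side alone will collect enough of the
    residue at 1. *)
Lemma coint_ge4 f (a c h b k : R) : 0 <= h -> edge_cont f a c h ->
  (forall x, a <= x <= a + h -> - b <= cim (f (mkC x c)) /\ cim (f (mkC x (c + h))) <= b) ->
  (forall y, c <= y <= c + h -> k - b <= cre (f (mkC (a + h) y)) /\ cre (f (mkC a y)) <= b) ->
  (k - 4 * b) * h <= coint f a c h.
Proof.
move=> h0 ef hx hy; have [b1 b2 b3 b4] := edge_cont_lint h0 ef.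
have ah : a <= a + h by lra.
have ch : c <= c + h by lra.
have l1 := lint_ge ah b1 (fun x xP => (hx x xP).1).
have l2 := lint_le ah b2 (fun x xP => (hx x xP).2).
have l3 := lint_ge ch b3 (fun y yP => (hy y yP).1).
have l4 := lint_le ch b4 (fun y yP => (hy y yP).2).
have e1 : a + h - a = h by ring.
have e2 : c + h - c = h by ring.
rewrite /coint; move: l1 l2 l3 l4; rewrite e1 e2; lra.
Qed.

Lemma cre_inv v : cre v^-1 = cre v / csq v. Proof. by case: v. Qed.
Lemma cim_inv v : cim v^-1 = - (cim v / csq v). Proof. by case: v. Qed.

Lemma csq_ge0 v : 0 <= csq v. Proof. by rewrite addr_ge0 ?sqr_ge0. Qed.

(** The factor w - s produced by the chain rule cancels the pole, so the dbar-derivative is the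
    nonnegative real number phi'(|w - s|^2) for an increasing profile. *)
Definition radial (phi : R -> R) s w : R[i] := mkC (phi (csq (w - s))) 0 * (w - s)^-1.

Section Radial.
Variables (phi : R -> R) (s : R[i]).
Hypothesis phi01 : forall t, 0 <= t -> 0 <= phi t <= 1.

Lemma radial_abs w : cabs (radial phi s w) <= (cabs (w - s))^-1.
Proof.
have /andP[p0 p1] := phi01 (csq_ge0 (w - s)).
by rewrite cabsM cabs_real ger0_norm// cabsV ler_piMl// invr_ge0 cabs_ge0.
Qed.

(** With [radial_cim] this says that on each side of a square around [s] the barrier contributes to
    [coint] with a known sign, so no bound on its size near the pole is needed. *)
Lemma radial_cre w : 0 <= cre (w - s) * cre (radial phi s w).
Proof.
have /andP[p0 p1] := phi01 (csq_ge0 (w - s)).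
rewrite /radial creM cre_mk cim_mk mul0r subr0 cre_inv mulrCA mulr_ge0//.
by rewrite mulrA -expr2 divr_ge0 ?sqr_ge0 ?csq_ge0.
Qed.

Lemma radial_cim w : cim (w - s) * cim (radial phi s w) <= 0.
Proof.
have /andP[p0 p1] := phi01 (csq_ge0 (w - s)).
rewrite /radial cimM cre_mk cim_mk mul0r addr0 cim_inv mulrN mulrN oppr_le0 mulrCA mulr_ge0//.
by rewrite mulrA -expr2 divr_ge0 ?sqr_ge0 ?csq_ge0.
Qed.

Lemma csq_gt0 w : w != s -> 0 < csq (w - s).
Proof. by move=> ws; rewrite csqE exprn_gt0// cabs_gt0 subr_eq0. Qed.

Lemma radial_loclip w : w != s -> (forall t, 0 < t -> lip1 phi t) -> loclip (radial phi s) w.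
Proof.
move=> ws lp; apply: loclipM; last exact: loclip_inv.
by apply: loclip_radial; apply: lp; exact: csq_gt0.
Qed.

Lemma radial_cdiff w k : w != s -> lip1 phi (csq (w - s)) -> der1 phi (csq (w - s)) k ->
  cdiff (radial phi s) w (mkC k 0).
Proof.
move=> ws lp dp.
have := cdiffM (loclip_radial lp) (loclip_inv ws) (cdiff_radial dp) (cdiff_inv ws).
by rewrite mulr0 add0r mulfK// subr_eq0.
Qed.
End Radial.

Lemma cre_ge_abs w : - cabs w <= cre w.
Proof. by have := cre_le w; rewrite ler_norml => /andP[]. Qed.
Lemma cre_le_abs w : cre w <= cabs w.
Proof. by have := cre_le w; rewrite ler_norml => /andP[]. Qed.
Lemma cim_ge_abs w : - cabs w <= cim w.
Proof. by have := cim_le w; rewrite ler_norml => /andP[]. Qed.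
Lemma cim_le_abs w : cim w <= cabs w.
Proof. by have := cim_le w; rewrite ler_norml => /andP[]. Qed.

(** The farthest corner of this square is at distance (2 sqrt 2 / 3) m < m from the origin. *)
Lemma cabs_third_square (m x y : R) : 0 < m ->
  - (m / 3) <= x <= - (m / 3) + m -> - (m / 3) <= y <= - (m / 3) + m -> cabs (mkC x y) < m.
Proof.
move=> m0 /andP[x1 x2] /andP[y1 y2].
by rewrite -ltr_sqr ?nnegrE ?cabs_ge0 ?(ltW m0)// cabs_sqr !cE; nra.
Qed.

End ContourBounds.

Section OffEdges.
Context {R : realType}.
Variable n : nat.
Implicit Types a h q : R.

(* q never meets an endpoint of [a, a + h] under repeated halving *)
Definition off a h q := exists j : int,
  3 * n%:R * (q - a) = (3 * j%:~R + 1) * h \/ 3 * n%:R * (q - a) = (3 * j%:~R + 2) * h.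

(** Halving the side doubles the integer 3 n (q - a) / h, which thus stays prime to 3; [off_shift]
    subtracts 3 n from it. *)
Lemma off_half0 a h q : off a (h * 2) q -> off a h q.
Proof.
move=> [j [e|e]].
  by exists (j * 2); right; rewrite e intrM; ring.
by exists (j * 2 + 1); left; rewrite e intrD intrM; ring.
Qed.

Lemma off_shift a h q : off a h q -> off (a + h) h q.
Proof.
move=> [j [e|e]]; exists (j - n%:Z); [left|right]; rewrite intrD intrN -pmulrn.
all: have -> : 3 * n%:R * (q - (a + h)) = 3 * n%:R * (q - a) - 3 * n%:R * h by ring.
all: by rewrite e; ring.
Qed.

Lemma off_half1 a h q : off a (h * 2) q -> off (a + h) h q.
Proof. by move=> /off_half0/off_shift. Qed.

Lemma int_off3 (j : int) : 1 <= `|3 * j%:~R + 1 : R| /\ 1 <= `|3 * j%:~R + 2 : R|.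
Proof.
have [j0|j0] := leP 0 j.
  have : 0 <= j%:~R :> R by rewrite ler0z.
  by split; rewrite ger0_norm; lra.
have : j%:~R <= -1 :> R.
  have -> : (-1 : R) = (-1)%:~R by rewrite intrN.
  by rewrite ler_int -ltzD1 addNr.
by split; rewrite ler0_norm; lra.
Qed.

(** An integer prime to 3 is nonzero, so the point even keeps the distance h / (3 n) from the
    endpoint. The bounds near the poles need this quantitative form. *)
Lemma off_dist a h q : 0 < h -> off a h q -> h <= 3 * n%:R * `|q - a|.
Proof.
move=> h0 [j [e|e]]; have [i1 i2] := int_off3 j.
  have : `|3 * n%:R * (q - a)| = 3 * n%:R * `|q - a| by rewrite normrM ger0_norm// mulr_ge0.
  by move=> <-; rewrite e normrM [`|h|]gtr0_norm// ler_peMl// ltW.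
have : `|3 * n%:R * (q - a)| = 3 * n%:R * `|q - a| by rewrite normrM ger0_norm// mulr_ge0.
by move=> <-; rewrite e normrM [`|h|]gtr0_norm// ler_peMl// ltW.
Qed.

End OffEdges.

(** * Bound for E(1) by a contour integral with poles at 0 and 1 *)

Section PointwiseEstimate.
Context {R : realType}.
Variables (al : R) (j : nat) (E : R[i] -> R[i]) (L K : R) (bad : R -> R -> Prop).
Let n := (3 * j + 1)%N.
Let M : R := n%:R.
Hypothesis al0 : 0 < al.
Hypothesis al1 : al < 1.
Hypothesis j2 : (2 <= j)%N.
Hypothesis L0 : 0 < L.
Hypothesis K0 : 0 <= K.
Hypothesis Elip : forall q q', cabs q < M -> cabs q' < M -> cabs (E q - E q') <= L * cabs (q - q').
Hypothesis E0 : E 0 = 0.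
Hypothesis Eo : forall e, 0 < e -> exists2 d, 0 < d & forall q, cabs q < d -> cabs (E q) <= e * cabs q.
Hypothesis nbad : cousin_null (- (M / 3)) (- (M / 3)) M bad.
Hypothesis Ed : forall x y, - (M / 3) <= x <= - (M / 3) + M -> - (M / 3) <= y <= - (M / 3) + M ->
  bad x y \/ exists2 be, cdiff E (mkC x y) be & cabs be <= K * cabs (mkC x y) `^ al.

Let C0 : R := 150 / (1 - al) + 8 / al + 16.
Let e := cabs (E 1).
Let C := C0 * K * e.
(** The factor makes the value at 1 equal to the real number -e^2, so that the residue there is
    visible in [coint]. *)
Let E' w := - cconj (E 1) * E w.
(* B cancels the pole of E' k at 1; the barriers P1, P2, P3 make the real part of
   the dbar-derivative of F nonpositive. *)
Let k (w : R[i]) := (w - 0)^-1 * (w - 0)^-1 * (w - 1)^-1.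
Let B (w : R[i]) := mkC (e ^+ 2) 0 * (w - 1)^-1.
Let P1 := @radial R (prof (al / 2)) 0.
Let P2 := @radial R (tail ((1 - al) / 2)) 0.
Let P3 := @radial R (prof (1 / 2)) 1.
Let F w := E' w * k w + B w + mkC (- C) 0 * (P1 w + P2 w + P3 w).

(** Large enough for the boundary of the square to stay at distance M / 3 - 1 >= M / 6 from the pole
    1. *)
Let M7 : 7 <= M.
Proof. by rewrite /M /n ler_nat (leq_add (leq_mul (leqnn 3) j2) (leqnn 1)). Qed.

Let C00 : 0 < C0.
Proof. by rewrite !addr_gt0 ?divr_gt0 ?subr_gt0 ?ltr0n. Qed.

Let e0 : 0 <= e. Proof. exact: cabs_ge0. Qed.
Let C0' : 0 <= C. Proof. by rewrite !mulr_ge0// ltW. Qed.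

Let inQ (x : R) := - (M / 3) <= x <= - (M / 3) + M.

Let inQ_abs x y : inQ x -> inQ y -> cabs (mkC x y) < M.
Proof.
by apply: cabs_third_square; have := M7; lra.
Qed.

Let Eloclip x y : inQ x -> inQ y -> loclip E (mkC x y).
Proof.
move=> xP yP; have := inQ_abs xP yP => h; exists L, (M - cabs (mkC x y)); split => //; first by rewrite subr_gt0.
move=> q q' qd q'd; apply: Elip.
  have := cabsBB q (mkC x y); lra.
have := cabsBB q' (mkC x y); lra.
Qed.

Let prof01 (a : R) : 0 <= a -> forall t : R, 0 <= t -> 0 <= prof a t <= 1.
Proof. by move=> ? ? ?; exact: prof_01. Qed.

Let b1 : forall t : R, 0 <= t -> 0 <= prof (al / 2) t <= 1. Proof. by move=> t t0; apply: prof01 => //; have := al0; lra. Qed.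
Let b2 : forall t : R, 0 <= t -> 0 <= tail ((1 - al) / 2) t <= 1.
Proof. by move=> t t0; apply: tail_01 => //; have := al1; lra. Qed.
Let b3 : forall t : R, 0 <= t -> 0 <= prof (1 / 2) t <= 1. Proof. by move=> t t0; apply: prof01 => //; have := al0; lra. Qed.

Let kloclip w : w != 0 -> w != 1 -> loclip k w.
Proof. by move=> w0 w1; apply: loclipM; [apply: loclipM|]; exact: loclip_inv. Qed.

Let Bloclip w : w != 1 -> loclip B w.
Proof. by move=> w1; apply: loclipM; [exact: loclip_const|exact: loclip_inv]. Qed.

Let P1loclip w : w != 0 -> loclip P1 w.
Proof. by move=> w0; apply: radial_loclip => // t; exact: lip1_prof. Qed.
Let P2loclip w : w != 0 -> loclip P2 w.
Proof. by move=> w0; apply: radial_loclip => // t; exact: lip1_tail. Qed.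
Let P3loclip w : w != 1 -> loclip P3 w.
Proof. by move=> w0; apply: radial_loclip => // t; exact: lip1_prof. Qed.

Let Floclip x y : inQ x -> inQ y -> mkC x y != 0 -> mkC x y != 1 -> loclip F (mkC x y).
Proof.
move=> xP yP w0 w1; apply: loclipD; first apply: loclipD.
- by apply: loclipM (kloclip w0 w1); apply: loclipM (Eloclip xP yP); exact: loclip_const.
- exact: Bloclip.
- apply: loclipM; first exact: loclip_const.
  by apply: loclipD (P3loclip w1); apply: loclipD; [exact: P1loclip|exact: P2loclip].
Qed.

(** The dbar-derivative of F is that of E' times the kernel, minus C times the three profile
    derivatives. [kernel_bound] with C = C0 K e makes its real part nonpositive. *)
Let Fcdiff x y be : inQ x -> inQ y -> mkC x y != 0 -> mkC x y != 1 ->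
  cdiff E (mkC x y) be -> cabs be <= K * cabs (mkC x y) `^ al ->
  exists2 be', cdiff F (mkC x y) be' & cre be' <= 0.
Proof.
move=> xP yP; set w := mkC x y => w0 w1 dE bK.
have lE := Eloclip xP yP; rewrite -/w in lE.
have t0 := csq_gt0 w0; have t1 := csq_gt0 w1.
have d1 := radial_cdiff w0 (lip1_prof (al / 2) t0) (der1_prof (al / 2) t0).
have d2 := radial_cdiff w0 (lip1_tail ((1 - al) / 2) t0) (der1_tail ((1 - al) / 2) t0).
have d3 := radial_cdiff w1 (lip1_prof (1 / 2) t1) (der1_prof (1 / 2) t1).
have lc k : loclip (fun=> k) w := loclip_const k w.
have dE' := cdiffM (lc (- cconj (E 1))) lE (cdiff_const _ w) dE.
have lE' : loclip E' w by apply: loclipM.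
have i0 := loclip_inv w0; have i1 := loclip_inv w1.
have dk := cdiffM (loclipM i0 i0) i1 (cdiffM i0 i0 (cdiff_inv w0) (cdiff_inv w0)) (cdiff_inv w1).
have dEk := cdiffM lE' (kloclip w0 w1) dE' dk.
have dB := cdiffM (lc (mkC (e ^+ 2) 0)) i1 (cdiff_const _ w) (cdiff_inv w1).
have l12 := loclipD (loclipD (P1loclip w0) (P2loclip w0)) (P3loclip w1).
have dP := cdiffM (lc (mkC (- C) 0)) l12 (cdiff_const _ w) (cdiffD (cdiffD d1 d2) d3).
have := cdiffD (cdiffD dEk dB) dP; set be' := (X in cdiff _ _ X) => dF.
exists be'; first exact: dF.
have {dF} -> : be' = - cconj (E 1) * be * k w + mkC (- C) 0 * (mkC (prof' (al / 2) (csq (w - 0))) 0 +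
   mkC (tail' ((1 - al) / 2) (csq (w - 0))) 0 + mkC (prof' (1 / 2) (csq (w - 1))) 0).
  by rewrite /be'; ring.
rewrite creD; set A := _ * k w.
have hA : cabs A <= e * (K * (cabs w `^ al / cabs w ^+ 2 / cabs (w - 1))).
  rewrite /A /k !cabsM cabsN cabsJ !cabsV -/e subr0.
  have -> : cabs w `^ al / cabs w ^+ 2 / cabs (w - 1) =
      cabs w `^ al * ((cabs w)^-1 / cabs w / cabs (w - 1)).
    by field; rewrite !lt0r_neq0// cabs_gt0// subr_eq0.
  rewrite -mulrA; apply: ler_wpM2l => //; rewrite [leRHS]mulrA; apply: ler_wpM2r => //.
  by rewrite !mulr_ge0 ?invr_ge0 ?cabs_ge0.
have kb := @kernel_bound R al (cabs w) (cabs (w - 1)) al0 al1.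
rewrite !cabs_gt0 subr_eq0 in kb; move: (kb w0 w1).
have h1 : cabs w <= cabs (w - 1) + 1.
  by have := cabsBB w 1; rewrite cabs1; lra.
have h2 : 1 <= cabs w + cabs (w - 1).
  by have := cabsBB 1 w; rewrite cabs1 cabsC; lra.
move=> /(_ h1 h2); rewrite -/C0 => kb'.
have eK : 0 <= e * K by rewrite mulr_ge0.
have := ler_wpM2l eK kb'; have := cre_le_abs A; move: A hA => A hA.
rewrite !csqE !subr0 !cE /C !mul0r !subr0; lra.
Qed.

(** The poles 0 and 1 have the same imaginary part, so one condition on [c] serves both. *)
Let adm a c h := [/\ subsquare (- (M / 3)) (- (M / 3)) M a c h, 0 < h, off n a h 0, off n a h 1 & off n c h 0].

Let adm_closed : dyadic_closed adm.
Proof.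
move=> a c h h0 [s _ o1 o2 o3]; have [s1 s2 s3 s4] := subsquare_closed h0 s.
by split; split => //; do ?[exact: off_half0|exact: off_half1].
Qed.

Let adm_edge a c h : adm a c h -> edge_cont F a c h.
Proof.
move=> [[s1 s2 s3 s4] h0 o1 o2 o3] x y /andP[xa xb] /andP[yc yd] edge.
have n0 : 0 < 3 * M by have := M7; lra.
have dd q b : off n b h q -> q != b.
  move=> /(off_dist h0); apply: contraTneq => ->; rewrite subrr normr0 mulr0 -ltNge//.
apply: loclip_cont; apply: Floclip; try by rewrite /inQ; lra.
  apply: contraPneq edge => /(congr1 (fun z : R[i] => (cre z, cim z))) [-> ->].
  case=> -[] e1.
  - by have := dd _ _ o1; rewrite e1 eqxx.
  - by have := dd _ _ (off_shift o1); rewrite e1 eqxx.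
  - by have := dd _ _ o3; rewrite e1 eqxx.
  - by have := dd _ _ (off_shift o3); rewrite e1 eqxx.
apply: contraPneq edge => /(congr1 (fun z : R[i] => (cre z, cim z))) [-> ->].
case=> -[] e1.
- by have := dd _ _ o2; rewrite e1 eqxx.
- by have := dd _ _ (off_shift o2); rewrite e1 eqxx.
- by have := dd _ _ o3; rewrite e1 eqxx.
- by have := dd _ _ (off_shift o3); rewrite e1 eqxx.
Qed.

(** For the initial square the integers of [off] are n = 3 j + 1 at the point 0 and n + 3 at the
    point 1, both prime to 3. *)
Let adm0 : adm (- (M / 3)) (- (M / 3)) M.
Proof.
have M0 : 0 < M by have := M7; lra.
have nE : M = 3 * j%:R + 1 by rewrite /M /n natrD natrM.
have jE : j%:R = (M - 1) / 3 :> R by rewrite nE; field.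
split => //.
- by exists j%:Z; left; rewrite -pmulrn jE; field.
- by exists (j%:Z + 1); left; rewrite intrD -pmulrn jE; field.
- by exists j%:Z; left; rewrite -pmulrn jE; field.
Qed.

Let n0 : 0 < 3 * M. Proof. by have := M7; lra. Qed.

Let E'_abs w : cabs (E' w) = e * cabs (E w).
Proof. by rewrite cabsM cabsN cabsJ. Qed.

Let B_abs w : cabs (B w) = e ^+ 2 / cabs (w - 1).
Proof. by rewrite cabsM cabs_real ger0_norm ?sqr_ge0// cabsV. Qed.

Let k_abs w : cabs (k w) = (cabs w)^-1 * (cabs w)^-1 / cabs (w - 1).
Proof. by rewrite !cabsM !cabsV subr0. Qed.

(** On every side of the square one coordinate keeps the distance given by [off_dist]. *)
Let edge_far (s1 s2 a c h x y : R) : 0 < h -> off n a h s1 -> off n c h s2 ->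
  (x = a \/ x = a + h) \/ (y = c \/ y = c + h) ->
  h / (3 * M) <= cabs (mkC x y - mkC s1 s2).
Proof.
move=> h0 o1 o2 edge; rewrite ler_pdivrMr// mulrC.
have kx (t b : R) : off n b h t -> h <= 3 * M * `|b - t|.
  by rewrite distrC; exact: off_dist.
have lex (t : R) : `|t| <= cabs (mkC x y - mkC s1 s2) -> h <= 3 * M * `|t| ->
    h <= 3 * M * cabs (mkC x y - mkC s1 s2).
  by move=> l /le_trans; apply; rewrite ler_pM2l.
case: edge => -[] eE.
- by apply: (lex (x - s1)); [exact: (cre_le (mkC x y - mkC s1 s2))|rewrite eE; exact: kx].
- by apply: (lex (x - s1)); [exact: (cre_le (mkC x y - mkC s1 s2))|rewrite eE; apply: kx; exact: off_shift].
- by apply: (lex (y - s2)); [exact: (cim_le (mkC x y - mkC s1 s2))|rewrite eE; exact: kx].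
- by apply: (lex (y - s2)); [exact: (cim_le (mkC x y - mkC s1 s2))|rewrite eE; apply: kx; exact: off_shift].
Qed.

Let reF w : cre (F w) = cre (E' w * k w + B w) - C * cre (P1 w) - C * cre (P2 w) - C * cre (P3 w).
Proof.
rewrite /F; move: (E' w * k w + B w) (P1 w) (P2 w) (P3 w) (C) => X Y1 Y2 Y3 c.
by rewrite !(creD, creM) cre_mk cim_mk; ring.
Qed.

Let imF w : cim (F w) = cim (E' w * k w + B w) - C * cim (P1 w) - C * cim (P2 w) - C * cim (P3 w).
Proof.
rewrite /F; move: (E' w * k w + B w) (P1 w) (P2 w) (P3 w) (C) => X Y1 Y2 Y3 c.
by rewrite !(cimD, cimM) cre_mk cim_mk; ring.
Qed.

Let CP_re (P : R[i] -> R[i]) w : - (C * cabs (P w)) <= C * cre (P w) <= C * cabs (P w).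
Proof. by rewrite -mulrN !ler_wpM2l// ?cre_ge_abs ?cre_le_abs. Qed.

Let CP_im (P : R[i] -> R[i]) w : - (C * cabs (P w)) <= C * cim (P w) <= C * cabs (P w).
Proof. by rewrite -mulrN !ler_wpM2l// ?cim_ge_abs ?cim_le_abs. Qed.

(** Near 0 the kernel is at most 2 / |w|^2 and E is o(|w|), so the integrand is o(1 / h) on edges at
    distance comparable to h. [P1] and [P2] enter through their sign only. *)
Let sing0 eps : 0 < eps -> exists2 d, 0 < d & forall a c h, adm a c h -> 0 < h < d ->
  a <= 0 <= a + h -> c <= 0 <= c + h -> coint F a c h <= eps.
Proof.
(* Fixed so that 24 e eta M <= eps / 2; the summand 1 in e + 1 covers e = 0. *)
move=> eps0; pose eta := eps / (48 * M * (e + 1)).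
have k0 : 0 < 48 * M * (e + 1) by have := M7; have := e0; nra.
have eta0 : 0 < eta by rewrite divr_gt0.
have [d1 d10 d1P] := Eo eta0.
pose b0 := 8 * e ^+ 2 + 8 * C + 1.
have b00 : 0 < b0 by rewrite /b0; have := sqr_ge0 e; have := C0'; lra.
exists (Num.min (Num.min (1 / 4) (d1 / 2)) (eps / 2 / b0)); first by rewrite !lt_min !divr_gt0.
move=> a c h ah; rewrite !lt_min => /andP[hh /andP[/andP[h4 hd] hb]] a0 c0.
have [_ _ o1 _ o3] := ah.
have cmp x y : a <= x <= a + h -> c <= y <= c + h -> (x = a \/ x = a + h) \/ (y = c \/ y = c + h) ->
    let w := mkC x y in cabs (E' w * k w + B w) + C * cabs (P3 w) <= 6 * e * eta * M / h + 2 * e ^+ 2 + 2 * C.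
  move=> xP yP edge; set w := mkC x y; cbv zeta.
  have w1 : cabs w <= 2 * h.
    have -> : w = mkC x y - mkC 0 0 by apply: cplx_eq; rewrite !cE ?subr0.
    by apply: cabs_insq; rewrite subr0 ler_norml; lra.
  have w2 : h / (3 * M) <= cabs w.
    have := edge_far hh o1 o3 edge; rewrite (_ : mkC x y - mkC 0 0 = w)//.
    by apply: cplx_eq; rewrite !cE ?subr0.
  have w0 : 0 < cabs w by apply: lt_le_trans w2; rewrite divr_gt0.
  have s1 : 1 / 2 <= cabs (w - 1).
    by have := cabsBB 1 w; rewrite cabs1 (cabsC 1 w); lra.
  have si : (cabs (w - 1))^-1 <= 2 by rewrite -[2]invrK lef_pV2 ?posrE ?invr_gt0//; lra.
  have si0 : 0 <= (cabs (w - 1))^-1 by rewrite invr_ge0 cabs_ge0.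
  have wi : (cabs w)^-1 <= 3 * M / h.
    by rewrite -[3 * M / h]invrK invf_div lef_pV2 ?posrE ?divr_gt0.
  have Ew : cabs (E w) <= eta * cabs w by apply: d1P; lra.
  have p3 : C * cabs (P3 w) <= C * 2.
    by apply: ler_wpM2l => //; apply: le_trans (radial_abs _ b3 _) si.
  have pB : cabs (B w) <= e ^+ 2 * 2 by rewrite B_abs ler_wpM2l// sqr_ge0.
  have pE : cabs (E' w * k w) <= e * eta * (3 * M / h) * 2.
    rewrite cabsM E'_abs k_abs mulrA; apply: ler_pM => //.
      by rewrite !mulr_ge0 ?invr_ge0 ?cabs_ge0.
    rewrite -(mulrA e) -(mulrA e); apply: ler_wpM2l => //.
    apply: (@le_trans _ _ (eta * cabs w * ((cabs w)^-1 * (cabs w)^-1))).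
      by rewrite ler_wpM2r// mulr_ge0 ?invr_ge0 ?cabs_ge0.
    have -> : eta * cabs w * ((cabs w)^-1 * (cabs w)^-1) = eta * (cabs w)^-1.
      by field; rewrite lt0r_neq0.
    by rewrite ler_pM2l.
  have := cabsD (E' w * k w) (B w).
  have -> : 6 * e * eta * M / h = e * eta * (3 * M / h) * 2 by field; rewrite lt0r_neq0.
  lra.
have F1 x y : 0 <= x * cre (P1 (mkC x y)).
  by have := radial_cre 0 b1 (mkC x y); rewrite creD creN subr0.
have F2 x y : 0 <= x * cre (P2 (mkC x y)).
  by have := radial_cre 0 b2 (mkC x y); rewrite creD creN subr0.
have G1 x y : y * cim (P1 (mkC x y)) <= 0.
  by have := radial_cim 0 b1 (mkC x y); rewrite cimD cimN subr0.
have G2 x y : y * cim (P2 (mkC x y)) <= 0.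
  by have := radial_cim 0 b2 (mkC x y); rewrite cimD cimN subr0.
pose b := 6 * e * eta * M / h + 2 * e ^+ 2 + 2 * C.
have aP : a <= a <= a + h /\ a <= a + h <= a + h by lra.
have cP : c <= c <= c + h /\ c <= c + h <= c + h by lra.
have a0' : a < 0.
  rewrite lt_neqAle; case/andP: a0 => -> _; rewrite andbT; apply/eqP => E1.
  by have := off_dist hh o1; rewrite E1 subrr normr0 mulr0 leNgt hh.
have a1' : 0 < a + h.
  rewrite lt_neqAle; case/andP: a0 => _ ->; rewrite andbT; apply/eqP => E1.
  by have := off_dist hh (off_shift o1); rewrite -E1 subrr normr0 mulr0 leNgt hh.
have c0' : c < 0.
  rewrite lt_neqAle; case/andP: c0 => -> _; rewrite andbT; apply/eqP => E1.
  by have := off_dist hh o3; rewrite E1 subrr normr0 mulr0 leNgt hh.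
have c1' : 0 < c + h.
  rewrite lt_neqAle; case/andP: c0 => _ ->; rewrite andbT; apply/eqP => E1.
  by have := off_dist hh (off_shift o3); rewrite -E1 subrr normr0 mulr0 leNgt hh.
apply: (@le_trans _ _ (4 * b * h)).
  apply: coint_le4; [exact: ltW|exact: adm_edge| |].
  - move=> x xP; split.
      have := cmp x c xP cP.1 (or_intror (or_introl erefl)); cbv zeta.
      have := G1 x c; have := G2 x c; rewrite !nmulr_rle0// => g2 g1.
      have := mulr_ge0 C0' g1; have := mulr_ge0 C0' g2.
      have /andP[+ _] := CP_im P3 (mkC x c).
      have := cim_le_abs (E' (mkC x c) * k (mkC x c) + B (mkC x c)).
      by rewrite imF /b; lra.
    have := cmp x (c + h) xP cP.2 (or_intror (or_intror erefl)); cbv zeta.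
    have := G1 x (c + h); have := G2 x (c + h); rewrite !pmulr_rle0// => g2 g1.
    have := mulr_ge0_le0 C0' g1; have := mulr_ge0_le0 C0' g2.
    have /andP[_ +] := CP_im P3 (mkC x (c + h)).
    have := cim_ge_abs (E' (mkC x (c + h)) * k (mkC x (c + h)) + B (mkC x (c + h))).
    by rewrite imF /b; lra.
  - move=> y yP; split.
      have := cmp (a + h) y aP.2 yP (or_introl (or_intror erefl)); cbv zeta.
      have := F1 (a + h) y; have := F2 (a + h) y; rewrite !pmulr_rge0// => g2 g1.
      have := mulr_ge0 C0' g1; have := mulr_ge0 C0' g2.
      have /andP[+ _] := CP_re P3 (mkC (a + h) y).
      have := cre_le_abs (E' (mkC (a + h) y) * k (mkC (a + h) y) + B (mkC (a + h) y)).
      by rewrite reF /b; lra.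
    have := cmp a y aP.1 yP (or_introl (or_introl erefl)); cbv zeta.
    have := F1 a y; have := F2 a y; rewrite !nmulr_rge0// => g2 g1.
    have := mulr_ge0_le0 C0' g1; have := mulr_ge0_le0 C0' g2.
    have /andP[_ +] := CP_re P3 (mkC a y).
    have := cre_ge_abs (E' (mkC a y) * k (mkC a y) + B (mkC a y)).
    by rewrite reF /b; lra.
have M0 : 0 < M by have := M7; lra.
have e1 : 0 < e + 1 by have := e0; lra.
have -> : 4 * b * h = 24 * e * eta * M + h * (8 * e ^+ 2 + 8 * C).
  by rewrite /b; field; rewrite lt0r_neq0.
have q1 : 24 * e * eta * M <= eps / 2.
  have -> : 24 * e * eta * M = eps / 2 * (e / (e + 1)) by rewrite /eta; field; rewrite !lt0r_neq0.
  by rewrite ler_piMr ?divr_ge0 ?(ltW eps0)// ler_pdivrMr// mul1r lerDl.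
have q2 : h * (8 * e ^+ 2 + 8 * C) <= eps / 2.
  apply: (@le_trans _ _ (h * b0)); first by rewrite ler_pM2l// /b0 lerDl.
  by rewrite -ler_pdivlMr// ltW.
lra.
Qed.

(** As B = e^2 w^2 k, the sum is (E'(w) - E'(1) + e^2 (w^2 - 1)) k(w), and both terms in the bracket
    are O(|w - 1|): the pole at 1 disappears although E is merely Lipschitz there. *)
Let num_abs w : cabs w <= 3 / 2 -> w != 0 -> w != 1 ->
  cabs (E' w * k w + B w) <= (e * L + 3 * e ^+ 2) * ((cabs w)^-1 * (cabs w)^-1).
Proof.
move=> w32 w0 w1; have w1' : w - 1 != 0 by rewrite subr_eq0.
have E1E : E' 1 = - mkC (e ^+ 2) 0.
  by apply: cplx_eq; rewrite /E' /e cabs_sqr !(cE, cconjE); ring.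
have -> : E' w * k w + B w = ((E' w - E' 1) + mkC (e ^+ 2) 0 * ((w - 1) * (w + 1))) * k w.
  by rewrite E1E /k /B subr0; field; rewrite w0 w1'.
rewrite cabsM k_abs.
have h1 : cabs (E' w - E' 1) <= e * L * cabs (w - 1).
  have -> : E' w - E' 1 = - cconj (E 1) * (E w - E 1) by rewrite /E'; ring.
  rewrite cabsM cabsN cabsJ -mulrA ler_wpM2l//; apply: Elip; last by rewrite cabs1; have := M7; lra.
  by have := M7; lra.
have h2 : cabs (mkC (e ^+ 2) 0 * ((w - 1) * (w + 1))) <= 3 * e ^+ 2 * cabs (w - 1).
  rewrite !cabsM cabs_real ger0_norm ?sqr_ge0//.
  have -> : 3 * e ^+ 2 * cabs (w - 1) = e ^+ 2 * (cabs (w - 1) * 3) by ring.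
  rewrite ler_wpM2l ?sqr_ge0// ler_wpM2l ?cabs_ge0//.
  by have := cabsD w 1; rewrite cabs1; lra.
have h3 : cabs (E' w - E' 1 + mkC (e ^+ 2) 0 * ((w - 1) * (w + 1))) <= (e * L + 3 * e ^+ 2) * cabs (w - 1).
  by apply: le_trans (cabsD _ _) _; lra.
have i0 : 0 <= (cabs w)^-1 * (cabs w)^-1 / cabs (w - 1).
  by rewrite !mulr_ge0 ?invr_ge0 ?cabs_ge0.
apply: le_trans (ler_wpM2r i0 h3) _.
rewrite le_eqVlt; apply/orP; left; apply/eqP; field.
by rewrite !lt0r_neq0 ?cabs_gt0.
Qed.

(** Apart from [P3], whose sign is favourable, the integrand is bounded near 1. *)
Let sing1 eps : 0 < eps -> exists2 d, 0 < d & forall a c h, adm a c h -> 0 < h < d ->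
  a <= 1 <= a + h -> c <= 0 <= c + h -> coint F a c h <= eps.
Proof.
move=> eps0.
pose b := 4 * (e * L + 3 * e ^+ 2) + 4 * C + 1.
have eL : 0 <= e * L by rewrite mulr_ge0// ltW.
have b0 : 0 < b by rewrite /b; have := sqr_ge0 e; have := C0'; lra.
exists (Num.min (1 / 4) (eps / 4 / b)); first by rewrite !lt_min !divr_gt0.
move=> a c h ah; rewrite !lt_min => /andP[hh /andP[h4 hb]] a0 c0.
have [_ _ _ o1 o3] := ah.
have cmp x y : a <= x <= a + h -> c <= y <= c + h -> (x = a \/ x = a + h) \/ (y = c \/ y = c + h) ->
    cabs (E' (mkC x y) * k (mkC x y) + B (mkC x y)) + C * cabs (P1 (mkC x y)) + C * cabs (P2 (mkC x y)) <= b.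
  move=> xP yP edge; set w := mkC x y.
  have wE : w - 1 = mkC x y - mkC 1 0 by apply: cplx_eq; rewrite !cE ?subr0.
  have w1 : cabs (w - 1) <= 2 * h.
    by rewrite wE; apply: cabs_insq; rewrite ler_norml; lra.
  have w2 : h / (3 * M) <= cabs (w - 1).
    by have := edge_far hh o1 o3 edge; rewrite -wE.
  have w10 : w != 1 by rewrite -subr_eq0 -cabs_gt0; apply: lt_le_trans w2; rewrite divr_gt0.
  have wl : 1 / 2 <= cabs w.
    by have := cabsBB 1 (1 - w); rewrite (_ : 1 - (1 - w) = w); [rewrite cabs1 (cabsC 1 w); lra|ring].
  have wu : cabs w <= 3 / 2.
    by have := cabsBB w 1; rewrite cabs1; lra.
  have w00 : w != 0 by rewrite -cabs_gt0; lra.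
  have wi : (cabs w)^-1 <= 2 by rewrite -[2]invrK lef_pV2 ?posrE ?invr_gt0//; lra.
  have wi0 : 0 <= (cabs w)^-1 by rewrite invr_ge0 cabs_ge0.
  have p1 : C * cabs (P1 w) <= C * 2.
    by apply: ler_wpM2l => //; apply: le_trans (radial_abs _ b1 _) _; rewrite subr0.
  have p2 : C * cabs (P2 w) <= C * 2.
    by apply: ler_wpM2l => //; apply: le_trans (radial_abs _ b2 _) _; rewrite subr0.
  have i4 : (cabs w)^-1 * (cabs w)^-1 <= 4.
    by have := ler_pM wi0 wi0 wi wi; lra.
  have n1 : 0 <= e * L + 3 * e ^+ 2 by have := sqr_ge0 e; lra.
  have := num_abs wu w00 w10; have := ler_wpM2l n1 i4.
  rewrite /b; lra.
have F3 x y : 0 <= (x - 1) * cre (P3 (mkC x y)).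
  by have := radial_cre 1 b3 (mkC x y); rewrite creD creN.
have G3 x y : y * cim (P3 (mkC x y)) <= 0.
  by have := radial_cim 1 b3 (mkC x y); rewrite cimD cimN subr0.
have aP : a <= a <= a + h /\ a <= a + h <= a + h by lra.
have cP : c <= c <= c + h /\ c <= c + h <= c + h by lra.
have a0' : a - 1 < 0.
  rewrite lt_neqAle subr_le0 subr_eq0; case/andP: a0 => -> _; rewrite andbT; apply/eqP => E1.
  by have := off_dist hh o1; rewrite E1 subrr normr0 mulr0 leNgt hh.
have a1' : 0 < a + h - 1.
  rewrite lt_neqAle subr_ge0 eq_sym subr_eq0; case/andP: a0 => _ ->; rewrite andbT; apply/eqP => E1.
  by have := off_dist hh (off_shift o1); rewrite -E1 subrr normr0 mulr0 leNgt hh.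
have c0' : c < 0.
  rewrite lt_neqAle; case/andP: c0 => -> _; rewrite andbT; apply/eqP => E1.
  by have := off_dist hh o3; rewrite E1 subrr normr0 mulr0 leNgt hh.
have c1' : 0 < c + h.
  rewrite lt_neqAle; case/andP: c0 => _ ->; rewrite andbT; apply/eqP => E1.
  by have := off_dist hh (off_shift o3); rewrite -E1 subrr normr0 mulr0 leNgt hh.
apply: (@le_trans _ _ (4 * b * h)).
  apply: coint_le4; [exact: ltW|exact: adm_edge| |].
  - move=> x xP; split.
      have := cmp x c xP cP.1 (or_intror (or_introl erefl)).
      have := G3 x c; rewrite !nmulr_rle0// => /(mulr_ge0 C0').
      have /andP[+ _] := CP_im P1 (mkC x c); have /andP[+ _] := CP_im P2 (mkC x c).
      have := cim_le_abs (E' (mkC x c) * k (mkC x c) + B (mkC x c)).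
      by rewrite imF; lra.
    have := cmp x (c + h) xP cP.2 (or_intror (or_intror erefl)).
    have := G3 x (c + h); rewrite !pmulr_rle0// => /(mulr_ge0_le0 C0').
    have /andP[_ +] := CP_im P1 (mkC x (c + h)); have /andP[_ +] := CP_im P2 (mkC x (c + h)).
    have := cim_ge_abs (E' (mkC x (c + h)) * k (mkC x (c + h)) + B (mkC x (c + h))).
    by rewrite imF; lra.
  - move=> y yP; split.
      have := cmp (a + h) y aP.2 yP (or_introl (or_intror erefl)).
      have := F3 (a + h) y; rewrite !pmulr_rge0// => /(mulr_ge0 C0').
      have /andP[+ _] := CP_re P1 (mkC (a + h) y); have /andP[+ _] := CP_re P2 (mkC (a + h) y).
      have := cre_le_abs (E' (mkC (a + h) y) * k (mkC (a + h) y) + B (mkC (a + h) y)).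
      by rewrite reF; lra.
    have := cmp a y aP.1 yP (or_introl (or_introl erefl)).
    have := F3 a y; rewrite !nmulr_rge0// => /(mulr_ge0_le0 C0').
    have /andP[_ +] := CP_re P1 (mkC a y); have /andP[_ +] := CP_re P2 (mkC a y).
    have := cre_ge_abs (E' (mkC a y) * k (mkC a y) + B (mkC a y)).
    by rewrite reF; lra.
have : b * h <= eps / 4 by rewrite mulrC -ler_pdivlMr// ltW.
lra.
Qed.

(** The integral of F is nonpositive, while on the outer square [B] contributes at least e^2 / (2 M)
    along the right side and with the good sign on the others. Weighing this against the bound [bA]
    for all remaining terms and dividing by e gives the claim. *)
Lemma pointwise_estimate : e <= 144 * (L / M + C0 * K).
Proof.
have M0 : 0 < M by have := M7; lra.
have [/eqP e00|en0] := boolP (e == 0).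
  by rewrite e00 mulr_ge0// addr_ge0// ?divr_ge0 ?mulr_ge0 ?(ltW L0) ?(ltW M0) ?(ltW C00).
have ep : 0 < e by rewrite lt_neqAle eq_sym en0 e0.
have key : coint F (- (M / 3)) (- (M / 3)) M <= 0.
  apply: (@stokes_singular R F adm bad adm_closed adm_edge [:: (0, 0); (1, 0)]) => //.
  - move=> a c h s [_ h0 o1 o2 o3]; rewrite !inE => /orP[] /eqP -> /=; split; apply/eqP => eq.
    + by have := off_dist h0 (off_shift o1); rewrite -eq subrr normr0 mulr0 leNgt h0.
    + by have := off_dist h0 (off_shift o3); rewrite -eq subrr normr0 mulr0 leNgt h0.
    + by have := off_dist h0 (off_shift o2); rewrite -eq subrr normr0 mulr0 leNgt h0.
    + by have := off_dist h0 (off_shift o3); rewrite -eq subrr normr0 mulr0 leNgt h0.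
  - move=> x y xP yP; rewrite !inE negb_or => /andP[w0 w1].
    have w0' : mkC x y != 0 by apply: contra w0 => /eqP [-> ->].
    have w1' : mkC x y != 1 by apply: contra w1 => /eqP [-> ->].
    split; first exact: Floclip.
    have [|[be dE beK]] := Ed xP yP; first by left.
    by right; exact: Fcdiff dE beK.
  - move=> x y xP yP; rewrite !inE => /orP[] /eqP[-> ->] eps eps0.
      have [d d0 dP] := sing0 eps0; exists d => // a c h ah _; exact: dP.
    have [d d0 dP] := sing1 eps0; exists d => // a c h ah _; exact: dP.
(* On the boundary |w| >= M / 3 and |w - 1| >= M / 6: 18 = 3 * 6 comes from E' k and 12 = 3 + 3 + 6
   from the barriers. *)
pose bA := 18 * e * L / M ^+ 2 + 12 * C / M.
have cmp x y : inQ x -> inQ y -> M / 3 <= cabs (mkC x y) ->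
    cabs (E' (mkC x y) * k (mkC x y)) + C * cabs (P1 (mkC x y)) + C * cabs (P2 (mkC x y)) + C * cabs (P3 (mkC x y)) <= bA.
  move=> xP yP; set w := mkC x y => wl.
  have wM : cabs w < M by exact: inQ_abs.
  have w0 : 0 < cabs w by apply: lt_le_trans wl; rewrite divr_gt0.
  have s6 : M / 6 <= cabs (w - 1).
    by have := cabsBB w 1; rewrite cabs1; have := M7; lra.
  have s0 : 0 < cabs (w - 1) by apply: lt_le_trans s6; rewrite divr_gt0.
  have wi : (cabs w)^-1 <= 3 / M.
    by rewrite -[3 / M]invrK invf_div lef_pV2 ?posrE ?divr_gt0.
  have si : (cabs (w - 1))^-1 <= 6 / M.
    by rewrite -[6 / M]invrK invf_div lef_pV2 ?posrE ?divr_gt0.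
  have wi0 : 0 <= (cabs w)^-1 by rewrite invr_ge0 cabs_ge0.
  have si0 : 0 <= (cabs (w - 1))^-1 by rewrite invr_ge0 cabs_ge0.
  have p1 : C * cabs (P1 w) <= C * (3 / M).
    by apply: ler_wpM2l => //; apply: le_trans (radial_abs _ b1 _) _; rewrite subr0.
  have p2 : C * cabs (P2 w) <= C * (3 / M).
    by apply: ler_wpM2l => //; apply: le_trans (radial_abs _ b2 _) _; rewrite subr0.
  have p3 : C * cabs (P3 w) <= C * (6 / M).
    by apply: ler_wpM2l => //; apply: le_trans (radial_abs _ b3 _) _.
  have Ew : cabs (E w) <= L * cabs w.
    by have := Elip wM (_ : cabs 0 < M); rewrite E0 !subr0; apply; rewrite cabs0.
  have pE : cabs (E' w * k w) <= e * L * (3 / M * (6 / M)).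
    rewrite cabsM E'_abs k_abs -(mulrA e) -(mulrA e); apply: ler_wpM2l => //.
    apply: (@le_trans _ _ (L * cabs w * ((cabs w)^-1 * (cabs w)^-1 / cabs (w - 1)))).
      by rewrite ler_wpM2r// !mulr_ge0.
    have -> : L * cabs w * ((cabs w)^-1 * (cabs w)^-1 / cabs (w - 1)) = L * ((cabs w)^-1 * (cabs (w - 1))^-1).
      by field; rewrite !lt0r_neq0.
    by rewrite ler_pM2l//; apply: ler_pM.
  have -> : bA = e * L * (3 / M * (6 / M)) + C * (3 / M) + C * (3 / M) + C * (6 / M).
    by rewrite /bA; field; rewrite lt0r_neq0.
  lra.
have far x y : (`|x| >= M / 3) || (`|y| >= M / 3) -> M / 3 <= cabs (mkC x y).
  by case/orP => /le_trans; apply; [exact: (cre_le (mkC x y))|exact: (cim_le (mkC x y))].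
have lo : inQ (- (M / 3)) /\ `|- (M / 3)| >= M / 3.
  by rewrite /inQ normrN; split; [lra|exact: ler_norm].
have hi : inQ (- (M / 3) + M) /\ `|- (M / 3) + M| >= M / 3.
  rewrite /inQ; split; [lra|apply: le_trans (ler_norm _); lra].
have Bim x y : cim (B (mkC x y)) = - (e ^+ 2 * (y / csq (mkC x y - 1))).
  by rewrite /B cimM cre_mk cim_mk mul0r addr0 cim_inv cimD cimN subr0 mulrN.
have Bre x y : cre (B (mkC x y)) = e ^+ 2 * ((x - 1) / csq (mkC x y - 1)).
  by rewrite /B creM cre_mk cim_mk mul0r subr0 cre_inv creD creN.
have := @coint_ge4 R F (- (M / 3)) (- (M / 3)) M bA (e ^+ 2 / (2 * M)) (ltW M0) (adm_edge adm0).
move=> /(_ _ _)/le_trans/(_ key) h.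
have {}h : (e ^+ 2 / (2 * M) - 4 * bA) * M <= 0.
  apply: h.
  - move=> x xP; split.
      have := cmp x _ xP lo.1 (far _ _ _); rewrite lo.2 orbT => /(_ isT).
      have : 0 <= cim (B (mkC x (- (M / 3)))).
        by rewrite Bim mulNr mulrN opprK mulr_ge0 ?sqr_ge0// divr_ge0 ?csq_ge0 ?divr_ge0// ltW.
      set w := mkC _ _.
      have /andP[_ +] := CP_im P1 w; have /andP[_ +] := CP_im P2 w; have /andP[_ +] := CP_im P3 w.
      have := cim_ge_abs (E' w * k w); rewrite imF cimD; lra.
    have := cmp x _ xP hi.1 (far _ _ _); rewrite hi.2 orbT => /(_ isT).
    have : cim (B (mkC x (- (M / 3) + M))) <= 0.
      rewrite Bim oppr_le0 mulr_ge0 ?sqr_ge0// divr_ge0 ?csq_ge0//; lra.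
    set w := mkC _ _.
    have /andP[+ _] := CP_im P1 w; have /andP[+ _] := CP_im P2 w; have /andP[+ _] := CP_im P3 w.
    have := cim_le_abs (E' w * k w); rewrite imF cimD; lra.
  - move=> y yP; split.
      have := cmp _ y hi.1 yP (far _ _ _); rewrite hi.2 => /(_ isT).
      have : e ^+ 2 / (2 * M) <= cre (B (mkC (- (M / 3) + M) y)).
        rewrite Bre ler_wpM2l ?sqr_ge0//.
        have c0 : 0 < csq (mkC (- (M / 3) + M) y - 1).
          rewrite csqE exprn_gt0// cabs_gt0 subr_eq0; apply/eqP => -[].
          by have := M7; lra.
        rewrite ler_pdivlMr// mulrC ler_pdivrMr ?mulr_gt0//.
        rewrite /csq !cE; have := M7; case/andP: yP => y1 y2; nra.
      set w := mkC _ _.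
      have /andP[_ +] := CP_re P1 w; have /andP[_ +] := CP_re P2 w; have /andP[_ +] := CP_re P3 w.
      have := cre_ge_abs (E' w * k w); rewrite reF creD; lra.
    have := cmp _ y lo.1 yP (far _ _ _); rewrite lo.2 => /(_ isT).
    have : cre (B (mkC (- (M / 3)) y)) <= 0.
      rewrite Bre mulr_ge0_le0 ?sqr_ge0// mulr_le0_ge0 ?invr_ge0 ?csq_ge0//.
      by have := M7; lra.
    set w := mkC _ _.
    have /andP[+ _] := CP_re P1 w; have /andP[+ _] := CP_re P2 w; have /andP[+ _] := CP_re P3 w.
    have := cre_le_abs (E' w * k w); rewrite reF creD; lra.
(* What remains is e^2 / 2 <= e (72 L / M + 48 C0 K), whence 144. *)
move: h; rewrite mulrBl subr_le0.
have -> : e ^+ 2 / (2 * M) * M = e * (e / 2) by field; rewrite lt0r_neq0.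
have -> : 4 * bA * M = e * (72 * (L / M) + 48 * (C0 * K)).
  by rewrite /bA /C; field; rewrite lt0r_neq0.
rewrite ler_pM2l//.
have : 0 <= C0 * K by rewrite mulr_ge0// ltW.
lra.
Qed.

End PointwiseEstimate.

(** * Rotation of the gradient graph *)

Section PhaseAlgebra.
Context {R : realType}.
Implicit Types (t l x N B th b : R).

Lemma cos_atan_gt0 x : 0 < cos (atan x).
Proof. by apply: cos_gt0_pihalf; rewrite atan_gtNpi2 atan_ltpi2. Qed.

Lemma sin_atanE x : sin (atan x) = x * cos (atan x).
Proof.
by rewrite -{2}[x](@atanK R) /tan divfK// lt0r_neq0// cos_atan_gt0.
Qed.

Lemma cos_atan_inv_le x B : `|x| <= B -> (cos (atan x))^-1 <= 1 + B.
Proof.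
move=> xB; have c0 := cos_atan_gt0 x; have B0 : 0 <= B by apply: le_trans xB.
rewrite -[leLHS]mul1r ler_pdivrMr//.
have := cos2Dsin2 (atan x); rewrite sin_atanE exprMn.
set k := cos _; have k0 : 0 < k := c0.
have x2 : x ^+ 2 <= B ^+ 2 by rewrite -(real_normK (num_real x)) ler_sqr ?nnegrE.
move=> h; rewrite -ler_sqr ?nnegrE//; last by rewrite mulr_ge0 ?(ltW k0)// addr_ge0.
rewrite expr1n.
have k2 : 0 <= k ^+ 2 := sqr_ge0 k.
have := ler_wpM2r k2 x2; have := mulr_ge0 B0 k2.
have -> : ((1 + B) * k) ^+ 2 = k ^+ 2 + 2 * (B * k ^+ 2) + B ^+ 2 * k ^+ 2 by ring.
lra.
Qed.

(* l = tan phi turns cos t + sin t * l into cos (t - phi) / cos phi. *)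
Lemma rot_eigen t l : cos t + sin t * l = cos (t - atan l) / cos (atan l).
Proof.
rewrite cosB sin_atanE; field; rewrite lt0r_neq0//; exact: cos_atan_gt0.
Qed.

Lemma atan_diff_le l1 l2 B : `|l1| <= B -> `|l2| <= B -> `|atan l1 - atan l2| <= 2 * atan B.
Proof.
rewrite !ler_norml => /andP[a1 a2] /andP[b1 b2].
have := le_atan a1; have := le_atan a2; have := le_atan b1; have := le_atan b2.
by rewrite atanN => *; apply/andP; split; lra.
Qed.

Lemma cos_ge_bound x b : 0 <= b -> b <= pi -> `|x| <= b -> cos b <= cos x.
Proof.
move=> b0 bpi xb.
have -> : cos x = cos `|x| by have [x0|x0] := leP 0 x; [rewrite ger0_norm|rewrite ltr0_norm// cosN].
have h1 : b \in `[0, pi] by rewrite in_itv /= b0 bpi.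
have h2 : `|x| \in `[0, pi] by rewrite in_itv /= normr_ge0 (le_trans xb bpi).
move: xb; rewrite le_eqVlt => /predU1P[->//|xb]; apply: ltW.
by rewrite ltr_cos.
Qed.

Lemma sin_abs_le x : `|sin x| <= `|x|.
Proof.
have key (y : R) : 0 <= y -> `|sin y| <= y.
  move=> y0; have cs : {within `[0, y], continuous (@sin R)}.
    by apply: continuous_subspaceT => z; exact: continuous_sin.
  have [c _] := MVT_segment y0 (fun x _ => is_derive_sin x) cs.
  rewrite sin0 !subr0 => ->; rewrite normrM (ger0_norm y0) ler_piMl//.
  by rewrite ler_norml cos_geN1 cos_le1.
have [x0|x0] := leP 0 x; first by rewrite (ger0_norm x0) key.
by rewrite (ltr0_norm x0) -normrN -sinN key// oppr_ge0 ltW.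
Qed.

(** [ellip N] is the cosine of the midpoint between atan N and pi / 2: half of the room is spent on
    the oscillation of the phase, the other half keeps the cosine positive. *)
Definition half_gap (N : R) : R := (pi / 2 - atan N) / 2.
Definition ellip (N : R) : R := cos (atan N + half_gap N).

Lemma half_gap_gt0 N : 0 < half_gap N.
Proof. by rewrite divr_gt0// subr_gt0 atan_ltpi2. Qed.

Lemma atan_ge0 N : 0 <= N -> 0 <= atan N.
Proof. by move=> /le_atan; rewrite atan0. Qed.

Lemma ellip_gt0 N : 0 <= N -> 0 < ellip N.
Proof.
move=> N0; apply: cos_gt0_pihalf; have := half_gap_gt0 N; have := atan_ge0 N0.
by rewrite /half_gap; lra.
Qed.

(** The angle th0 / 2 - atan l1 equals (atan l2 - atan l1) / 2 + (th0 - th) / 2. Rotating by half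
    the phase leaves only the difference of the two angles, at most 2 atan N, and the deviation of
    the phase. *)
Lemma rot_eigen_ge N th0 th l1 l2 : 0 <= N -> `|l1| <= N -> `|l2| <= N ->
  atan l1 + atan l2 = th -> `|th - th0| <= 2 * half_gap N ->
  ellip N <= cos (th0 / 2) + sin (th0 / 2) * l1.
Proof.
move=> N0 l1N l2N sum gap; rewrite rot_eigen.
have d := atan_diff_le l1N l2N.
have g0 := half_gap_gt0 N; have a0 := atan_ge0 N0.
have b1 : ellip N <= cos (th0 / 2 - atan l1).
  apply: cos_ge_bound; first by lra.
    by have := pi_gt0 R; move: g0 a0; rewrite /half_gap; lra.
  move: d gap; rewrite !ler_norml => /andP[? ?] /andP[? ?]; apply/andP; split; lra.
have c0 := cos_atan_gt0 l1; have c1 := cos_le1 (atan l1).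
apply: (le_trans b1); rewrite ler_pdivlMr// ler_piMr//.
exact: le_trans (ltW (ellip_gt0 N0)) b1.
Qed.

(** As (c l - s) / (c + s l) = tan(atan l - t), this is a sum of two tangents cleared of
    denominators; it vanishes when the phase is 2 t. *)
Lemma rot_phase t l1 l2 : let c := cos t in let s := sin t in
  (c * l1 - s) * (c + s * l2) + (c * l2 - s) * (c + s * l1) =
  sin (atan l1 + atan l2 - t *+ 2) / (cos (atan l1) * cos (atan l2)).
Proof.
move=> /=; set c := cos t; set s := sin t; have c1 := cos_atan_gt0 l1; have c2 := cos_atan_gt0 l2.
have -> : atan l1 + atan l2 - t *+ 2 = (atan l1 - t) + (atan l2 - t) by rewrite mulr2n; ring.
rewrite sinD !sinB !cosB !sin_atanE -/c -/s.
by field; rewrite !lt0r_neq0.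
Qed.

Lemma rot_phase_le N th0 th l1 l2 : 0 <= N -> `|l1| <= N -> `|l2| <= N ->
  atan l1 + atan l2 = th -> let c := cos (th0 / 2) in let s := sin (th0 / 2) in
  `|(c * l1 - s) * (c + s * l2) + (c * l2 - s) * (c + s * l1)| <= (1 + N) ^+ 2 * `|th - th0|.
Proof.
move=> N0 l1N l2N sum /=; rewrite rot_phase sum.
have -> : th - (th0 / 2) *+ 2 = th - th0 by rewrite mulr2n; field.
have c1 := cos_atan_gt0 l1; have c2 := cos_atan_gt0 l2.
rewrite normrM mulrC ler_pM// ?sin_abs_le// ger0_norm ?invr_ge0 ?mulr_ge0 ?(ltW c1) ?(ltW c2)//.
by rewrite invfM expr2 ler_pM ?invr_ge0 ?(ltW c1) ?(ltW c2) ?cos_atan_inv_le.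
Qed.

End PhaseAlgebra.

Section Rotation.
Context {R : realType}.
Implicit Types (g : R[i] -> R[i]) (x y : R).

Definition rc (x : R) : R[i] := mkC x 0.
Lemma rcJ x : cconj (rc x) = rc x. Proof. by apply: cplx_eq; rewrite !(cE, cconjE) ?oppr0. Qed.
Lemma rcM x y : rc (x * y) = rc x * rc y. Proof. by apply: cplx_eq; rewrite !cE; ring. Qed.
Lemma rcD x y : rc (x + y) = rc x + rc y. Proof. by apply: cplx_eq; rewrite !cE; ring. Qed.
Lemma rcN x : rc (- x) = - rc x. Proof. by apply: cplx_eq; rewrite !cE; ring. Qed.
Lemma rc1 : rc 1 = 1. Proof. by apply: cplx_eq. Qed.
Lemma cabs_rc x : cabs (rc x) = `|x|. Proof. exact: cabs_real. Qed.
Lemma cconjK (z : R[i]) : cconj (cconj z) = z.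
Proof. by apply: cplx_eq; rewrite !cconjE ?opprK. Qed.
Lemma cabs_sub_sqr (u v : R[i]) :
  cabs (u - v) ^+ 2 = cabs u ^+ 2 - 2 * cre (cconj v * u) + cabs v ^+ 2.
Proof. by rewrite !cabs_sqr !(cE, cconjE); ring. Qed.

Lemma cre_cconj_rcM x (u v : R[i]) : cre (cconj (rc x * v) * u) = x * cre (cconj v * u).
Proof. by rewrite cconjM rcJ -mulrA !cE; ring. Qed.

Lemma mul_cconj (z : R[i]) : z * cconj z = rc (cabs z ^+ 2).
Proof. by apply: cplx_eq; rewrite ?cabs_sqr !(cE, cconjE); ring. Qed.

(** Unlike in [cdiff], the coefficient of h is a parameter: for a gradient it is real, namely half
    the Laplacian. *)
Definition cdiff2 g (p al be : R[i]) := forall e, 0 < e ->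
  exists2 d, 0 < d & forall h, cabs h < d ->
    cabs (g (p + h) - g p - al * h - be * cconj h) <= e * cabs h.

(* The rotation of the graph {(z, g z)} of the gradient; in the new coordinates the gradient is (the conjugate of) rotG. *)
Definition rotw (t : R) g (z : R[i]) := rc (cos t) * z + rc (sin t) * g z.
Definition rotG (t : R) g (z : R[i]) := cconj (rc (cos t) * g z - rc (sin t) * z).

Section Point.
Variables (t mu : R) (nu : R[i]).
Let c := cos t.
Let s := sin t.
(** The differential of [rotw] is rot_m h + s nu conj h, with Jacobian [rot_det]. [rot_al] and
    [rot_be] are the coefficients of dw and conj(dw) in the differential of [rotG]; [rot_be] is half
    the sum of the rotated eigenvalues. *)
Definition rot_m := c + s * mu.
Definition rot_det := rot_m ^+ 2 - (s * cabs nu) ^+ 2.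
Definition rot_al : R[i] := rc rot_det^-1 * cconj nu.
Definition rot_be : R := rot_det^-1 * (rot_m * (c * mu - s) - s * c * cabs nu ^+ 2).

(** An exact identity for finite increments: the remainder of [rotG] as a function of w is a fixed
    real-linear image of the remainder of [g], so estimates pass both ways. *)
Lemma rot_residual g z z' : rot_det != 0 ->
  let rho := g z' - g z - rc mu * (z' - z) - nu * cconj (z' - z) in
  rotG t g z' - rotG t g z - rot_al * (rotw t g z' - rotw t g z)
    - rc rot_be * cconj (rotw t g z' - rotw t g z) =
  rc rot_det^-1 * (rc rot_m * cconj rho - rc s * cconj nu * rho).
Proof.
move=> d0 /=; set rho := g z' - _ - _ - _.
have gE : g z' = g z + rc mu * (z' - z) + nu * cconj (z' - z) + rho by rewrite /rho; ring.
have zE : z' = z + (z' - z) by ring.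
move: rho gE => rho; rewrite /rotG /rotw /rot_al => ->.
move: (z' - z) zE => h ->.
have cs : rc c * rc c + rc s * rc s - 1 = 0.
  by rewrite -!rcM -rcD -!expr2 cos2Dsin2 rc1 subrr.
have mE : rc rot_m = rc c + rc s * rc mu by rewrite rcD rcM.
have dE : rc rot_det = rc rot_m * rc rot_m - rc s * rc s * (nu * cconj nu).
  by rewrite mul_cconj; apply: cplx_eq; rewrite !cE /rot_det; ring.
have bE : rc rot_be = rc rot_det^-1 * (rc rot_m * (rc c * rc mu - rc s) - rc s * rc c * (nu * cconj nu)).
  by rewrite mul_cconj; apply: cplx_eq; rewrite !cE /rot_be; ring.
have iE : rc rot_det^-1 * rc rot_det = 1 by rewrite -rcM mulVf// rc1.
rewrite bE; set i := rc rot_det^-1 in iE *.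
rewrite !(cconjD, cconjM, cconjN, rcJ, cconjK) -/c -/s.
set nb := cconj nu in dE *; set hb := cconj h; set rb := cconj rho; set zb := cconj z; set gb := cconj (g z).
rewrite -[X in X - _ - _]mul1r -iE dE mE.
set C := rc c in cs *; set S := rc s in cs *; set m := rc mu; set G := g z.
apply/eqP; rewrite -subr_eq0; apply/eqP.
(* The two sides differ by a multiple of cos^2 + sin^2 - 1. *)
transitivity (i * (C * C + S * S - 1) * (nb * (C + S * m) * h + nu * nb * S * hb + (C + S * m) * rb)); first by ring.
by rewrite cs mulr0 mul0r.
Qed.

End Point.
End Rotation.

Section Plane.
Context {R : realType}.

Lemma cconj0 : cconj 0 = 0 :> R[i].
Proof. by apply: cplx_eq; rewrite cconjE ?oppr0. Qed.

Definition toC (p : R * R) : R[i] := mkC p.1 p.2.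
Definition ofC (z : R[i]) : R * R := (cre z, cim z).

Lemma toCK p : ofC (toC p) = p. Proof. by case: p. Qed.
Lemma ofCK z : toC (ofC z) = z. Proof. exact: mkC_eta. Qed.

Lemma ball_toC (p p' : R * R) (e : R) : ball p e p' -> cabs (toC p - toC p') <= 2 * e.
Proof. by rewrite ball_pairE => -[/= h1 h2]; apply: cabs_insq; exact: ltW. Qed.

Lemma cabs_ball (z z' : R[i]) (e : R) : cabs (z - z') < e -> ball (ofC z) e (ofC z').
Proof.
move=> h; rewrite ball_pairE; split; rewrite /ball /=.
  by apply: le_lt_trans h; rewrite -creN -creD; exact: cre_le.
by apply: le_lt_trans h; rewrite -cimN -cimD; exact: cim_le.
Qed.

Lemma open_disc (z0 : R[i]) (r : R) : open [set p : R * R | cabs (toC p - z0) < r].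
Proof.
rewrite openE => p /= pr; apply/nbhs_ballP.
have h0 : 0 < (r - cabs (toC p - z0)) / 4 by rewrite divr_gt0// subr_gt0.
exists ((r - cabs (toC p - z0)) / 4) => //= q /ball_toC; rewrite cabsC => h.
have E : toC q - z0 = (toC q - toC p) + (toC p - z0) by ring.
have := cabsD (toC q - toC p) (toC p - z0); rewrite -E /=; lra.
Qed.

Lemma toC_continuous (p : R * R) (f : R[i] -> R) (L d : R) : 0 < L -> 0 < d ->
  (forall z, cabs (z - toC p) < d -> `|f (toC p) - f z| <= L * cabs (z - toC p)) ->
  {for p, continuous (f \o toC)}.
Proof.
move=> L0 d0 fL; apply/cvgrPdist_lt => e e0; near_simpl; apply/(@nbhs_ballP _ (R * R)%type).
pose r := Num.min (d / 4) (e / (4 * L)).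
have r0 : 0 < r by rewrite lt_min !divr_gt0// mulr_gt0.
exists r => //= q /ball_toC; rewrite cabsC => h.
have r1 : r <= d / 4 by rewrite /r ge_min lexx.
have r2 : r * (4 * L) <= e.
  by rewrite -ler_pdivlMr ?mulr_gt0// /r ge_min lexx orbT.
have h' : cabs (toC q - toC p) < d by lra.
apply: le_lt_trans (fL _ h') _.
have := ler_wpM2l (ltW L0) h; lra.
Qed.

End Plane.

Section CDiff2.
Context {R : realType}.
Implicit Types (g : R[i] -> R[i]) (z al be : R[i]).

(** In the direction u the derivative is al u + be conj u; the directions 1 and i give the two
    bounds. *)
Lemma cdiff2_bound g z al be (L d : R) : 0 < d ->
  (forall h, cabs h < d -> cabs (g (z + h) - g z) <= L * cabs h) ->
  cdiff2 g z al be -> cabs (al + be) <= L /\ cabs (al - be) <= L.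
Proof.
move=> d0 gL dg.
have key (u : R[i]) : cabs u = 1 -> cabs (al * u + be * cconj u) <= L.
  move=> u1; apply/ler_addgt0Pr => e e0.
  have [d1 d10 P] := dg e e0.
  pose t := Num.min d d1 / 2.
  have t0 : 0 < t by rewrite divr_gt0// lt_min d0.
  have [td td1] : t < d /\ t < d1.
    have m0 : 0 < Num.min d d1 by rewrite lt_min d0.
    have : t < Num.min d d1 by rewrite /t; lra.
    by rewrite lt_min => /andP[].
  have hh : cabs (rc t * u) = t by rewrite cabsM cabs_rc gtr0_norm// u1 mulr1.
  have := P (rc t * u); have := gL (rc t * u); rewrite hh => /(_ td) h1 /(_ td1) h2.
  have : cabs (rc t * (al * u + be * cconj u)) <= (L + e) * t.
    have -> : rc t * (al * u + be * cconj u) = (g (z + rc t * u) - g z) -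
       (g (z + rc t * u) - g z - al * (rc t * u) - be * cconj (rc t * u)).
      by rewrite cconjM rcJ; ring.
    apply: le_trans (cabsB _ _) _; lra.
  by rewrite cabsM cabs_rc gtr0_norm// mulrC ler_pM2r.
split.
  by have := key 1 cabs1; rewrite (_ : cconj 1 = 1) ?mulr1//; apply: cplx_eq; rewrite cconjE !cE ?oppr0.
have i1 : cabs (mkC 0 1 : R[i]) = 1 by rewrite cabs_imag normr1.
have := key _ i1; have -> : al * mkC 0 1 + be * cconj (mkC 0 1) = (al - be) * mkC 0 1.
  by apply: cplx_eq; rewrite !(cE, cconjE); ring.
by rewrite cabsM i1 mulr1.
Qed.

Lemma cdiff2_hess_bound g z (mu : R) nu (L d : R) : 0 < d ->
  (forall h, cabs h < d -> cabs (g (z + h) - g z) <= L * cabs h) ->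
  cdiff2 g z (rc mu) nu -> `|mu| <= L /\ cabs nu <= L.
Proof.
move=> d0 gL dg; have [h1 h2] := cdiff2_bound d0 gL dg.
have e2 (v : R[i]) : cabs (v + v) = 2 * cabs v.
  have -> : v + v = rc 2 * v by apply: cplx_eq; rewrite !cE; ring.
  by rewrite cabsM cabs_rc ger0_norm.
split.
  have := cabsD (rc mu + nu) (rc mu - nu); rewrite addrACA subrr addr0 e2 cabs_rc; lra.
have := cabsB (rc mu + nu) (rc mu - nu); rewrite opprB addrC addrA subrK e2; lra.
Qed.

End CDiff2.

(** * Inversion of the rotation map and the expansion at a good point *)

Section Local.
Context {R : realType}.
Variables (g : R[i] -> R[i]) (ph : R[i] -> R) (Nn : set (R * R)) (Lam al T : R).
Variables (z0 nu0 : R[i]) (mu0 rho0 : R).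
Hypothesis Lam0 : 0 < Lam.
Hypothesis T0 : 0 <= T.
Hypothesis al0 : 0 < al.
Hypothesis al1 : al < 1.
Hypothesis rho00 : 0 < rho0.
(** Bounds the eigenvalues mu + |nu| and mu - |nu|, since |mu| and |nu| are each at most [Lam]. *)
Let N := 2 * Lam.
Let D0 z := cabs (z - z0) < rho0.
Hypothesis D0r : forall z, D0 z -> cabs z < 1.
Hypothesis Nn0 : (leb2 R).-negligible (Nn : set (mplane R)).
Hypothesis glip : forall z z', D0 z -> D0 z' -> cabs (g z - g z') <= Lam * cabs (z - z').
Hypothesis gae : forall z, D0 z -> Nn (ofC z) \/ exists mu nu,
  cdiff2 g z (rc mu) nu /\ atan (mu + cabs nu) + atan (mu - cabs nu) = ph z.
Hypothesis g0 : cdiff2 g z0 (rc mu0) nu0.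
Hypothesis g0ph : atan (mu0 + cabs nu0) + atan (mu0 - cabs nu0) = ph z0.
Hypothesis phT : forall z, D0 z -> `|ph z - ph z0| <= T * cabs (z - z0) `^ al.
Hypothesis rhoT : T * rho0 `^ al <= 2 * half_gap N.

Let t := ph z0 / 2.
Let c := cos t.
Let s := sin t.
Let del := ellip N.
Let w := rotw t g.
Let Lw := 1 + Lam.

Let N0 : 0 <= N. Proof. by rewrite /N; have := Lam0; lra. Qed.
Let del0 : 0 < del. Proof. exact: ellip_gt0. Qed.
Let del1 : del <= 1. Proof. exact: cos_le1. Qed.

Let D0_open z : D0 z -> exists2 d, 0 < d & forall h, cabs h < d -> D0 (z + h).
Proof.
move=> Dz; exists (rho0 - cabs (z - z0)); first by rewrite subr_gt0.
move=> h hh; rewrite /D0; have := cabsD (z - z0) h; rewrite addrAC; lra.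
Qed.

Let hess_bound z mu nu : D0 z -> cdiff2 g z (rc mu) nu -> `|mu| <= Lam /\ cabs nu <= Lam.
Proof.
move=> Dz; have [d d0 dP] := D0_open Dz; apply: (cdiff2_hess_bound d0) => h /dP Dh.
by have := glip Dh Dz; rewrite addrAC subrr add0r.
Qed.

Let z0D : D0 z0. Proof. by rewrite /D0 subrr cabs0. Qed.

Let phgap z : D0 z -> `|ph z - ph z0| <= 2 * half_gap N.
Proof.
move=> Dz; apply: le_trans (phT Dz) _; apply: le_trans rhoT.
apply: ler_wpM2l => //; apply: (@ge0_ler_powR R al (ltW al0)); rewrite ?nnegrE ?cabs_ge0 ?(ltW rho00)//.
exact: ltW.
Qed.

Let eig_le z mu nu : D0 z -> cdiff2 g z (rc mu) nu ->
  `|mu + cabs nu| <= N /\ `|mu - cabs nu| <= N.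
Proof.
move=> Dz dg; have [h1 h2] := hess_bound Dz dg; have h3 := cabs_ge0 nu.
by move: h1; rewrite !ler_norml /N => /andP[? ?]; split; apply/andP; split; lra.
Qed.

(** The right side is the smaller singular value of dw; the sign of s decides which eigenvalue
    produces it, so both are estimated. *)
Let ell z mu nu : D0 z -> cdiff2 g z (rc mu) nu ->
  atan (mu + cabs nu) + atan (mu - cabs nu) = ph z ->
  del <= rot_m t mu - `|s| * cabs nu.
Proof.
move=> Dz dg sum; have [l1 l2] := eig_le Dz dg; have gap := phgap Dz.
have e1 := rot_eigen_ge N0 l1 l2 sum gap.
have e2 := rot_eigen_ge N0 l2 l1 (etrans (addrC _ _) sum) gap.
rewrite /rot_m -/c -/s; move: e1 e2; rewrite -/t -/c -/s -/del.
by have [s0|s0] := leP 0 s; [rewrite ger0_norm//|rewrite ltr0_norm//]; lra.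
Qed.

Let ell_m z mu nu : D0 z -> cdiff2 g z (rc mu) nu -> `|rot_m t mu| <= Lw /\ `|s| * cabs nu <= Lam.
Proof.
move=> Dz dg; have [h1 h2] := hess_bound Dz dg.
have s1 : `|s| <= 1 by rewrite ler_norml sin_geN1 sin_le1.
have c1 : `|c| <= 1 by rewrite ler_norml cos_geN1 cos_le1.
split; last by rewrite -[Lam]mul1r; apply: ler_pM; rewrite ?cabs_ge0.
rewrite /rot_m -/c -/s; apply: le_trans (ler_normD _ _) _; rewrite /Lw lerD// normrM -[Lam]mul1r.
exact: ler_pM.
Qed.

Let wlip z z' : D0 z -> D0 z' -> cabs (w z - w z') <= Lw * cabs (z - z').
Proof.
move=> Dz Dz'; have -> : w z - w z' = rc c * (z - z') + rc s * (g z - g z').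
  by rewrite /w /rotw -/c -/s; ring.
apply: le_trans (cabsD _ _) _; rewrite /Lw mulrDl; apply: lerD; rewrite cabsM cabs_rc.
  by apply: ler_wpM2r; rewrite ?cabs_ge0// ler_norml cos_geN1 cos_le1.
apply: le_trans (glip Dz Dz'); apply: ler_piMl; rewrite ?cabs_ge0//.
by rewrite ler_norml sin_geN1 sin_le1.
Qed.

Let wcdiff z mu nu : cdiff2 g z (rc mu) nu -> cdiff2 w z (rc (rot_m t mu)) (rc s * nu).
Proof.
move=> dg e e0; have [d d0 dP] := dg e e0; exists d => // h /dP hh.
have -> : w (z + h) - w z - rc (rot_m t mu) * h - rc s * nu * cconj h =
  rc s * (g (z + h) - g z - rc mu * h - nu * cconj h).
  by rewrite /w /rotw /rot_m -/c -/s rcD rcM; ring.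
rewrite cabsM cabs_rc; apply: le_trans hh; apply: ler_piMl; rewrite ?cabs_ge0//.
by rewrite ler_norml sin_geN1 sin_le1.
Qed.

Section Monotone.
Variables (z e : R[i]) (ta : R).
Hypothesis e0 : e != 0.
Hypothesis ta0 : 0 < ta.
Hypothesis ta1 : ta <= 1.
Let str (om : R[i]) := mkC (cre om) (ta * cim om).
Let X om := z + e * str om.
Hypothesis XD : forall x y, 0 <= x <= 1 -> 0 <= y <= 1 -> D0 (X (mkC x y)).
Let A := del * cabs e ^+ 2.
(** Being real, f contributes to [coint] only along the two vertical sides, and Re(dbar f) is half
    its x-derivative. The x-direction runs from z to z + e, and the transversal one is compressed by
    [ta]. *)
Let f om := rc (A * cre om) - rc (cre (cconj e * (w (X om) - w z))).

Let str_le om : cabs (str om) <= 2 * cabs om.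
Proof.
apply: le_trans (cabs_le _) _; rewrite !cE normrM (gtr0_norm ta0).
have := cre_le om; have := cim_le om; have : ta * `|cim om| <= `|cim om| by rewrite ler_piMl.
lra.
Qed.

Let e_gt0 : 0 < cabs e. Proof. by rewrite cabs_gt0. Qed.

Let X_step om k : X (om + k) = X om + e * str k.
Proof. by apply: cplx_eq; rewrite /X /str !cE; ring. Qed.

Let X_lip om om' : cabs (X om - X om') <= 2 * cabs e * cabs (om - om').
Proof.
have -> : X om - X om' = e * str (om - om').
  by apply: cplx_eq; rewrite /X /str !cE; ring.
by rewrite cabsM mulrAC [leRHS]mulrAC [2 * _]mulrC -mulrA ler_pM2l.
Qed.

Let f_loclip om : D0 (X om) -> loclip f om.
Proof.
move=> DX; have [d d0 dP] := D0_open DX.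
have Lw0 : 0 < Lw by rewrite /Lw; have := Lam0; lra.
have A0 : 0 <= A by rewrite mulr_ge0 ?sqr_ge0// ltW.
have X0 : 0 < 2 * cabs e by rewrite mulr_gt0.
exists (A + cabs e * (Lw * (2 * cabs e)) + 1), (d / (2 * cabs e)); split.
- by rewrite ltr_wpDl// addr_ge0// mulr_ge0 ?cabs_ge0// mulr_ge0 ?ltW.
- by rewrite divr_gt0.
have near q : cabs (q - om) < d / (2 * cabs e) -> D0 (X q).
  move=> h; have -> : X q = X om + (X q - X om) by ring.
  by apply: dP; apply: le_lt_trans (X_lip _ _) _; rewrite mulrC -ltr_pdivlMr.
move=> q q' /near Dq /near Dq'.
have -> : f q - f q' = rc (A * cre (q - q') - cre (cconj e * (w (X q) - w (X q')))).
  have -> : cconj e * (w (X q) - w (X q')) = cconj e * (w (X q) - w z) - cconj e * (w (X q') - w z) by ring.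
  rewrite (creD _ (- (cconj e * _))) (creN (cconj e * _)) (creD q) creN /f.
  by rewrite !(rcD, rcN, rcM); ring.
have i1 : `|A * cre (q - q')| <= A * cabs (q - q').
  by rewrite normrM (ger0_norm A0); apply: ler_wpM2l => //; exact: cre_le.
have i2 : `|cre (cconj e * (w (X q) - w (X q')))| <= cabs e * (Lw * (2 * cabs e)) * cabs (q - q').
  apply: le_trans (cre_le _) _; rewrite cabsM cabsJ -mulrA; apply: ler_wpM2l; first exact: cabs_ge0.
  apply: le_trans (wlip Dq Dq') _; rewrite -mulrA; apply: ler_wpM2l (X_lip _ _); exact: ltW.
rewrite cabs_rc; apply: le_trans (ler_normB _ _) _.
have := cabs_ge0 (q - q'); lra.
Qed.

(** The x-derivative is A - Re(conj e dw(e)), and [ell] gives Re(conj e dw(e)) >= del |e|^2 = A. *)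
Let f_cdiff om mu nu : D0 (X om) -> cdiff2 g (X om) (rc mu) nu ->
  atan (mu + cabs nu) + atan (mu - cabs nu) = ph (X om) ->
  exists2 be, cdiff f om be & cre be <= 0.
Proof.
move=> DX dg sum; have el := ell DX dg sum; have dw := wcdiff dg.
move: dw el; set m := rot_m t mu; set n := rc s * nu => dw el.
pose l1 := A - cre (cconj e * (rc m * e + n * cconj e)).
pose l2 := - cre (cconj e * (rc m * (e * mkC 0 ta) + n * cconj (e * mkC 0 ta))).
exists (mkC (l1 / 2) (l2 / 2)); last first.
  rewrite cre_mk pmulr_lle0 ?invr_gt0// /l1 subr_le0.
  have -> : cconj e * (rc m * e + n * cconj e) = rc m * (e * cconj e) + n * (cconj e * cconj e) by ring.
  rewrite creD mul_cconj -rcM /A.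
  have := cre_ge_abs (n * (cconj e * cconj e)).
  rewrite !cabsM cabs_rc !cabsJ.
  have := ler_wpM2r (sqr_ge0 (cabs e)) el; rewrite [cre (rc _)]/= -expr2; lra.
exists (cconj (mkC (l1 / 2) (l2 / 2))) => ep ep0.
have k0 : 0 < ep / (2 * cabs e ^+ 2) by rewrite divr_gt0// mulr_gt0// exprn_gt0.
have [d d0 dP] := dw _ k0.
exists (d / (2 * cabs e)); first by rewrite divr_gt0// mulr_gt0.
move=> k kd; set eta := e * str k.
have eta1 : cabs eta <= 2 * cabs e * cabs k.
  by rewrite cabsM mulrAC [leRHS]mulrAC [2 * _]mulrC -mulrA ler_pM2l// str_le.
have etad : cabs eta < d.
  by apply: le_lt_trans eta1 _; rewrite mulrC -ltr_pdivlMr ?mulr_gt0.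
have hw := dP eta etad.
set r := w (X om + eta) - w (X om) - rc m * eta - n * cconj eta in hw.
have etaE : eta = rc (cre k) * e + rc (cim k) * (e * mkC 0 ta).
  by apply: cplx_eq; rewrite /eta /str !cE; ring.
have -> : f (om + k) - f om - cconj (mkC (l1 / 2) (l2 / 2)) * k - mkC (l1 / 2) (l2 / 2) * cconj k
   = rc (- cre (cconj e * r)).
  have wE : cre (cconj e * (w (X om + eta) - w z)) = cre (cconj e * (w (X om) - w z)) +
      (cre k * (A - l1) - cim k * l2) + cre (cconj e * r).
    rewrite /l1 /l2 subKr mulrN opprK.
    have cM (x : R) (v : R[i]) : x * cre v = cre (rc x * v) by rewrite creM !cE mul0r subr0.
    rewrite !cM -!creD; congr cre; rewrite /r etaE !(cconjD, cconjM, rcJ); ring.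
  rewrite /f X_step -/eta wE; move: (cre (cconj e * (w (X om) - w z))) (cre (cconj e * r)) => u v.
  by apply: cplx_eq; rewrite !(cE, cconjE); field.
rewrite cabs_rc normrN; apply: le_trans (cre_le _) _; rewrite cabsM cabsJ.
apply: (@le_trans _ _ (cabs e * (ep / (2 * cabs e ^+ 2) * (2 * cabs e * cabs k)))).
  apply: ler_wpM2l; first exact: cabs_ge0.
  by apply: le_trans hw _; rewrite ler_pM2l.
rewrite le_eqVlt; apply/orP; left; apply/eqP; field; exact: lt0r_neq0.
Qed.

Let f_null : cousin_null 0 0 1 (fun x y => Nn (ofC (X (mkC x y)))).
Proof.
have M0 : 0 < 2 / (cabs e * ta) by rewrite divr_gt0// mulr_gt0.
pose W (p : R * R) : R * R := (cre ((toC p - z) / e), cim ((toC p - z) / e) / ta).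
have tai : 1 <= ta^-1 by rewrite invf_ge1.
apply: (@cousin_null_image R Nn [set p | D0 (toC p)] 1 W (fun x y => ofC (X (mkC x y))) 0 0 1 (2 / (cabs e * ta))) => //.
- exact: open_disc.
- move=> p /D0r h; have := @cabs_ball R 0 (toC p) 1; rewrite sub0r cabsN toCK; exact.
- move=> p p' ep _ _ /ball_toC h.
  have hC : cabs ((toC p - z) / e - (toC p' - z) / e) <= 2 * ep / cabs e.
    have -> : (toC p - z) / e - (toC p' - z) / e = (toC p - toC p') / e by ring.
    by rewrite cabsM cabsV ler_wpM2r// invr_ge0 ltW.
  have ep0 : 0 <= ep by have := cabs_ge0 (toC p - toC p'); lra.
  have E : 2 / (cabs e * ta) * ep = 2 * ep / cabs e * ta^-1 by field; rewrite !lt0r_neq0.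
  have h0 : 0 <= 2 * ep / cabs e by apply: le_trans hC; exact: cabs_ge0.
  rewrite /W /= E; split.
    rewrite -creN -creD; apply: le_trans (cre_le _) _; apply: le_trans hC _.
    by rewrite ler_peMr.
  rewrite -mulrBl -cimN -cimD normrM [X in _ * X]ger0_norm ?invr_ge0 ?(ltW ta0)//.
  apply: ler_wpM2r; first by rewrite invr_ge0 ltW.
  by apply: le_trans (cim_le _) hC.
- move=> x y; rewrite add0r => xP yP; split; first by rewrite /= ofCK; exact: XD.
  rewrite /W ofCK /X addrC addKr mulrC mulKf// /str !cE mulrC mulKf// lt0r_neq0//.
- move=> x y _ _ ep ep0; exists (ep / (4 * cabs e)); first by rewrite divr_gt0// mulr_gt0.
  move=> x' y' _ _ hx hy; apply: cabs_ball; apply: le_lt_trans (X_lip _ _) _.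
  have : cabs (mkC x y - mkC x' y') < ep / (2 * cabs e).
    apply: le_lt_trans (cabs_le _) _; rewrite !cE.
    have -> : ep / (2 * cabs e) = ep / (4 * cabs e) + ep / (4 * cabs e) by field; rewrite lt0r_neq0.
    exact: ltrD.
  by move=> hlt; rewrite mulrC -ltr_pdivlMr ?mulr_gt0.
Qed.

(** On the segment itself [g] may be differentiable nowhere, so it is thickened to a strip.
    Averaging across the strip costs the oscillation of the Lipschitz map w over its width, hence an
    error linear in [ta]. *)
Lemma monotone_strip : A - cre (cconj e * (w (z + e) - w z)) <= 8 * Lw * ta * cabs e ^+ 2.
Proof.
have XDf x y : 0 <= x <= 0 + 1 -> 0 <= y <= 0 + 1 -> D0 (X (mkC x y)) by rewrite add0r; exact: XD.
have edge a b h : subsquare 0 0 1 a b h -> edge_cont f a b h.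
  move=> [h1 h2 h3 h4] x y xP yP _; apply: loclip_cont; apply: f_loclip; apply: XDf; lra.
have key : coint f 0 0 1 <= 0.
  apply: (@stokes_singular R f (subsquare 0 0 1) _ (@subsquare_closed R 0 0 1) edge [::] _ 0 0 1 ltr01 (subsquare_refl _ _ _) f_null) => //.
  move=> x y xP yP _; have DX := XDf _ _ xP yP; split; first exact: f_loclip.
  have [|[mu [nu [dg sum]]]] := gae DX; first by left.
  by right; exact: f_cdiff dg sum.
pose b := 2 * Lw * ta * cabs e ^+ 2.
pose k := A - cre (cconj e * (w (z + e) - w z)).
have := @coint_ge4 R f 0 0 1 b k ler01 (edge _ _ _ (subsquare_refl _ _ _)).
have fE x y : f (mkC x y) = rc (A * x - cre (cconj e * (w (X (mkC x y)) - w z))).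
  by rewrite /f rcD rcN.
have Lw0 : 0 < Lw by rewrite /Lw; have := Lam0; lra.
have b0 : 0 <= b by rewrite !mulr_ge0 ?sqr_ge0// ltW.
have D00 : D0 z.
  have := XD (x := 0) (y := 0) _ _; rewrite lexx ler01 => /(_ isT isT).
  by rewrite /X (_ : str (mkC 0 0) = 0) ?mulr0 ?addr0//; apply: cplx_eq; rewrite /str !cE ?mulr0.
have D01 : D0 (z + e).
  have := XD (x := 1) (y := 0) _ _; rewrite !lexx ler01 => /(_ isT isT).
  by rewrite /X (_ : str (mkC 1 0) = 1) ?mulr1//; apply: cplx_eq; rewrite /str !cE ?mulr0.
have wb (u v : R[i]) : D0 u -> D0 v -> cabs (u - v) <= 2 * (ta * cabs e) ->
    `|cre (cconj e * (w u - w v))| <= b.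
  move=> Du Dv h; apply: le_trans (cre_le _) _; rewrite cabsM cabsJ.
  have -> : b = cabs e * (Lw * (2 * (ta * cabs e))) by rewrite /b; ring.
  rewrite ler_wpM2l ?cabs_ge0//; apply: le_trans (wlip Du Dv) _.
  by rewrite ler_pM2l.
have sh x y : 0 <= y <= 1 -> cabs (X (mkC x y) - (z + e * rc x)) <= 2 * (ta * cabs e).
  move=> /andP[y0 y1]; have -> : X (mkC x y) - (z + e * rc x) = e * mkC 0 (ta * y).
    by apply: cplx_eq; rewrite /X /str !cE; ring.
  rewrite cabsM cabs_imag ger0_norm ?mulr_ge0 ?(ltW ta0)//.
  have : ta * y * cabs e <= ta * cabs e by rewrite ler_pM2r// ler_piMr// ltW.
  by have := mulr_ge0 (ltW ta0) (cabs_ge0 e); lra.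
move=> /(_ _ _)/le_trans/(_ key) h.
have : (k - 4 * b) * 1 <= 0.
  apply: h => [x xP|y yP]; rewrite !fE /rc ?cre_mk ?cim_mk ?oppr_le0 ?b0//.
  have y1 : 0 <= y <= 1 by move: yP; rewrite add0r.
  split.
    rewrite add0r mulr1 /k; have := sh (0 + 1) y y1; rewrite add0r rc1 mulr1 => h1.
    have DX1 : D0 (X (mkC 1 y)) by apply: XD => //; rewrite lexx ler01.
    have := wb _ _ DX1 D01 h1; rewrite ler_norml => /andP[_].
    have E : cre (cconj e * (w (X (mkC 1 y)) - w z)) =
        cre (cconj e * (w (X (mkC 1 y)) - w (z + e))) + cre (cconj e * (w (z + e) - w z)).
      by rewrite -creD; congr cre; ring.
    lra.
  have := sh 0 y y1; rewrite (_ : rc 0 = 0)// mulr0 addr0 => h1.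
  have DX0 : D0 (X (mkC 0 y)) by apply: XD => //; rewrite lexx ler01.
  have := wb _ _ DX0 D00 h1; rewrite ler_norml mulr0 sub0r => /andP[h2 _]; lra.
by rewrite mulr1 /k /b; lra.
Qed.

End Monotone.

(** The width of the strip tends to 0; [ta] is also taken small enough for the strip to stay in the
    disc. *)
Let monotone z z' : D0 z -> D0 z' ->
  del * cabs (z' - z) ^+ 2 <= cre (cconj (z' - z) * (w z' - w z)).
Proof.
move=> Dz Dz'; have [<-|zz] := eqVneq z' z.
  by rewrite !subrr cabs0 expr0n !mulr0 cre0.
set e := z' - z; have e0 : e != 0 by rewrite subr_eq0.
have eg : 0 < cabs e by rewrite cabs_gt0.
have Lw0 : 0 < Lw by rewrite /Lw; have := Lam0; lra.
pose k := del * cabs e ^+ 2 - cre (cconj e * (w z' - w z)).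
rewrite -subr_le0 -/k; apply/ler_addgt0Pl => ep ep0; rewrite addr0.
pose q := Num.max (cabs (z - z0)) (cabs (z' - z0)).
have qr : q < rho0 by rewrite gt_max; apply/andP.
pose ta := Num.min 1 (Num.min ((rho0 - q) / (2 * cabs e)) (ep / (8 * Lw * cabs e ^+ 2))).
have d8 : 0 < 8 * Lw * cabs e ^+ 2 by rewrite !mulr_gt0// exprn_gt0.
have ta0 : 0 < ta by rewrite !lt_min ltr01 !divr_gt0// ?subr_gt0// mulr_gt0.
have ta1 : ta <= 1 by rewrite /ta ge_min lexx.
have taq : ta * (2 * cabs e) <= rho0 - q.
  by rewrite -ler_pdivlMr ?mulr_gt0// /ta !ge_min lexx !orbT.
have tae : ta * (8 * Lw * cabs e ^+ 2) <= ep.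
  by rewrite -ler_pdivlMr// /ta !ge_min lexx !orbT.
have [q1 q2] : cabs (z - z0) <= q /\ cabs (z' - z0) <= q by rewrite /q !le_max !lexx orbT.
have XD x y : 0 <= x <= 1 -> 0 <= y <= 1 -> D0 (z + e * mkC (cre (mkC x y)) (ta * cim (mkC x y))).
  move=> /andP[x0 x1] /andP[y0 y1]; rewrite /D0 !cE.
  have -> : z + e * mkC x (ta * y) - z0 = rc (1 - x) * (z - z0) + rc x * (z' - z0) + e * mkC 0 (ta * y).
    by rewrite /e; apply: cplx_eq; rewrite !cE; ring.
  apply: le_lt_trans (cabsD _ _) _.
  have h1 : cabs (rc (1 - x) * (z - z0) + rc x * (z' - z0)) <= q.
    apply: le_trans (cabsD _ _) _; rewrite !cabsM !cabs_rc !ger0_norm ?subr_ge0//.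
    have x1' : 0 <= 1 - x by lra.
    have := ler_wpM2l x1' q1; have := ler_wpM2l x0 q2; lra.
  have h2 : cabs (e * mkC 0 (ta * y)) <= ta * cabs e.
    rewrite cabsM cabs_imag ger0_norm ?mulr_ge0 ?(ltW ta0)// mulrC.
    by rewrite ler_pM2r// ler_piMr// ltW.
  have := mulr_gt0 ta0 eg; lra.
have := monotone_strip e0 ta0 ta1 XD.
have -> : z + e = z' by rewrite /e addrC subrK.
rewrite -/k; lra.
Qed.

Let Lw0 : 0 < Lw. Proof. by rewrite /Lw; have := Lam0; lra. Qed.

Let w_expand z z' : D0 z -> D0 z' -> del * cabs (z' - z) <= cabs (w z' - w z).
Proof.
move=> Dz Dz'; have [->|zz] := eqVneq z' z; first by rewrite subrr cabs0 mulr0 cabs_ge0.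
have eg : 0 < cabs (z' - z) by rewrite cabs_gt0 subr_eq0.
rewrite -(ler_pM2r eg) -mulrA -expr2; apply: le_trans (monotone Dz Dz') _.
by apply: le_trans (cre_le_abs _) _; rewrite cabsM cabsJ mulrC.
Qed.

(** Radius of a disc covered by w. The minimum point used in [surj] is interior to its box of
    half-side rho0 / 2 because 2 R0 = del rho0 / 2. *)
Let R0 := del * rho0 / 4.

(* A minimum point of |w - v| over a box must be a zero, as moving towards v decreases the distance. *)
Let surj v : cabs (v - w z0) < R0 -> exists z, D0 z /\ w z = v.
Proof.
move=> vR; pose r1 := rho0 / 2; have r10 : 0 < r1 by rewrite divr_gt0.
pose K : set (R * R) := `[cre z0 - r1, cre z0 + r1] `*` `[cim z0 - r1, cim z0 + r1].
have cK : compact K by apply: compact_setX; exact: segment_compact.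
have KE p : K p <-> `|cre (toC p - z0)| <= r1 /\ `|cim (toC p - z0)| <= r1.
  rewrite /K /= !in_itv /= !cE !ler_norml; split=> -[/andP[h1 h2] /andP[h3 h4]];
    split; apply/andP; split; lra.
have KD p : K p -> D0 (toC p).
  move=> /KE[h1 h2]; rewrite /D0 -ltr_sqr ?nnegrE ?cabs_ge0 ?(ltW rho00)// cabs_sqr.
  have sq (x : R) : `|x| <= r1 -> x ^+ 2 <= r1 ^+ 2.
    by move=> xr; rewrite -(real_normK (num_real x)) ler_sqr ?nnegrE ?(ltW r10).
  move: (sq _ h1) (sq _ h2).
  have -> : r1 ^+ 2 = rho0 ^+ 2 / 4 by rewrite /r1; field.
  have : 0 < rho0 ^+ 2 by rewrite exprn_gt0.
  lra.
pose f z := cabs (w z - v).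
have Kz0 : K (ofC z0) by apply/KE; rewrite ofCK subrr normr0 (ltW r10).
have cf : {within K, continuous (f \o toC)}.
  apply: continuous_in_subspaceT => p; rewrite inE => /KD Dp.
  have [d d0 dP] := D0_open Dp.
  apply: (toC_continuous Lw0 d0) => z zd.
  have Dz : D0 z by have := dP _ zd; rewrite addrC subrK.
  have h1 := wlip Dp Dz; rewrite (cabsC (toC p) z) in h1.
  have a1 := cabsD (w (toC p) - w z) (w z - v); rewrite addrA subrK in a1.
  have a2 := cabsD (w z - w (toC p)) (w (toC p) - v); rewrite addrA subrK (cabsC (w z) (w (toC p))) in a2.
  by rewrite /f ler_norml; apply/andP; split; lra.
have [|p pK pmin] := @compact_EVT_min (R * R)%type R (f \o toC) K _ cK cf; first by exists (ofC z0).
rewrite inE in pK; have Dp := KD _ pK; exists (toC p); split => //.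
have fz0 : f (toC p) < R0.
  apply: le_lt_trans (pmin _ (mem_set Kz0)) _; rewrite /= ofCK /f cabsC; exact: vR.
have near0 : cabs (toC p - z0) < r1.
  rewrite -(ltr_pM2l del0); apply: le_lt_trans (w_expand z0D Dp) _.
  have E : w (toC p) - w z0 = (w (toC p) - v) + (v - w z0) by ring.
  have := cabsD (w (toC p) - v) (v - w z0); rewrite -E => h.
  have rE : del * r1 = R0 + R0 by rewrite /R0 /r1; field.
  by apply: le_lt_trans h _; rewrite rE; exact: ltrD.
apply/eqP; rewrite -subr_eq0 -cabs_eq0; apply: contraT => nz.
set e := v - w (toC p); have eE : cabs e = cabs (w (toC p) - v) by rewrite cabsC.
have eg : 0 < cabs e by rewrite eE lt_neqAle eq_sym nz cabs_ge0.
(* The first entry makes the quadratic term at most del ta |e|^2, against a linear gain of 2 del ta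
   |e|^2; the second keeps the new point in the box. *)
pose ta := Num.min (del / Lw ^+ 2) ((r1 - cabs (toC p - z0)) / cabs e).
have ta0 : 0 < ta by rewrite lt_min !divr_gt0// ?exprn_gt0// subr_gt0.
have ta1 : ta * Lw ^+ 2 <= del by rewrite -ler_pdivlMr ?exprn_gt0// /ta ge_min lexx.
have ta2 : ta * cabs e <= r1 - cabs (toC p - z0).
  by rewrite -ler_pdivlMr// /ta ge_min lexx orbT.
pose q := toC p + rc ta * e.
have qe : q - toC p = rc ta * e by rewrite /q; ring.
have qabs : cabs (q - toC p) = ta * cabs e by rewrite qe cabsM cabs_rc gtr0_norm.
have Kq : K (ofC q).
  have : cabs (q - z0) <= r1.
    have -> : q - z0 = (q - toC p) + (toC p - z0) by ring.
    apply: le_trans (cabsD _ _) _; rewrite qabs; lra.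
  move=> h; apply/KE; rewrite ofCK.
  by split; [apply: le_trans (cre_le _) h|apply: le_trans (cim_le _) h].
have Dq : D0 q by have := KD _ Kq; rewrite ofCK.
have := pmin _ (mem_set Kq); rewrite /= ofCK /f -eE.
have -> : w q - v = (w q - w (toC p)) - e by rewrite /e; ring.
have m1 := monotone Dp Dq; have l1 := wlip Dq Dp.
rewrite qabs in m1 l1; rewrite qe in m1.
set De := w q - w (toC p) in m1 l1 *.
rewrite -ler_sqr ?nnegrE ?cabs_ge0//.
rewrite (cabs_sub_sqr De e).
have m2 : del * ta * cabs e ^+ 2 <= cre (cconj e * De).
  rewrite -(ler_pM2l ta0) -cre_cconj_rcM.
  by move: m1; rewrite exprMn; lra.
have l2 : cabs De ^+ 2 <= ta * (ta * Lw ^+ 2) * cabs e ^+ 2.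
  have -> : ta * (ta * Lw ^+ 2) * cabs e ^+ 2 = (Lw * (ta * cabs e)) ^+ 2 by ring.
  by rewrite ler_sqr ?nnegrE ?cabs_ge0 ?mulr_ge0 ?cabs_ge0 ?(ltW Lw0) ?(ltW ta0).
have e2 : 0 < ta * cabs e ^+ 2 by rewrite mulr_gt0// exprn_gt0.
have l3 : ta * (ta * Lw ^+ 2) * cabs e ^+ 2 <= del * (ta * cabs e ^+ 2).
  have -> : ta * (ta * Lw ^+ 2) * cabs e ^+ 2 = (ta * Lw ^+ 2) * (ta * cabs e ^+ 2) by ring.
  by rewrite ler_pM2r.
have := mulr_gt0 del0 e2; lra.
Qed.

Let det_ge z mu nu : D0 z -> cdiff2 g z (rc mu) nu ->
  atan (mu + cabs nu) + atan (mu - cabs nu) = ph z -> del ^+ 2 <= rot_det t mu nu.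
Proof.
move=> Dz dg sum; have el := ell Dz dg sum.
have -> : rot_det t mu nu = (rot_m t mu - `|s| * cabs nu) * (rot_m t mu + `|s| * cabs nu).
  by rewrite /rot_det -/s exprMn -[s ^+ 2](real_normK (num_real s)); ring.
rewrite expr2; have sn : 0 <= `|s| * cabs nu by rewrite mulr_ge0 ?cabs_ge0.
by apply: ler_pM; rewrite ?(ltW del0)//; lra.
Qed.

Let Kb := (1 + N) ^+ 2 / del ^+ 2.

(** [rot_be] is the expression of [rot_phase_le] at the eigenvalues, halved and divided by the
    Jacobian. *)
Let be_bound z mu nu : D0 z -> cdiff2 g z (rc mu) nu ->
  atan (mu + cabs nu) + atan (mu - cabs nu) = ph z ->
  `|rot_be t mu nu| <= Kb * `|ph z - ph z0|.
Proof.
move=> Dz dg sum; have d1 := det_ge Dz dg sum; have [e1 e2] := eig_le Dz dg.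
have d2 : 0 < del ^+ 2 by rewrite exprn_gt0.
have d3 : 0 < rot_det t mu nu by exact: lt_le_trans d1.
have := rot_phase_le (ph z0) N0 e1 e2 sum; rewrite /= -/t -/c -/s.
set A := (X in `|X| <= _).
have -> : rot_be t mu nu = (rot_det t mu nu)^-1 * (A / 2).
  by rewrite /rot_be /A /rot_m -/c -/s; congr (_ * _); field.
move=> hA; rewrite normrM [`|_^-1|]ger0_norm ?invr_ge0 ?(ltW d3)//.
have -> : Kb * `|ph z - ph z0| = (del ^+ 2)^-1 * ((1 + N) ^+ 2 * `|ph z - ph z0|).
  by rewrite /Kb; ring.
apply: ler_pM; rewrite ?invr_ge0 ?(ltW d3)//; first by rewrite lef_pV2.
by rewrite normrM [`|2^-1|]ger0_norm//; have := normr_ge0 A; lra.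
Qed.

(** The map sending rho to rot_m conj rho - s conj nu rho has singular values rot_m + |s nu| and
    rot_m - |s nu|, whose product is [rot_det]. The first bound carries remainders to the w-plane,
    the second brings the final estimate back. *)
Let res_le z mu nu (rho : R[i]) : D0 z -> cdiff2 g z (rc mu) nu ->
  atan (mu + cabs nu) + atan (mu - cabs nu) = ph z ->
  let res := rc (rot_det t mu nu)^-1 * (rc (rot_m t mu) * cconj rho - rc s * cconj nu * rho) in
  cabs res <= 2 * Lw / del ^+ 2 * cabs rho /\ cabs rho <= 2 * Lw * cabs res.
Proof.
move=> Dz dg sum res; have d1 := det_ge Dz dg sum; have el := ell Dz dg sum.
have [m1 n1] := ell_m Dz dg.
have d2 : 0 < del ^+ 2 by rewrite exprn_gt0.
have d3 : 0 < rot_det t mu nu by exact: lt_le_trans d1.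
have sn : 0 <= `|s| * cabs nu by rewrite mulr_ge0 ?cabs_ge0.
have m0 : 0 <= rot_m t mu by have := del0; lra.
have LwE : Lam <= Lw by rewrite /Lw; lra.
rewrite ger0_norm// in m1.
have r0 := cabs_ge0 rho.
have E1 : cabs (rc (rot_m t mu) * cconj rho) = rot_m t mu * cabs rho.
  by rewrite cabsM cabs_rc cabsJ ger0_norm.
have E2 : cabs (rc s * cconj nu * rho) = `|s| * cabs nu * cabs rho.
  by rewrite !cabsM cabs_rc cabsJ.
rewrite /res cabsM cabs_rc ger0_norm ?invr_ge0 ?(ltW d3)//; split.
  have := cabsB (rc (rot_m t mu) * cconj rho) (rc s * cconj nu * rho); rewrite E1 E2 => h.
  have -> : 2 * Lw / del ^+ 2 * cabs rho = (del ^+ 2)^-1 * (2 * Lw * cabs rho) by ring.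
  apply: ler_pM; rewrite ?invr_ge0 ?(ltW d3) ?cabs_ge0//; first by rewrite lef_pV2.
  apply: le_trans h _; have := ler_wpM2r r0 m1; have := ler_wpM2r r0 (le_trans n1 LwE); lra.
have := cabsBB (rc (rot_m t mu) * cconj rho) (rc s * cconj nu * rho); rewrite E1 E2.
set V := cabs (_ - _) => h.
have detE : rot_det t mu nu = (rot_m t mu - `|s| * cabs nu) * (rot_m t mu + `|s| * cabs nu).
  by rewrite /rot_det -/s exprMn -[s ^+ 2](real_normK (num_real s)); ring.
have k1 : 0 < rot_m t mu - `|s| * cabs nu by have := del0; lra.
have k2 : 0 < rot_m t mu + `|s| * cabs nu by lra.
have V1 : cabs rho <= (rot_m t mu + `|s| * cabs nu) * ((rot_det t mu nu)^-1 * V).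
  rewrite detE invfM -(ler_pM2l k1).
  have -> : (rot_m t mu - `|s| * cabs nu) * ((rot_m t mu + `|s| * cabs nu) *
    ((rot_m t mu - `|s| * cabs nu)^-1 * (rot_m t mu + `|s| * cabs nu)^-1 * V)) = V.
    by field; rewrite !lt0r_neq0.
  lra.
apply: le_trans V1 _; apply: ler_wpM2r; first by rewrite mulr_ge0 ?invr_ge0 ?cabs_ge0 ?(ltW d3).
lra.
Qed.

(** The rotation is tuned to the phase at z0, so the rotated Hessian is trace free there. *)
Let be0 : rot_be t mu0 nu0 = 0.
Proof.
apply/eqP; rewrite -normr_le0; apply: le_trans (be_bound z0D g0 g0ph) _.
by rewrite subrr normr0 mulr0.
Qed.

Let al_le : cabs (rot_al t mu0 nu0) <= Lam / del ^+ 2.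
Proof.
have d1 := det_ge z0D g0 g0ph; have [_ n1] := hess_bound z0D g0.
have d2 : 0 < del ^+ 2 by rewrite exprn_gt0.
rewrite /rot_al cabsM cabs_rc cabsJ mulrC ger0_norm ?invr_ge0 ?(le_trans (ltW d2))//.
apply: ler_pM => //; rewrite ?cabs_ge0 ?invr_ge0 ?(le_trans (ltW d2))//.
by rewrite lef_pV2// posrE; exact: lt_le_trans d1.
Qed.

Let G := rotG t g.
Let Glip z z' : D0 z -> D0 z' -> cabs (G z - G z') <= Lw * cabs (z - z').
Proof.
move=> Dz Dz'; have -> : G z - G z' = cconj (rc c * (g z - g z') - rc s * (z - z')).
  by rewrite /G /rotG -/c -/s; apply: cplx_eq; rewrite !(cE, cconjE); ring.
rewrite cabsJ; apply: le_trans (cabsB _ _) _; rewrite !cabsM !cabs_rc.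
have s1 : `|s| <= 1 by rewrite ler_norml sin_geN1 sin_le1.
have c1 : `|c| <= 1 by rewrite ler_norml cos_geN1 cos_le1.
have h1 := ler_pM (normr_ge0 c) (cabs_ge0 _) c1 (glip Dz Dz').
have h2 := ler_wpM2r (cabs_ge0 (z - z')) s1.
by rewrite /Lw; lra.
Qed.

(** The factor 12 makes R0 / d larger than 12, hence j >= 2. In [local_const], 288 = 2 * 144
    combines [res_le] with [pointwise_estimate]. *)
Definition local_radius := R0 / (12 * Lw).
Definition local_const := 288 * Lw * (4 * (Lw / del + Lam / del ^+ 2) * Lw ^+ 2 / R0 +
  (150 / (1 - al) + 8 / al + 16) * (Kb * T) * Lw * (Lw / del) `^ al).

Let R00 : 0 < R0. Proof. by rewrite divr_gt0// mulr_gt0. Qed.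
Let Kb0 : 0 <= Kb. Proof. by rewrite divr_ge0 ?sqr_ge0. Qed.

Lemma local_estimate z1 : cabs (z1 - z0) <= 1 -> cabs (z1 - z0) < local_radius ->
  cabs (g z1 - g z0 - rc mu0 * (z1 - z0) - nu0 * cconj (z1 - z0)) <=
  local_const * (cabs (z1 - z0) * cabs (z1 - z0) `^ al).
Proof.
move=> hz1 hzr.
set hh := cabs (z1 - z0) in hz1 hzr *.
have hR : Lw * hh < R0 / 12.
  move: hzr; rewrite /local_radius -(ltr_pM2l Lw0); congr (_ < _).
  by field; rewrite lt0r_neq0.
have Lw1 : 1 <= Lw by rewrite /Lw; have := Lam0; lra.
have D1 : D0 z1.
  rewrite /D0 -/hh; have : hh <= Lw * hh by rewrite ler_peMl// cabs_ge0.
  have : R0 / 12 <= rho0.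
    have : del * rho0 <= rho0 by rewrite ler_piMl// ltW.
    rewrite /R0; have := rho00; lra.
  lra.
have [z10|z10] := eqVneq z1 z0.
  by rewrite /hh z10 !subrr cconj0 !mulr0 !subr0 cabs0 mul0r mulr0.
have hh0 : 0 < hh by rewrite cabs_gt0 subr_eq0.
pose w1 := w z1 - w z0; pose d := cabs w1.
have dle : d <= Lw * hh by exact: wlip.
have d0 : 0 < d.
  apply: lt_le_trans (w_expand z0D D1); exact: mulr_gt0.
have w10 : w1 != 0 by rewrite -cabs_gt0.
have d20 : 0 < del ^+ 2 by rewrite exprn_gt0.
(* n is the scale R0 / d up to a constant; the singular points need n = 3 j + 1. *)
pose x := R0 / d.
have x12 : 12 < x by rewrite /x ltr_pdivlMr//; lra.
pose j := Num.trunc (x / 6).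
have /andP[j1 j2] : j%:R <= x / 6 < j.+1%:R by apply: truncn_itv; lra.
have j2' : (2 <= j)%N.
  rewrite leqNgt; apply/negP => jlt.
  have : j.+1%:R <= 2 :> R by rewrite ler_nat.
  lra.
pose n := (3 * j + 1)%N; have nE : n%:R = 3 * j%:R + 1 :> R by rewrite /n natrD natrM.
have nlo : x / 4 <= n%:R.
  have j3 : x / 6 < j%:R + 1 by rewrite natr1.
  by rewrite nE; lra.
have nhi : n%:R <= x by rewrite nE; lra.
have n0 : 0 < n%:R :> R by rewrite nE; have := ler0n R j; lra.
have nd : n%:R * d <= R0 by rewrite -ler_pdivlMr.
have /choice [inv invP] : forall v, exists z, cabs (v - w z0) < R0 -> D0 z /\ w z = v.
  move=> v; have [vR|vR] := pselect (cabs (v - w z0) < R0); last by exists 0.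
  by have [z zP] := surj vR; exists z.
(* The inverse of w in the coordinate where z0 becomes 0 and z1 becomes 1; it is meaningful for |om|
   < n. *)
pose X om := inv (w z0 + w1 * om).
have XP om : cabs om < n%:R -> D0 (X om) /\ w (X om) = w z0 + w1 * om.
  move=> omn; apply: invP; rewrite addrC addKr cabsM -/d.
  by apply: lt_le_trans nd; rewrite mulrC ltr_pM2r.
have Xlip om om' : cabs om < n%:R -> cabs om' < n%:R -> cabs (X om - X om') <= d / del * cabs (om - om').
  move=> /XP[D wX] /XP[D' wX']; rewrite mulrAC ler_pdivlMr// mulrC.
  apply: le_trans (w_expand D' D) _; rewrite wX wX'.
  have -> : w z0 + w1 * om - (w z0 + w1 * om') = w1 * (om - om') by ring.
  by rewrite cabsM.
have winj z z' : D0 z -> D0 z' -> w z = w z' -> z = z'.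
  move=> Dz Dz' wz; have := w_expand Dz' Dz; rewrite wz subrr cabs0 pmulr_rle0// => h.
  by apply/eqP; rewrite -subr_eq0 -cabs_eq0 eq_le h cabs_ge0.
have X0 : X 0 = z0.
  have [D wX] : D0 (X 0) /\ w (X 0) = w z0 + w1 * 0 by apply: XP; rewrite cabs0.
  by apply: winj => //; rewrite wX mulr0 addr0.
have n1 : cabs (1 : R[i]) < n%:R by rewrite cabs1; lra.
have X1 : X 1 = z1.
  have [D wX] := XP _ n1.
  by apply: winj => //; rewrite wX /w1 mulr1 addrC subrK.
pose alf := rot_al t mu0 nu0.
(* No conj term is subtracted, by [be0]. *)
pose E om := G (X om) - G z0 - alf * w1 * om.
pose L := d * (Lw / del + Lam / del ^+ 2).
pose Kd := d / del.
(* |X om - z0| <= Kd |om| turns the deviation of the phase into T Kd^al |om|^al, and d = |w1| comes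
   from the change of coordinate. *)
pose K := Kb * T * d * Kd `^ al.
have Kd0 : 0 < Kd by rewrite divr_gt0.
have L0 : 0 < L by rewrite mulr_gt0// addr_gt0// divr_gt0.
have K0 : 0 <= K by exact: mulr_ge0 (mulr_ge0 (mulr_ge0 Kb0 T0) (ltW d0)) (powR_ge0 _ _).
have E00 : E 0 = 0 by rewrite /E X0 mulr0 !subrr.
have Elip q q' : cabs q < n%:R -> cabs q' < n%:R -> cabs (E q - E q') <= L * cabs (q - q').
  move=> qn q'n; have [[D _] [D' _]] := (XP _ qn, XP _ q'n).
  have -> : E q - E q' = (G (X q) - G (X q')) - alf * w1 * (q - q') by rewrite /E; ring.
  apply: le_trans (cabsB _ _) _; rewrite (cabsM (alf * w1)) (cabsM alf w1) -/d.
  have h1 := le_trans (Glip D D') (ler_wpM2l (ltW Lw0) (Xlip _ _ qn q'n)).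
  have h2 : cabs alf * d * cabs (q - q') <= Lam / del ^+ 2 * d * cabs (q - q').
    by apply: ler_wpM2r; rewrite ?cabs_ge0//; apply: ler_wpM2r; rewrite ?(ltW d0)//; exact: al_le.
  have -> : L * cabs (q - q') = Lw * (d / del * cabs (q - q')) + Lam / del ^+ 2 * d * cabs (q - q').
    by rewrite /L; ring.
  exact: lerD.
have Einc z mu nu om om' : cabs om < n%:R -> cabs om' < n%:R -> X om = z ->
    cdiff2 g z (rc mu) nu -> atan (mu + cabs nu) + atan (mu - cabs nu) = ph z ->
    let rho := g (X om') - g z - rc mu * (X om' - z) - nu * cconj (X om' - z) in
    E om' - E om - (rot_al t mu nu - alf) * w1 * (om' - om) - rc (rot_be t mu nu) * cconj w1 * cconj (om' - om)
    = rc (rot_det t mu nu)^-1 * (rc (rot_m t mu) * cconj rho - rc s * cconj nu * rho).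
  move=> omn om'n Xz dg sum rho; have [Dz wX] := XP _ omn; have [D' wX'] := XP _ om'n.
  rewrite Xz in Dz wX; have d1 := det_ge Dz dg sum.
  have d3 : rot_det t mu nu != 0 by apply: lt0r_neq0; exact: lt_le_trans d1.
  have := rot_residual g z (X om') d3; rewrite -/rho -/s -/w -/G /= => <-.
  have -> : rotw t g (X om') - rotw t g z = w1 * (om' - om).
    by rewrite -/(w _) -/(w z) wX wX'; ring.
  by rewrite /E Xz cconjM; ring.
have Eo e : 0 < e -> exists2 dl, 0 < dl & forall q, cabs q < dl -> cabs (E q) <= e * cabs q.
  move=> e0; pose k := 2 * Lw / del ^+ 2 * Kd.
  have k0 : 0 < k by rewrite mulr_gt0// divr_gt0// mulr_gt0.
  have ek0 : 0 < e / k by rewrite divr_gt0.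
  have [dl dl0 dlP] := g0 ek0.
  exists (Num.min n%:R (dl / Kd)); first by rewrite lt_min n0 divr_gt0.
  move=> q; rewrite lt_min => /andP[qn qd].
  have Xq : cabs (X q - z0) <= Kd * cabs q.
    by have := Xlip q 0 qn; rewrite X0 subr0; apply; rewrite cabs0.
  have Xqd : cabs (X q - z0) < dl by apply: le_lt_trans Xq _; rewrite mulrC -ltr_pdivlMr.
  have c0n : cabs (0 : R[i]) < n%:R by rewrite cabs0.
  have := Einc z0 mu0 nu0 0 q c0n qn X0 g0 g0ph; rewrite be0 E00 !subr0 -/alf subrr /=.
  rewrite (_ : rc 0 = 0)// !mul0r !subr0 => ->.
  have [r1 _] := res_le (g (X q) - g z0 - rc mu0 * (X q - z0) - nu0 * cconj (X q - z0)) z0D g0 g0ph.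
  apply: le_trans r1 _; have := dlP _ Xqd; rewrite [z0 + _]addrC subrK => r2.
  have c0 : 0 < 2 * Lw / del ^+ 2 by rewrite divr_gt0// mulr_gt0.
  apply: le_trans (ler_wpM2l (ltW c0) r2) _.
  apply: le_trans (ler_wpM2l (ltW c0) (ler_wpM2l (ltW ek0) Xq)) _.
  rewrite le_eqVlt; apply/orP; left; apply/eqP.
  by rewrite /k; field; rewrite !lt0r_neq0.
have Qn := @cabs_third_square R n%:R.
have Ed (a b : R) : - (n%:R / 3) <= a <= - (n%:R / 3) + n%:R -> - (n%:R / 3) <= b <= - (n%:R / 3) + n%:R ->
    Nn (ofC (X (mkC a b))) \/ exists2 be, cdiff E (mkC a b) be & cabs be <= K * cabs (mkC a b) `^ al.
  move=> aP bP; have omn := Qn _ _ n0 aP bP; set om := mkC a b in omn *.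
  have [DX wX] := XP _ omn.
  have [|[mu [nu [dg sum]]]] := gae DX; first by left.
  right; exists (rc (rot_be t mu nu) * cconj w1).
    exists ((rot_al t mu nu - alf) * w1) => e e0.
    pose k := 2 * Lw / del ^+ 2 * Kd.
    have k0 : 0 < k by rewrite mulr_gt0// divr_gt0// mulr_gt0.
    have ek0 : 0 < e / k by rewrite divr_gt0.
    have [dl dl0 dlP] := dg _ ek0.
    exists (Num.min (n%:R - cabs om) (dl / Kd)); first by rewrite lt_min subr_gt0 omn divr_gt0.
    move=> h; rewrite lt_min => /andP[hn hd].
    have om'n : cabs (om + h) < n%:R by apply: le_lt_trans (cabsD _ _) _; rewrite -ltrBrDl.
    have Xq : cabs (X (om + h) - X om) <= Kd * cabs h.
      by have := Xlip _ _ om'n omn; rewrite [om + h - om]addrC addKr.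
    have Xqd : cabs (X (om + h) - X om) < dl by apply: le_lt_trans Xq _; rewrite mulrC -ltr_pdivlMr.
    have := Einc (X om) mu nu om (om + h) omn om'n erefl dg sum; rewrite /=.
    have -> : om + h - om = h by rewrite addrC addKr.
    move=> ->.
    have [r1 _] := res_le (g (X (om + h)) - g (X om) - rc mu * (X (om + h) - X om) - nu * cconj (X (om + h) - X om)) DX dg sum.
    apply: le_trans r1 _; have := dlP _ Xqd; rewrite [X om + _]addrC subrK => r2.
    have c0 : 0 < 2 * Lw / del ^+ 2 by rewrite divr_gt0// mulr_gt0.
    apply: le_trans (ler_wpM2l (ltW c0) r2) _.
    apply: le_trans (ler_wpM2l (ltW c0) (ler_wpM2l (ltW ek0) Xq)) _.
    rewrite le_eqVlt; apply/orP; left; apply/eqP.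
    by rewrite /k; field; rewrite !lt0r_neq0.
  rewrite cabsM cabs_rc cabsJ -/d.
  apply: le_trans (ler_wpM2r (ltW d0) (be_bound DX dg sum)) _.
  have h1 := phT DX.
  have Xq : cabs (X om - z0) <= Kd * cabs om.
    by have := Xlip om 0 omn; rewrite X0 subr0; apply; rewrite cabs0.
  have h2 : cabs (X om - z0) `^ al <= Kd `^ al * cabs om `^ al.
    rewrite -powRM ?cabs_ge0 ?(ltW Kd0)//; apply: (@ge0_ler_powR R al (ltW al0)); rewrite ?nnegrE ?cabs_ge0//.
    by rewrite mulr_ge0 ?cabs_ge0 ?(ltW Kd0).
  have h3 := le_trans h1 (ler_wpM2l T0 h2).
  apply: le_trans (ler_wpM2r (ltW d0) (ler_wpM2l Kb0 h3)) _.
  by rewrite /K le_eqVlt; apply/orP; left; apply/eqP; ring.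
have Enull : cousin_null (- (n%:R / 3)) (- (n%:R / 3)) n%:R (fun a b => Nn (ofC (X (mkC a b)))).
  pose W (p : R * R) := ofC ((w (toC p) - w z0) / w1).
  have Lwd : 0 < 2 * Lw / d by rewrite divr_gt0// mulr_gt0.
  apply: (@cousin_null_image R Nn [set p | D0 (toC p)] 1 W (fun a b => ofC (X (mkC a b))) _ _ _ (2 * Lw / d)) => //.
  - exact: open_disc.
  - move=> p /D0r h; have := @cabs_ball R 0 (toC p) 1; rewrite sub0r cabsN toCK; exact.
  - move=> p p' ep Dp Dp' /ball_toC h.
    have hC : cabs ((w (toC p) - w z0) / w1 - (w (toC p') - w z0) / w1) <= 2 * Lw / d * ep.
      have -> : (w (toC p) - w z0) / w1 - (w (toC p') - w z0) / w1 = (w (toC p) - w (toC p')) / w1 by ring.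
      rewrite cabsM cabsV -/d; have h1 := le_trans (wlip Dp Dp') (ler_wpM2l (ltW Lw0) h).
      by apply: le_trans (ler_wpM2r _ h1) _; rewrite ?invr_ge0 ?(ltW d0)// le_eqVlt; apply/orP; left; apply/eqP; ring.
    split; [rewrite -creN -creD; apply: le_trans (cre_le _) hC|rewrite -cimN -cimD; apply: le_trans (cim_le _) hC].
  - move=> a b aP bP; have [DX wX] := XP _ (Qn _ _ n0 aP bP).
    split; first by rewrite /= ofCK.
    by rewrite /W ofCK wX [w z0 + _]addrC addrK mulrC mulKf.
  - move=> a b aP bP ep ep0; exists (ep / (2 * Kd)); first by rewrite divr_gt0// mulr_gt0.
    move=> a' b' a'P b'P ha hb; apply: cabs_ball; apply: le_lt_trans (Xlip _ _ (Qn _ _ n0 aP bP) (Qn _ _ n0 a'P b'P)) _.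
    have : cabs (mkC a b - mkC a' b') < ep / Kd.
      apply: le_lt_trans (cabs_le _) _; rewrite !cE.
      have -> : ep / Kd = ep / (2 * Kd) + ep / (2 * Kd) by field; rewrite lt0r_neq0.
      exact: ltrD.
    by move=> hlt; rewrite mulrC -ltr_pdivlMr.
have est := pointwise_estimate al0 al1 j2' L0 K0 Elip E00 Eo Enull Ed.
have c0n : cabs (0 : R[i]) < n%:R by rewrite cabs0.
have := Einc z0 mu0 nu0 0 1 c0n n1 X0 g0 g0ph; rewrite be0 E00 !subr0 -/alf subrr /=.
rewrite (_ : rc 0 = 0)// !mul0r !subr0 X1 => E1E.
have [_ r2] := res_le (g z1 - g z0 - rc mu0 * (z1 - z0) - nu0 * cconj (z1 - z0)) z0D g0 g0ph.
rewrite -E1E in r2.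
apply: le_trans r2 _.
have Lw20 : 0 <= 2 * Lw by rewrite mulr_ge0// ltW.
apply: le_trans (ler_wpM2l Lw20 est) _.
set C0 := 150 / (1 - al) + 8 / al + 16.
have C00 : 0 < C0 by rewrite !addr_gt0 ?divr_gt0 ?subr_gt0 ?ltr0n.
have hal : hh <= hh `^ al by apply: ger1_powR; rewrite ?hh0 ?hz1// ltW.
(* Both L and 1 / n are of order d, and hh <= hh^al, valid for hh <= 1, absorbs the square. *)
have q1 : L / n%:R <= 4 * (Lw / del + Lam / del ^+ 2) * Lw ^+ 2 / R0 * (hh * hh `^ al).
  have ni : n%:R^-1 <= 4 * d / R0.
    have -> : 4 * d / R0 = (x / 4)^-1 by rewrite /x; field; rewrite !lt0r_neq0.
    by rewrite lef_pV2 ?posrE//; lra.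
  have u0 : 0 <= Lw / del + Lam / del ^+ 2 by rewrite addr_ge0// divr_ge0 ?ltW.
  apply: le_trans (ler_wpM2l (ltW L0) ni) _.
  have -> : L * (4 * d / R0) = 4 * (Lw / del + Lam / del ^+ 2) / R0 * (d * d) by rewrite /L; ring.
  have -> : 4 * (Lw / del + Lam / del ^+ 2) * Lw ^+ 2 / R0 * (hh * hh `^ al) =
    4 * (Lw / del + Lam / del ^+ 2) / R0 * ((Lw * hh) * (Lw * hh `^ al)) by ring.
  apply: ler_wpM2l; first by rewrite divr_ge0 ?mulr_ge0// ltW.
  apply: ler_pM; rewrite ?(ltW d0)//; apply: le_trans dle _.
  by rewrite ler_pM2l.
have q2 : K <= Kb * T * Lw * (Lw / del) `^ al * (hh * hh `^ al).
  have h2 : Kd `^ al <= (Lw / del) `^ al * hh `^ al.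
    have e0 : 0 <= Lw / del by rewrite divr_ge0 ?ltW.
    rewrite -powRM ?(ltW hh0)//; apply: (@ge0_ler_powR R al (ltW al0)); rewrite ?nnegrE ?(ltW Kd0)//.
      by rewrite mulr_ge0 ?(ltW hh0).
    by rewrite /Kd mulrAC ler_pM2r ?invr_gt0.
  have -> : Kb * T * Lw * (Lw / del) `^ al * (hh * hh `^ al) = Kb * T * ((Lw * hh) * ((Lw / del) `^ al * hh `^ al)) by ring.
  rewrite /K -mulrA; apply: ler_wpM2l; first by rewrite mulr_ge0.
  by apply: ler_pM; rewrite ?(ltW d0) ?powR_ge0.
have q3 := ler_wpM2l (ltW C00) q2.
have e : 288 * Lw = 2 * Lw * 144 by ring.
rewrite /local_const -/C0 e -!(mulrA (2 * Lw)); apply: ler_wpM2l => //.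
by rewrite -!(mulrA 144) ler_pM2l//; apply: le_trans (lerD q1 q3) _; rewrite le_eqVlt; apply/orP; left; apply/eqP; ring.
Qed.

End Local.

(** * Calculus in the plane and the phase of a symmetric matrix *)

Section PlaneCalculus.
Context {R : realType}.
Implicit Types (f u : R * R -> R) (x h : R * R).

Lemma enormE x : enorm x = cabs (toC x). Proof. by []. Qed.

Definition pdiff f x (a b : R) := forall e, 0 < e -> exists2 d, 0 < d &
  forall h, enorm h < d -> `|f (x + h) - f x - a * h.1 - b * h.2| <= e * enorm h.

Lemma pair_norm_le h : `|h| <= enorm h.
Proof.
by rewrite prod_normE /= ge_max; apply/andP; split; [exact: (cre_le (toC h))|exact: (cim_le (toC h))].
Qed.

Lemma enorm_le_pair h : enorm h <= 2 * `|h|.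
Proof.
apply: le_trans (cabs_le (toC h)) _; rewrite /= mulr_natl mulr2n.
by apply: lerD; rewrite prod_normE /= le_max lexx ?orbT.
Qed.

Lemma diff_pdiff f x : differentiable f x ->
  pdiff f x (partial 0 f x) (partial 1 f x).
Proof.
move=> df e e0; have := diff_locally df; move/eqaddoP => /(_ e e0).
move/nbhs_ballP => [d /= d0 dP]; exists d => // h hd.
have hb : ball (0 : R * R) d h.
  by rewrite ball_pairE; split; rewrite /ball /= sub0r normrN;
    apply: le_lt_trans hd; [exact: (cre_le (toC h))|exact: (cim_le (toC h))].
have := dP h hb; rewrite /= => hP.
have dlin : 'd f x h = partial 0 f x * h.1 + partial 1 f x * h.2.
  rewrite /partial !deriveE//.
  have -> : h = h.1 *: (ebase R 0) + h.2 *: (ebase R 1).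
    by case: (h) => h1 h2; apply/pair_equal_spec; split; rewrite /ebase /=; rewrite /GRing.scale /= ?mulr1 ?mulr0 ?addr0 ?add0r.
  by rewrite linearD !linearZ /= /GRing.scale /= /ebase /=; ring.
apply: (@le_trans _ _ (e * `|h|)); last first.
  by have := ler_wpM2l (ltW e0) (pair_norm_le h).
apply: le_trans hP; rewrite le_eqVlt; apply/orP; left; apply/eqP; congr `|_|.
rewrite -[RHS]/(f (h + x) - (f x + 'd f x h)) dlin (addrC h); ring.
Qed.

Definition lin2 (a b : R) (h : R * R) : R := a * h.1 + b * h.2.

Fact lin2_is_linear a b : linear (lin2 a b).
Proof. by move=> k z z'; rewrite /lin2 /= /GRing.scale /=; ring. Qed.
HB.instance Definition _ a b :=
  GRing.isLinear.Build R (R * R)%type R _ (lin2 a b) (lin2_is_linear a b).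

Lemma pdiff_diff f x a b : pdiff f x a b ->
  [/\ differentiable f x, partial 0 f x = a & partial 1 f x = b].
Proof.
move=> df.
pose L : {linear (R * R)%type -> R} := lin2 a b.
have Lc : continuous L.
  move=> z; apply: (@cvgD _ _ _ _ _ (fun h : R * R => a * h.1) (fun h : R * R => b * h.2)).
    by apply: cvgM; [exact: cvg_cst|exact: cvg_fst].
  by apply: cvgM; [exact: cvg_cst|exact: cvg_snd].
have [dE expand] : ('d f x = L :> (R * R -> R)) /\ differentiable f x.
  suff h : f \o shift x = cst (f x) + (L : (R * R)%type -> R) +o_ (nbhs (0 : (R * R)%type)) (id : (R * R)%type -> (R * R)%type).
    have dE := diff_unique Lc h; split => //; by apply/diff_locallyP; rewrite dE.
  apply/eqaddoP => e e0; have e20 : 0 < e / 2 by rewrite divr_gt0.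
  have [d d0 dP] := df _ e20.
  apply/nbhs_ballP; exists (d / 4) => /=; first by rewrite divr_gt0.
  move=> h hb.
  have hh : `|h| < d / 4 by move: hb; rewrite ball_pairE => -[]; rewrite /ball /= !sub0r !normrN prod_normE /= gt_max => -> ->.
  have := dP h (le_lt_trans (enorm_le_pair h) _); have -> : 2 * `|h| < d by lra.
  move=> /(_ isT) hP.
  rewrite -[X in `|X|]/(f (h + x) - (f x + (a * h.1 + b * h.2))).
  have -> : f (h + x) - (f x + (a * h.1 + b * h.2)) = f (x + h) - f x - a * h.1 - b * h.2.
    by rewrite (addrC h); ring.
  apply: le_trans hP _; have := ler_wpM2l (ltW e20) (enorm_le_pair h); rewrite /=; lra.
have fd := expand.
by split => //; rewrite /partial deriveE// dE /= /lin2 /ebase /= ?mulr1 ?mulr0 ?addr0 ?add0r.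
Qed.

Lemma is_derive_hor u (x y s : R) : differentiable u (x + s, y) ->
  is_derive s 1 (fun r => u (x + r, y)) (partial 0 u (x + s, y)).
Proof.
move=> du; have dd : derivable u (x + s, y) (ebase R 0) by exact: diff_derivable.
have E : (fun h : R => h^-1 *: (((fun r => u (x + r, y)) \o shift s) (h *: 1) - u (x + s, y))) =
         (fun h : R => h^-1 *: ((u \o shift (x + s, y)) (h *: ebase R 0) - u (x + s, y))).
  apply/funext => h; congr (_ *: (u _ - _)); apply/pair_equal_spec.
  by split; rewrite /ebase /= /GRing.scale /= ?mulr1 ?mulr0 ?add0r// addrCA.
by split; [rewrite /derivable E|rewrite /derive E].
Qed.

Lemma is_derive_ver u (x y s : R) : differentiable u (x, y + s) ->
  is_derive s 1 (fun r => u (x, y + r)) (partial 1 u (x, y + s)).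
Proof.
move=> du; have dd : derivable u (x, y + s) (ebase R 1) by exact: diff_derivable.
have E : (fun h : R => h^-1 *: (((fun r => u (x, y + r)) \o shift s) (h *: 1) - u (x, y + s))) =
         (fun h : R => h^-1 *: ((u \o shift (x, y + s)) (h *: ebase R 1) - u (x, y + s))).
  apply/funext => h; congr (_ *: (u _ - _)); apply/pair_equal_spec.
  by split; rewrite /ebase /= /GRing.scale /= ?mulr1 ?mulr0 ?add0r// addrCA.
by split; [rewrite /derivable E|rewrite /derive E].
Qed.

Lemma mvt_diff (F dF : R -> R) (t : R) : 0 <= t ->
  (forall s, 0 <= s <= t -> is_derive s 1 F (dF s)) ->
  exists2 s, 0 <= s <= t & F t - F 0 = dF s * t.
Proof.
move=> t0 dFP; have [||s sP ->] := @MVT_segment R F dF 0 t t0.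
- by move=> s; rewrite in_itv /= => /andP[h1 h2]; apply: dFP; rewrite !ltW.
- apply: continuous_in_subspaceT => s; rewrite inE /= in_itv /= => /dFP [ds _].
  by apply: differentiable_continuous; apply/derivable1_diffP.
by exists s; [move: sP; rewrite in_itv|rewrite subr0].
Qed.

(* Second differences: both mixed derivatives are limits of the same quotient. *)
Lemma hess_sym u x (r a b b' d : R) : 0 < r ->
  (forall h, enorm h < r -> differentiable u (x + h)) ->
  pdiff (partial 0 u) x a b -> pdiff (partial 1 u) x b' d -> b = b'.
Proof.
move=> r0 du d0 d1; apply/eqP; rewrite -subr_eq0 -normr_le0.
apply/ler_addgt0Pl => e e0; rewrite addr0.
have e80 : 0 < e / 8 by rewrite divr_gt0.
have [r1 r10 P1] := d0 _ e80; have [r2 r20 P2] := d1 _ e80.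
pose t := Num.min r (Num.min r1 r2) / 4.
have m0 : 0 < Num.min r (Num.min r1 r2) by rewrite !lt_min r0 r10.
have t0 : 0 < t by rewrite divr_gt0.
have [tr [tr1 tr2]] : 2 * t < r /\ (2 * t < r1 /\ 2 * t < r2).
  have : 2 * t < Num.min r (Num.min r1 r2) by rewrite /t; lra.
  by rewrite !lt_min => /andP[-> /andP[-> ->]].
have en (p q : R) : 0 <= p <= t -> 0 <= q <= t -> enorm (p, q) <= 2 * t.
  move=> /andP[p0 p1] /andP[q0 q1]; apply: le_trans (cabs_le (toC (p, q))) _.
  by rewrite !cE /= !ger0_norm//; lra.
have [x1 [x2 xE]] : exists x1 x2 : R, x = (x1, x2) by exists x.1, x.2; case: (x).
have tt : 0 <= t <= t by rewrite lexx ltW.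
have z0 : 0 <= (0 : R) <= t by rewrite lexx ltW.
have dA p q : 0 <= p <= t -> 0 <= q <= t -> differentiable u (x1 + p, x2 + q).
  by move=> pP qP; have := du (p, q) (le_lt_trans (en _ _ pP qP) tr); rewrite xE.
pose D := u (x1 + t, x2 + t) - u (x1 + t, x2) - (u (x1, x2 + t) - u (x1, x2)).
have est0 : `|D - b * t ^+ 2| <= e / 2 * t ^+ 2.
  have [|s sP sE] := @mvt_diff (fun s => u (x1 + s, x2 + t) - u (x1 + s, x2))
     (fun s => partial 0 u (x1 + s, x2 + t) - partial 0 u (x1 + s, x2)) t (ltW t0).
    move=> s sP; apply: is_deriveB; apply: is_derive_hor; first exact: dA.
    by have := dA s 0 sP z0; rewrite addr0.
  have -> : D = (partial 0 u (x1 + s, x2 + t) - partial 0 u (x1 + s, x2)) * t.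
    by rewrite -sE addr0 /D; ring.
  have := P1 (s, t) (le_lt_trans (en _ _ sP tt) tr1); have := P1 (s, 0) (le_lt_trans (en _ _ sP z0) tr1).
  rewrite xE /= -[(x1, x2) + (s, 0)]/(x1 + s, x2 + 0) -[(x1, x2) + (s, t)]/(x1 + s, x2 + t) addr0.
  have := ler_wpM2l (ltW e80) (en _ _ sP tt); have := ler_wpM2l (ltW e80) (en _ _ sP z0).
  set A := partial 0 u (x1, x2); set B := partial 0 u (x1 + s, x2 + t); set C := partial 0 u (x1 + s, x2).
  move=> h1 h2 h3 h4.
  have -> : (B - C) * t - b * t ^+ 2 = ((B - A - a * s - b * t) - (C - A - a * s - b * 0)) * t by ring.
  rewrite normrM (gtr0_norm t0).
  have -> : e / 2 * t ^+ 2 = (e / 2 * t) * t by ring.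
  rewrite ler_pM2r//; apply: le_trans (ler_normB _ _) _; lra.
have est1 : `|D - b' * t ^+ 2| <= e / 2 * t ^+ 2.
  have [|s sP sE] := @mvt_diff (fun s => u (x1 + t, x2 + s) - u (x1, x2 + s))
     (fun s => partial 1 u (x1 + t, x2 + s) - partial 1 u (x1, x2 + s)) t (ltW t0).
    move=> s sP; apply: is_deriveB; apply: is_derive_ver; first exact: dA.
    by have := dA 0 s z0 sP; rewrite addr0.
  have -> : D = (partial 1 u (x1 + t, x2 + s) - partial 1 u (x1, x2 + s)) * t.
    by rewrite -sE addr0 /D; ring.
  have := P2 (t, s) (le_lt_trans (en _ _ tt sP) tr2); have := P2 (0, s) (le_lt_trans (en _ _ z0 sP) tr2).
  rewrite xE /= -[(x1, x2) + (0, s)]/(x1 + 0, x2 + s) -[(x1, x2) + (t, s)]/(x1 + t, x2 + s) addr0.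
  have := ler_wpM2l (ltW e80) (en _ _ tt sP); have := ler_wpM2l (ltW e80) (en _ _ z0 sP).
  set A := partial 1 u (x1, x2); set B := partial 1 u (x1 + t, x2 + s); set C := partial 1 u (x1, x2 + s).
  move=> h1 h2 h3 h4.
  have -> : (B - C) * t - b' * t ^+ 2 = ((B - A - b' * t - d * s) - (C - A - b' * 0 - d * s)) * t by ring.
  rewrite normrM (gtr0_norm t0).
  have -> : e / 2 * t ^+ 2 = (e / 2 * t) * t by ring.
  rewrite ler_pM2r//; apply: le_trans (ler_normB _ _) _; lra.
have t20 : 0 < t ^+ 2 by rewrite exprn_gt0.
rewrite -(ler_pM2r t20) -{1}(gtr0_norm t20) -normrM.
have -> : (b - b') * t ^+ 2 = (D - b' * t ^+ 2) - (D - b * t ^+ 2) by ring.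
apply: le_trans (ler_normB _ _) _; lra.
Qed.

Lemma char_poly2 (H : 'M[R]_2) : char_poly H = ('X - (H 0 0)%:P) * ('X - (H 1 1)%:P) - (H 0 1 * H 1 0)%:P.
Proof.
rewrite /char_poly (expand_det_row _ 0) !big_ord_recl big_ord0 /cofactor !det_mx11 !mxE /=.
rewrite !mulr1n !mulr0n !sub0r addr0 /bump /= expr0 expr1 mul1r.
have -> : lift (0 : 'I_2) (0 : 'I_1) = 1 by apply/val_inj.
have -> : lift (1 : 'I_2) (0 : 'I_1) = 0 by apply/val_inj.
by rewrite polyCM; ring.
Qed.

(** [eigenvalues] is an arbitrary choice of a splitting of the characteristic polynomial, so any
    such list is shown to consist of these two numbers in some order. *)
Lemma slag_sym2 (H : 'M[R]_2) : H 0 1 = H 1 0 ->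
  let mu := (H 0 0 + H 1 1) / 2 in let nu := mkC ((H 0 0 - H 1 1) / 2) (H 0 1) in
  slag H = atan (mu + cabs nu) + atan (mu - cabs nu).
Proof.
move=> sym mu nu; set l1 := mu + cabs nu; set l2 := mu - cabs nu.
have cE : char_poly H = ('X - l1%:P) * ('X - l2%:P).
  have e1 : l1 + l2 = H 0 0 + H 1 1 by rewrite /l1 /l2 /mu; field.
  have e2 : l1 * l2 = H 0 0 * H 1 1 - H 0 1 * H 1 0.
    have -> : l1 * l2 = mu ^+ 2 - cabs nu ^+ 2 by rewrite /l1 /l2; ring.
    by rewrite cabs_sqr /nu /cre /cim /= /mu -sym; field.
  rewrite char_poly2.
  have -> : ('X - l1%:P) * ('X - l2%:P) = 'X * 'X - (l1 + l2)%:P * 'X + (l1 * l2)%:P.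
    by move: (l1) (l2) => k1 k2; rewrite polyCD polyCM; ring.
  rewrite e1 e2; move: (H 0 0) (H 0 1) (H 1 0) (H 1 1) => h00 h01 h10 h11.
  by rewrite polyCB polyCD !polyCM; ring.
have : char_poly H = \prod_(l <- eigenvalues H) ('X - l%:P).
  apply: (@xgetPex _ [::] [set s : seq R | char_poly H = \prod_(l <- s) ('X - l%:P)]).
  by exists [:: l1; l2] => /=; rewrite !big_cons big_nil mulr1.
rewrite /slag; move: (eigenvalues H) => s; rewrite cE => sE.
have := congr1 (fun p : {poly R} => size p) sE.
rewrite size_prod_XsubC size_Mmonic ?polyXsubC_eq0 ?monicXsubC// !size_XsubC /=.
case: s sE => [//|x [//|y [|//]]]; rewrite !big_cons big_nil mulr1 => sE _.
rewrite big_nil addr0.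
have cancelX (p q : {poly R}) (z : R) : ('X - z%:P) * p = ('X - z%:P) * q -> p = q.
  by apply: mulfI; rewrite polyXsubC_eq0.
have inj (z z' : R) : 'X - z%:P = 'X - z'%:P -> z = z'.
  by move/addrI/oppr_inj/polyC_inj.
have : root (('X - l1%:P) * ('X - l2%:P)) x by rewrite sE rootM root_XsubC eqxx.
rewrite rootM !root_XsubC => /orP[/eqP xl|/eqP xl].
  by move: sE; rewrite xl => /cancelX/inj <-.
by move: sE; rewrite xl mulrC => /cancelX/inj <-; rewrite addrC.
Qed.

End PlaneCalculus.

(** * Uniform first-order expansions *)

Section TaylorHolder.
Context {R : realType} (al : R).
Hypotheses (al0 : 0 < al) (al1 : al < 1).
Implicit Types (f a b : R * R -> R) (x y z h : R * R).

Lemma enorm_ge0 h : 0 <= enorm h. Proof. exact: sqrtr_ge0. Qed.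

Lemma enormD x y : enorm (x + y) <= enorm x + enorm y.
Proof. exact: (cabsD (toC x) (toC y)). Qed.

Lemma enormN x : enorm (- x) = enorm x.
Proof. by rewrite /enorm /= !sqrrN. Qed.

Lemma enormB x y : enorm (x - y) = enorm (y - x).
Proof. by rewrite -enormN opprB. Qed.

Lemma enorm_fst h : `|h.1| <= enorm h. Proof. exact: (cre_le (toC h)). Qed.

Lemma enorm_snd h : `|h.2| <= enorm h. Proof. exact: (cim_le (toC h)). Qed.

Lemma enorm0_eq h : enorm h = 0 -> h = 0.
Proof.
move=> h0; have := enorm_fst h; have := enorm_snd h; rewrite h0 !normr_le0.
by case: (h) => h1 h2 /= /eqP -> /eqP ->.
Qed.

Lemma enormB_gt0 x y : x != y -> 0 < enorm (x - y).
Proof.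
move=> xy; rewrite lt_neqAle enorm_ge0 andbT eq_sym.
by apply: contra_neq xy => /enorm0_eq/eqP; rewrite subr_eq0 => /eqP.
Qed.

Lemma enorm_hor (t : R) : 0 <= t -> enorm (t, 0) = t.
Proof. by move=> t0; rewrite /enorm /= expr0n /= addr0 sqrtr_sqr ger0_norm. Qed.

Lemma enorm_ver (t : R) : 0 <= t -> enorm (0, t) = t.
Proof. by move=> t0; rewrite /enorm /= expr0n /= add0r sqrtr_sqr ger0_norm. Qed.

Lemma powR_double (s t : R) : 0 <= s -> s <= 2 * t -> s `^ al <= 2 * t `^ al.
Proof.
move=> s0 st; have t0 : 0 <= t by lra.
have h := @ge0_ler_powR R al (ltW al0) s (2 * t); apply: le_trans (h _ _ st) _.
- by rewrite nnegrE.
- by rewrite nnegrE; lra.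
rewrite powRM// ler_wpM2r ?powR_ge0//.
by have := @ler_powR R 2 _ al 1 (ltW al1); rewrite powRr1//; apply; lra.
Qed.

(** The expansion is required on the whole unit ball, so that expansions at two base points can be
    compared at any common point. *)
Definition taylor1 (C : R) f x (p q : R) := forall z, enorm z < 1 ->
  `|f z - f x - p * (z - x).1 - q * (z - x).2| <=
    C * (enorm (z - x) * enorm (z - x) `^ al).

Lemma taylor1_le (C s d : R) f x z p q : 0 <= C -> taylor1 C f x p q ->
  enorm z < 1 -> enorm (z - x) <= s -> s <= 2 * d ->
  `|f z - f x - p * (z - x).1 - q * (z - x).2| <= C * (s * (2 * d `^ al)).
Proof.
move=> C0 T1 z1 zs sd; apply: le_trans (T1 z z1) _; apply: ler_wpM2l => //.
apply: ler_pM => //; [exact: enorm_ge0|exact: powR_ge0|].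
by apply: powR_double; [exact: enorm_ge0|lra].
Qed.

(** Both expansions are evaluated at x + v with |v| = d / 2 along a coordinate axis, which stays in
    the unit ball. The remainders at distances d / 2, 3 d / 2 and d total 6 C d^(1 + al); division
    by d / 2 gives 12 C. *)
Lemma taylor1_holder (C : R) f x y p q p' q' : 0 <= C -> x != y ->
  enorm x < 1 / 2 -> enorm y < 1 / 2 ->
  taylor1 C f x p q -> taylor1 C f y p' q' ->
  `|p - p'| <= 12 * C * enorm (x - y) `^ al /\
  `|q - q'| <= 12 * C * enorm (x - y) `^ al.
Proof.
move=> C0 xy x12 y12 Tx Ty.
have := enormB_gt0 xy; set d := enorm (x - y) => d0.
have d1 : d < 1 by have := enormD x (- y); rewrite enormN -/d; lra.
have x1 : enorm x < 1 by lra.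
have key v : enorm v = d / 2 ->
    `|(p - p') * v.1 + (q - q') * v.2| <= d / 2 * (12 * C * d `^ al).
  move=> vd; have xv1 : enorm (x + v) < 1 by have := enormD x v; lra.
  have xvx : enorm (x + v - x) <= d / 2 by rewrite addrC addKr vd.
  have xvy : enorm (x + v - y) <= 3 * d / 2.
    by rewrite -addrA addrCA addrC; have := enormD (x - y) v; rewrite -/d; lra.
  have h1 := taylor1_le C0 Tx xv1 xvx (_ : _ <= 2 * d).
  have h2 := taylor1_le C0 Ty xv1 xvy (_ : _ <= 2 * d).
  have h3 := taylor1_le C0 Ty x1 (lexx d) (_ : _ <= 2 * d).
  have {h1}h1 := h1 ltac:(lra); have {h2}h2 := h2 ltac:(lra); have {h3}h3 := h3 ltac:(lra).
  move: h1 h2 h3 => /=; set fv := f (x + v); set fx := f x; set fy := f y.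
  set e1 := (X in `|X| <= _); move=> h1; set e2 := (X in `|X| <= _); move=> h2.
  set e3 := (X in `|X| <= _); move=> h3.
  have -> : (p - p') * v.1 + (q - q') * v.2 = e2 - e3 - e1.
    by rewrite /e1 /e2 /e3 /=; ring.
  apply: le_trans (ler_normB _ _) _; have := ler_normB e2 e3.
  have : C * (d / 2 * (2 * d `^ al)) + C * (3 * d / 2 * (2 * d `^ al)) +
     C * (d * (2 * d `^ al)) = d / 2 * (12 * C * d `^ al) by field.
  by lra.
have d20 : 0 < d / 2 by lra.
split.
  have := key _ (enorm_hor (ltW d20)); rewrite /= mulr0 addr0 normrM (gtr0_norm d20) mulrC.
  by rewrite ler_pM2l.
have := key _ (enorm_ver (ltW d20)); rewrite /= mulr0 add0r normrM (gtr0_norm d20) mulrC.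
by rewrite ler_pM2l.
Qed.

(** McShane's extension formula at a single point; the factor 2 comes from [powR_double]. *)
Lemma squeeze_point (S : set (R * R)) a (K : R) x : 0 <= K ->
  (forall p q, S p -> S q -> p != q -> `|a p - a q| <= K * enorm (p - q) `^ al) ->
  exists A, forall p, S p -> `|A - a p| <= 2 * K * enorm (x - p) `^ al.
Proof.
move=> K0 aH; have [[p0 Sp0]|noS] := pselect (exists p, S p); last first.
  by exists 0 => p Sp; case: noS; exists p.
pose E := [set a p - 2 * K * enorm (x - p) `^ al | p in S].
have sep p q : S p -> S q -> a p - 2 * K * enorm (x - p) `^ al <= a q + 2 * K * enorm (x - q) `^ al.
  move=> Sp Sq; have P1 := powR_ge0 (enorm (x - p)) al; have P2 := powR_ge0 (enorm (x - q)) al.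
  have [<-|pq] := eqVneq p q; first by rewrite lerBlDr -addrA lerDl; apply: addr_ge0;
    exact: mulr_ge0 (mulr_ge0 (ler0n _ 2) K0) P1.
  have tri : enorm (p - q) <= enorm (x - p) + enorm (x - q).
    by have := enormD (p - x) (x - q); rewrite (enormB p x) addrA subrK.
  have pw : enorm (p - q) `^ al <= 2 * enorm (x - p) `^ al + 2 * enorm (x - q) `^ al.
    have [h|h] := leP (enorm (x - p)) (enorm (x - q)).
      apply: le_trans (powR_double (enorm_ge0 _) (_ : _ <= 2 * enorm (x - q))) _; first by lra.
      by rewrite lerDr; exact: mulr_ge0 (ler0n _ 2) P1.
    apply: le_trans (powR_double (enorm_ge0 _) (_ : _ <= 2 * enorm (x - p))) _; first by lra.
    by rewrite lerDl; exact: mulr_ge0 (ler0n _ 2) P2.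
  rewrite lerBlDr -addrA -lerBlDl; apply: le_trans (ler_norm _) _; apply: le_trans (aH p q Sp Sq pq) _.
  apply: le_trans (ler_wpM2l K0 pw) _; rewrite le_eqVlt; apply/orP; left; apply/eqP; ring.
have Esup : has_sup E.
  split; first by exists (a p0 - 2 * K * enorm (x - p0) `^ al), p0.
  by exists (a p0 + 2 * K * enorm (x - p0) `^ al) => _ [p Sp <-]; exact: sep.
exists (sup E) => p Sp; rewrite ler_distl; apply/andP; split.
  by apply: ub_le_sup; [case: Esup|exists p].
by apply: sup_le_ub; [case: Esup|move=> _ [q Sq <-]; exact: sep].
Qed.

(* The gradients, Hoelder on the dense set by [taylor1_holder], extend by
   squeezing; the expansions then pass to the limit points. *)
Lemma taylor1_extend (S : set (R * R)) (C : R) f a b : 0 <= C ->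
  (forall p, S p -> enorm p < 1 / 2) ->
  (forall x e, enorm x < 1 / 2 -> 0 < e -> exists2 p, S p & enorm (p - x) < e) ->
  (forall p, S p -> taylor1 C f p (a p) (b p)) ->
  forall x, enorm x < 1 / 2 -> exists pq : R * R, taylor1 (101 * C) f x pq.1 pq.2.
Proof.
move=> C0 S12 dense ST x x12.
have K0 : 0 <= 12 * C by lra.
have aH p q : S p -> S q -> p != q -> `|a p - a q| <= 12 * C * enorm (p - q) `^ al.
  by move=> Sp Sq pq; have [] := taylor1_holder C0 pq (S12 _ Sp) (S12 _ Sq) (ST _ Sp) (ST _ Sq).
have bH p q : S p -> S q -> p != q -> `|b p - b q| <= 12 * C * enorm (p - q) `^ al.
  by move=> Sp Sq pq; have [] := taylor1_holder C0 pq (S12 _ Sp) (S12 _ Sq) (ST _ Sp) (ST _ Sq).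
have [A AP] := squeeze_point x K0 aH; have [B BP] := squeeze_point x K0 bH.
exists (A, B) => z z1 /=.
have [->|zx] := eqVneq z x.
  rewrite !subrr !mulr0 !subr0 normr0 mulr_ge0 ?mulr_ge0 ?enorm_ge0 ?powR_ge0//.
have := enormB_gt0 zx; set d := enorm (z - x) => d0.
(* The base point p depends on z: it is closer to x than z is, so all errors made at p are of order
   d^(1 + al). *)
have [p Sp px] := dense x d x12 d0.
have zp : enorm (z - p) <= 2 * d.
  have := enormD (z - x) (x - p); rewrite addrA subrK (enormB x p) -/d; lra.
have x1 : enorm x < 1 by lra.
have xp : enorm (x - p) <= d by rewrite enormB ltW.
have {}h1 := taylor1_le C0 (ST p Sp) z1 zp (lexx _).
have h2 := taylor1_le C0 (ST p Sp) x1 xp (_ : d <= 2 * d).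
have {}h2 := h2 ltac:(lra).
have pw : enorm (x - p) `^ al <= d `^ al.
  by apply: ge0_ler_powR; rewrite ?nnegrE ?enorm_ge0 ?(ltW al0) ?(ltW d0).
have Pd := powR_ge0 d al.
have close (U u' w : R) : `|U - u'| <= 2 * (12 * C) * enorm (x - p) `^ al -> `|w| <= d ->
    `|(u' - U) * w| <= 24 * C * d `^ al * d.
  move=> h w1; rewrite normrM; apply: ler_pM (normr_ge0 _) (normr_ge0 _) _ w1; rewrite distrC.
  apply: le_trans h _; have -> : 24 * C = 2 * (12 * C) by ring.
  by rewrite ler_wpM2l// mulr_ge0.
have h3 := close _ _ _ (AP p Sp) (enorm_fst (z - x)).
have h4 := close _ _ _ (BP p Sp) (enorm_snd (z - x)).
move: h1 h2 h3 h4 => /=.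
set e1 := (X in `|X| <= _); move=> h1; set e2 := (X in `|X| <= _); move=> h2.
set e3 := (X in `|X| <= _); move=> h3; set e4 := (X in `|X| <= _); move=> h4.
have -> : f z - f x - A * (z.1 - x.1) - B * (z.2 - x.2) = (e1 - e2) + (e3 + e4).
  by rewrite /e1 /e2 /e3 /e4 /=; ring.
apply: le_trans (ler_normD _ _) _.
have := ler_normB e1 e2; have := ler_normD e3 e4.
(* The coefficients 4 + 2 + 24 + 24 = 54 stay below 101. *)
have : C * (2 * d * (2 * d `^ al)) + C * (d * (2 * d `^ al)) + 24 * C * d `^ al * d + 24 * C * d `^ al * d
  <= 101 * C * (d * d `^ al).
  by have := mulr_ge0 C0 (mulr_ge0 (ltW d0) Pd); lra.
lra.
Qed.

(** Turns the extended expansions into true derivatives, so that [hess] takes no default value in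
    the half ball. *)
Lemma taylor1_pdiff (C : R) f x p q : 0 <= C -> enorm x < 1 -> taylor1 C f x p q ->
  pdiff f x p q.
Proof.
move=> C0 x1 fT e e0.
(* Then C r^al <= e, also when C = 0. *)
pose r := (e / (C + 1)) `^ al^-1.
have eC : 0 < e / (C + 1) by rewrite divr_gt0//; lra.
have r0 : 0 < r by exact: powR_gt0.
exists (Num.min r (1 - enorm x)); first by rewrite lt_min r0 subr_gt0.
move=> h; rewrite lt_min => /andP[hr h1].
have := fT (x + h) _; have -> : enorm (x + h) < 1 by have := enormD x h; lra.
move=> /(_ isT); rewrite [x + h - x]addrC addKr => H; apply: le_trans H _.
rewrite mulrCA mulrC; apply: ler_wpM2r; first exact: enorm_ge0.
have : enorm h `^ al <= e / (C + 1).
  have -> : e / (C + 1) = r `^ al by rewrite /r -powRrM mulVf ?powRr1 ?(ltW eC)// gt_eqF.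
  by apply: ge0_ler_powR; rewrite ?nnegrE ?enorm_ge0 ?(ltW al0) ?(ltW r0) ?(ltW hr).
move/(ler_wpM2l C0)/le_trans; apply; rewrite mulrA ler_pdivrMr; last by lra.
by have := mulr_ge0 C0 (ltW e0); lra.
Qed.

Lemma taylor1_bound (C L : R) f x p q : 0 <= C -> 0 <= L -> enorm x < 1 / 2 ->
  (forall z, enorm z < 1 -> `|f z - f x| <= L * enorm (z - x)) ->
  taylor1 C f x p q -> `|p| <= L + C /\ `|q| <= L + C.
Proof.
move=> C0 L0 x12 fL fT.
have t0 : 0 < 1 / 2 :> R by lra.
have key v : enorm v = 1 / 2 -> `|p * v.1 + q * v.2| <= (L + C) / 2.
  move=> v12; have xv : enorm (x + v) < 1 by have := enormD x v; lra.
  have := fL _ xv; have := fT _ xv; rewrite [x + v - x]addrC addKr v12.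
  set F := f (x + v) - f x; move=> h1 h2.
  have -> : p * v.1 + q * v.2 = F - (F - p * v.1 - q * v.2) by ring.
  apply: le_trans (ler_normB _ _) _.
  have : (1 / 2 : R) `^ al <= 1.
    have E1 : (1 : R) `^ al = 1 by rewrite powR1.
    by rewrite -[leRHS]E1; apply: ge0_ler_powR; rewrite ?nnegrE ?(ltW al0)//; lra.
  by move/(ler_wpM2l C0); lra.
split.
  have := key _ (enorm_hor (ltW t0)); rewrite /= mulr0 addr0 normrM (gtr0_norm t0); lra.
have := key _ (enorm_ver (ltW t0)); rewrite /= mulr0 add0r normrM (gtr0_norm t0); lra.
Qed.

End TaylorHolder.

(** * Hölder norms and matrix norms *)

Section HolderNorms.
Context {R : realType} (V : zmodType) (N : V -> R).
Hypothesis N_ge0 : forall v, 0 <= N v.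
Implicit Types (A : set (R * R)) (f : R * R -> V).

Lemma sup_norm_ge0 A f x : A x -> (0 <= sup_norm N A f)%E.
Proof.
move=> Ax; apply: (@le_trans _ _ (N (f x))%:E); first by rewrite lee_fin.
by apply: ereal_sup_ubound; exists x.
Qed.

Lemma holder_seminorm_ge0 a A f x y : A x -> A y -> x != y ->
  (0 <= holder_seminorm N a A f)%E.
Proof.
move=> Ax Ay xy; apply: (@le_trans _ _ (N (f x - f y) / enorm (x - y) `^ a)%:E).
  by rewrite lee_fin divr_ge0 ?powR_ge0.
by apply: ereal_sup_ubound; exists (x, y).
Qed.

(** The supremum of an empty set is -oo, so the seminorm is known to be nonnegative only in the
    presence of two distinct points; then each summand is at most the total. *)
Lemma holder_norm_fin a A f T x y : holder_norm N a A f = T%:E ->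
  A x -> A y -> x != y -> N (f x) <= T /\ N (f x - f y) <= T * enorm (x - y) `^ a.
Proof.
move=> fT Ax Ay xy.
have s0 := sup_norm_ge0 f Ax; have h0 := holder_seminorm_ge0 a f Ax Ay xy.
have s1 : ((N (f x))%:E <= sup_norm N A f)%E by apply: ereal_sup_ubound; exists x.
have h1 : ((N (f x - f y) / enorm (x - y) `^ a)%:E <= holder_seminorm N a A f)%E.
  by apply: ereal_sup_ubound; exists (x, y).
split.
  by rewrite -lee_fin -fT /holder_norm -[leLHS]adde0; exact: leeD.
have e0 := enormB_gt0 xy.
rewrite -ler_pdivrMr ?powR_gt0// -lee_fin -fT /holder_norm -[leLHS]add0e; exact: leeD.
Qed.

Lemma sup_norm_le A f c : (forall x, A x -> N (f x) <= c) -> (sup_norm N A f <= c%:E)%E.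
Proof. by move=> fc; apply: ge_ereal_sup => _ [x Ax <-]; rewrite lee_fin fc. Qed.

Lemma holder_norm_le a A f c k : (forall x, A x -> N (f x) <= c) ->
  (forall x y, A x -> A y -> x != y -> N (f x - f y) <= k * enorm (x - y) `^ a) ->
  (holder_norm N a A f <= (c + k)%:E)%E.
Proof.
move=> fc fk; rewrite EFinD; apply: leeD; first exact: sup_norm_le.
apply: ge_ereal_sup => _ [[x y] /= [Ax Ay xy] <-]; rewrite lee_fin.
have e0 := enormB_gt0 xy.
by rewrite ler_pdivrMr ?powR_gt0//; exact: fk.
Qed.

End HolderNorms.

Section Matrices.
Context {R : realType}.
Implicit Types (u : R * R -> R) (x : R * R).

Lemma mxnorm2_ge0 m n (A : 'M[R]_(m, n)) : 0 <= mxnorm2 A.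
Proof. exact: sqrtr_ge0. Qed.

Lemma mxnorm2_le (A : 'M[R]_2) c : (forall i j, `|A i j| <= c) -> mxnorm2 A <= 2 * c.
Proof.
move=> Ac; have c0 : 0 <= c by apply: le_trans (Ac 0 0).
rewrite -[leRHS]ger0_norm ?mulr_ge0// -sqrtr_sqr; apply: ler_wsqrtr.
have sq i j : A i j ^+ 2 <= c ^+ 2 by rewrite -real_normK ?num_real// lerXn2r ?nnegrE.
rewrite !big_ord_recl !big_ord0.
by have := sq 0 0; have := sq 0 (lift ord0 ord0); have := sq (lift ord0 ord0) 0;
  have := sq (lift ord0 ord0) (lift ord0 ord0); rewrite exprMn; lra.
Qed.

Lemma ord2 (P : 'I_2 -> Prop) : P 0 -> P 1 -> forall i, P i.
Proof.
move=> P0 P1 [[|[|//]] i2]; [have -> : Ordinal i2 = 0 by apply/val_inj|]; first by [].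
by have -> : Ordinal i2 = 1 by apply/val_inj.
Qed.

Lemma grad_cabs u x y : mxnorm2 (grad u x - grad u y) =
  cabs (mkC (partial 0 u x) (partial 1 u x) - mkC (partial 0 u y) (partial 1 u y)).
Proof.
rewrite /mxnorm2 big_ord_recl big_ord0 addr0 !big_ord_recl big_ord0 addr0 !mxE.
by have -> : lift ord0 ord0 = 1 :> 'I_2 by apply/val_inj.
Qed.

Lemma grad_diff u x : differentiable (grad u) x <->
  differentiable (partial 0 u) x /\ differentiable (partial 1 u) x.
Proof.
split=> [du|[d0 d1]].
  have dp i : differentiable (partial i u) x.
    have -> : partial i u = (fun M : 'rV[R]_2 => M 0 i) \o grad u.
      by apply/funext => y; rewrite /= mxE.
    by apply: differentiable_comp => //; exact: differentiable_coord.
  by split.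
have -> : grad u = (fun y => partial 0 u y *: delta_mx 0 0) + (fun y => partial 1 u y *: delta_mx 0 1).
  apply/funext => y; apply/matrixP => i j; rewrite !mxE !ord1 /=.
  by move: j; apply: ord2; rewrite /= ?mulr1 ?mulr0 ?addr0 ?add0r.
by apply: differentiableD; exact: differentiableZl.
Qed.

End Matrices.

(** * Expansions at almost every point and the conclusion *)

Section Main.
Context {R : realType}.
Implicit Types (u : R * R -> R) (x : R * R).

Lemma negligible_dense (Nn : set (R * R)) x e : (leb2 R).-negligible (Nn : set (mplane R)) ->
  0 < e -> exists2 p, ~ Nn p & enorm (p - x) < e.
Proof.
move=> Nn0 e0; apply: contrapT => full.
have e40 : 0 < e / 4 by lra.
pose B : set (mplane R) := ball (x : R * R) (e / 4).
have sub : B `<=` Nn.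
  move=> p xp; have [//|Np] := pselect (Nn p); case: full; exists p => //.
  by have := ball_toC xp; rewrite enormB enormE; have -> : toC (x - p) = toC x - toC p by []; lra.
have mB : measurable B by apply: open_plane_measurable; exact: ball_open.
have B0 : leb2 R B = 0%E by exact: (negligibleP _ mB).1 (negligibleS sub Nn0).
have := @leb2_ball R x _ (ltW e40); rewrite -/B B0 => -[] /esym; apply/eqP.
by rewrite mulf_neq0 ?expf_neq0 ?gt_eqF.
Qed.

Definition cgrad u (z : R[i]) := mkC (partial 0 u (ofC z)) (partial 1 u (ofC z)).

Lemma ofCD x (h : R[i]) : ofC (toC x + h) = x + ofC h.
Proof. by apply/pair_equal_spec; rewrite /= !cE. Qed.

Lemma enorm_ofC (z : R[i]) : enorm (ofC z) = cabs z.
Proof. by rewrite enormE ofCK. Qed.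

Lemma enorm_ofCB (z z' : R[i]) : enorm (ofC z - ofC z') = cabs (z - z').
Proof. by rewrite -enorm_ofC; congr enorm; apply/pair_equal_spec; rewrite !cE. Qed.

(** The complex form of a symmetric matrix with entries a, b, d: half its trace acts on h, its
    trace-free part acts on conj h. *)
Lemma affine_parts (a b d : R) (G G0 h : R[i]) :
  let w := G - G0 - rc ((a + d) / 2) * h - mkC ((a - d) / 2) b * cconj h in
  cre w = cre G - cre G0 - a * cre h - b * cim h /\
  cim w = cim G - cim G0 - b * cre h - d * cim h.
Proof. by move=> w; rewrite /w !(cE, cconjE); split; field. Qed.

Lemma hess_cdiff2 u x : (forall y, eball 1 y -> differentiable u y) -> eball 1 x ->
  differentiable (grad u) x ->
  hess u x 0 1 = hess u x 1 0 /\
  cdiff2 (cgrad u) (toC x) (rc ((hess u x 0 0 + hess u x 1 1) / 2))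
    (mkC ((hess u x 0 0 - hess u x 1 1) / 2) (hess u x 0 1)).
Proof.
move=> du x1 /grad_diff[d0 d1].
have P0 := diff_pdiff d0; have P1 := diff_pdiff d1.
have sym : hess u x 0 1 = hess u x 1 0.
  rewrite !mxE; apply: (@hess_sym R u x (1 - enorm x) _ _ _ _ _ _ P0 P1).
    by rewrite subr_gt0; exact: x1.
  by move=> h h1; apply: du; rewrite /eball /=; have := enormD x h; lra.
split=> // e e0; have e20 : 0 < e / 2 by lra.
have [r0 r00 H0] := P0 _ e20; have [r1 r10 H1] := P1 _ e20.
exists (Num.min r0 r1); first by rewrite lt_min r00.
move=> h; rewrite lt_min -enorm_ofC => /andP[/H0 h0 /H1 h1].
have [E0 E1] := affine_parts (hess u x 0 0) (hess u x 0 1) (hess u x 1 1)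
  (cgrad u (toC x + h)) (cgrad u (toC x)) h.
apply: le_trans (cabs_le _) _; rewrite (splitr e) [leRHS]mulrDl; apply: lerD.
  by rewrite E0 /cgrad ofCD toCK !mxE; exact: h0.
by rewrite E1 sym /cgrad ofCD toCK !mxE; exact: h1.
Qed.

(** Close to x the local estimate applies; at distance at least [r1] the remainder is at most 3 Lam
    |z - x|, and dividing by r1^al supplies the missing power. [C] is fixed before [u], hence
    depends on Lam, al and T only. *)
Lemma interior_taylor (Lam al T : R) : 0 < Lam -> 0 < al -> al < 1 -> 0 <= T ->
  exists2 C, 0 <= C & forall u theta (Nn : set (R * R)),
    (leb2 R).-negligible (Nn : set (mplane R)) ->
    (forall y, eball 1 y -> differentiable u y) ->
    (forall x y, eball 1 x -> eball 1 y -> x != y ->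
       mxnorm2 (grad u x - grad u y) <= Lam * enorm (x - y)) ->
    (forall x y, eball 1 x -> eball 1 y -> x != y ->
       `|theta x - theta y| <= T * enorm (x - y) `^ al) ->
    (forall x, eball 1 x -> ~ Nn x ->
       differentiable (grad u) x /\ slag (hess u x) = theta x) ->
    forall x, enorm x < 1 / 2 -> ~ Nn x -> forall i,
      taylor1 al C (partial i u) x (hess u x i 0) (hess u x i 1).
Proof.
move=> Lam0 al0 al1 T0.
(* On a disc of radius at most q^(1 / al) the phase varies by no more than the rotation tolerates; T
   + 1 covers T = 0. *)
pose q := 2 * half_gap (2 * Lam) / (T + 1).
have T10 : 0 < T + 1 by rewrite ltr_wpDl.
have hg0 := half_gap_gt0 (2 * Lam).
have q0 : 0 < q by apply: divr_gt0 T10; apply: mulr_gt0 hg0.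
(* The bound 1 / 2 keeps discs around points of the half ball inside the unit ball. *)
pose rho0 := Num.min (1 / 2) (q `^ al^-1).
have rho00 : 0 < rho0.
  by rewrite lt_min; apply/andP; split; [lra|exact: powR_gt0].
have rho12 : rho0 <= 1 / 2 by rewrite ge_min lexx.
have rhoT : T * rho0 `^ al <= 2 * half_gap (2 * Lam).
  have rq : rho0 `^ al <= q.
    have qE : (q `^ al^-1) `^ al = q by rewrite -powRrM mulVf ?powRr1 ?(ltW q0) ?gt_eqF.
    by rewrite -[leRHS]qE; apply: ge0_ler_powR; rewrite ?nnegrE ?powR_ge0 ?(ltW al0) ?(ltW rho00)// ge_min lexx orbT.
  have : (T + 1) * q = 2 * half_gap (2 * Lam) by rewrite /q mulrC divfK// gt_eqF//; lra.
  by have := ler_wpM2l T0 rq; lra.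
pose r1 := Num.min 1 (local_radius Lam rho0).
have lr0 : 0 < local_radius Lam rho0.
  have el0 : 0 < ellip (2 * Lam) by apply: ellip_gt0; lra.
  by rewrite /local_radius !divr_gt0 ?mulr_gt0 ?divr_gt0 ?mulr_gt0//; lra.
have r10 : 0 < r1 by rewrite lt_min lr0 ltr01.
have r1a : 0 < r1 `^ al by exact: powR_gt0.
have C0 : 0 <= 3 * Lam / r1 `^ al by rewrite divr_ge0 ?(ltW r1a)//; lra.
exists (`|local_const Lam al T rho0| + 3 * Lam / r1 `^ al); first by rewrite addr_ge0.
move=> u theta Nn Nn0 du ulip thold sol x x12 Nx.
have x1 : eball 1 x by rewrite /eball /=; lra.
have glip (z z' : R[i]) : cabs z < 1 -> cabs z' < 1 ->
    cabs (cgrad u z - cgrad u z') <= Lam * cabs (z - z').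
  have [->|zz] := eqVneq z z'; first by rewrite !subrr cabs0 mulr0.
  move=> z1 z1'; rewrite /cgrad -grad_cabs -enorm_ofCB; apply: ulip.
  - by rewrite /eball /= enorm_ofC.
  - by rewrite /eball /= enorm_ofC.
  - by apply: contra_neq zz => /(congr1 toC); rewrite !ofCK.
have disc (z : R[i]) : cabs (z - toC x) < rho0 -> cabs z < 1.
  by have := cabsD (z - toC x) (toC x); rewrite subrK -enormE; lra.
have sing y : eball 1 y -> ~ Nn y -> exists (mu : R) (nu : R[i]),
    cdiff2 (cgrad u) (toC y) (rc mu) nu /\ atan (mu + cabs nu) + atan (mu - cabs nu) = theta y.
  move=> y1 Ny; have [dg <-] := sol _ y1 Ny; have [sym dC] := hess_cdiff2 du y1 dg.
  by do 2 eexists; split; [exact: dC|rewrite (slag_sym2 sym)].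
have [dg sx] := sol _ x1 Nx; have [sym dC] := hess_cdiff2 du x1 dg.
have := slag_sym2 sym; rewrite sx /=.
set mu := (_ + _) / 2 in dC *; set nu := mkC _ _ in dC *; move=> sx'.
have key (z : R[i]) : cabs z < 1 ->
    cabs (cgrad u z - cgrad u (toC x) - rc mu * (z - toC x) - nu * cconj (z - toC x)) <=
    (`|local_const Lam al T rho0| + 3 * Lam / r1 `^ al) * (cabs (z - toC x) * cabs (z - toC x) `^ al).
  move=> z1; have P := mulr_ge0 (cabs_ge0 (z - toC x)) (powR_ge0 (cabs (z - toC x)) al).
  rewrite mulrDl; have [zr|zr] := ltP (cabs (z - toC x)) r1.
    apply: le_trans (_ : _ <= local_const Lam al T rho0 * (cabs (z - toC x) * cabs (z - toC x) `^ al)) _.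
      move: zr; rewrite lt_min => /andP[/ltW za zb].
      apply: (local_estimate (ph := theta \o ofC) Lam0 T0 al0 al1 rho00 disc Nn0 _ _ dC _ _ rhoT za zb).
      - by move=> w w' /disc w1 /disc w1'; exact: glip.
      - move=> w /disc w1; have [Nw|Nw] := pselect (Nn (ofC w)); [by left|right].
        have w1' : eball 1 (ofC w) by rewrite /eball /= enorm_ofC.
        by have := sing _ w1' Nw; rewrite ofCK.
      - by rewrite /= toCK sx'.
      - move=> w /disc w1; have [->|wx] := eqVneq w (toC x).
          by rewrite subrr normr0 mulr_ge0// powR_ge0.
        rewrite /= -enorm_ofCB; apply: thold => //; rewrite ?toCK//.
        by apply: contra_neq wx => /(congr1 toC); rewrite ofCK.
    apply: le_trans (ler_wpM2r P (ler_norm _)) _; rewrite lerDl; exact: mulr_ge0.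
  have r12 : 0 < 1 / 2 :> R by lra.
  have near_lip (h : R[i]) : cabs h < 1 / 2 -> cabs (cgrad u (toC x + h) - cgrad u (toC x)) <= Lam * cabs h.
    move=> h12; rewrite -{2}(addKr (toC x) h) (addrC (- _)); apply: glip; last exact: x1.
    by have := cabsD (toC x) h; rewrite -enormE; lra.
  have [bmu bnu] := cdiff2_hess_bound r12 near_lip dC.
  set h := z - toC x in P zr *.
  have b0 : cabs (cgrad u z - cgrad u (toC x)) <= Lam * cabs h by apply: glip; [|exact: x1].
  have b1 : cabs (rc mu * h) <= Lam * cabs h.
    by rewrite cabsM cabs_rc; apply: ler_wpM2r; [exact: cabs_ge0|].
  have b2 : cabs (nu * cconj h) <= Lam * cabs h.
    by rewrite cabsM cabsJ; apply: ler_wpM2r; [exact: cabs_ge0|].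
  have b3 : 3 * Lam * cabs h <= 3 * Lam / r1 `^ al * (cabs h * cabs h `^ al).
    have pw : r1 `^ al <= cabs h `^ al.
      by apply: ge0_ler_powR; rewrite ?nnegrE ?cabs_ge0 ?(ltW al0) ?(ltW r10).
    have -> : 3 * Lam / r1 `^ al * (cabs h * cabs h `^ al) = 3 * Lam * cabs h * (cabs h `^ al / r1 `^ al) by ring.
    rewrite ler_peMr ?ler_pdivlMr ?mul1r// mulr_ge0 ?cabs_ge0//; lra.
  have := cabsB (cgrad u z - cgrad u (toC x) - rc mu * h) (nu * cconj h).
  have := cabsB (cgrad u z - cgrad u (toC x)) (rc mu * h).
  have := mulr_ge0 (normr_ge0 (local_const Lam al T rho0)) P; lra.
have parts z := affine_parts (hess u x 0 0) (hess u x 0 1) (hess u x 1 1)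
  (cgrad u (toC z)) (cgrad u (toC x)) (toC z - toC x).
apply: ord2 => z z1; have [E0 E1] := parts z.
  apply: le_trans (key (toC z) z1); apply: le_trans (cre_le _); rewrite E0.
  by rewrite /cgrad !toCK !cE.
apply: le_trans (key (toC z) z1); apply: le_trans (cim_le _); rewrite E1 -sym.
by rewrite /cgrad !toCK !cE.
Qed.

End Main.

Theorem theorem1p2 (R : realType) (alpha : R)
    (halpha0 : 0 < alpha) (halpha1 : alpha < 1) (Lambda : R) :
  exists r : R, (0 < r /\ r < 1) /\
    forall M T : R, exists C1 : R,
      forall u theta : R * R -> R,
        C1_holder 1 (eball 1) u ->
        sobolev 2 2%:E (eball 1) u ->
        holder_norm (@mxnorm2 R 1 2) 1 (eball 1) (grad u) = Lambda%:E ->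
        slag_solution (eball 1) u theta ->
        Lp_norm +oo%E (eball 1) u = M%:E ->
        holder_norm Num.norm alpha (eball 1) theta = T%:E ->
        C2_holder alpha (eball r) u /\
        (holder_norm (@mxnorm2 R 2 2) alpha (eball r) (hess u) <= C1%:E)%E.
Proof.
exists (1 / 2); split; first by split; lra.
(* A positive Lipschitz constant whatever the real number [Lambda] is. *)
move=> M T; pose L := `|Lambda| + 1.
have L0 : 0 < L by rewrite ltr_pwDr.
have [C C0 Taylor] := interior_taylor L0 halpha0 halpha1 (normr_ge0 T).
have K0 : 0 <= 101 * C by lra.
(* The summands bound the supremum of the Hessian ([taylor1_bound]) and its seminorm
   ([taylor1_holder]); the outer factors 2 pass from entries to the matrix norm. *)
exists (2 * (L + 101 * C) + 2 * (12 * (101 * C))) => u theta [du uL gfin] _ gLam sol _ thT.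
have du1 y : eball 1 y -> differentiable u y by exact: du.
have sub (y : R * R) : eball (1 / 2) y -> eball 1 y by rewrite /eball /=; lra.
have glip x y : eball 1 x -> eball 1 y -> x != y ->
    mxnorm2 (grad u x - grad u y) <= L * enorm (x - y).
  move=> x1 y1 xy; have [_] := holder_norm_fin (@mxnorm2_ge0 R 1 2) gLam x1 y1 xy.
  rewrite powRr1 ?enorm_ge0// => /le_trans; apply; rewrite ler_wpM2r ?enorm_ge0//.
  by rewrite /L; have := ler_norm Lambda; lra.
have thold x y : eball 1 x -> eball 1 y -> x != y ->
    `|theta x - theta y| <= `|T| * enorm (x - y) `^ alpha.
  move=> x1 y1 xy; have [_] := holder_norm_fin (@normr_ge0 _ _) thT x1 y1 xy.
  by move/le_trans; apply; rewrite ler_wpM2r ?powR_ge0// ler_norm.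
pose Nn := ~` [set x : mplane R | eball 1 x ->
     differentiable (grad u) x /\ slag (hess u x) = theta x].
have Nn0 : (leb2 R).-negligible Nn by exact: sol.
have solN x : eball 1 x -> ~ Nn x -> differentiable (grad u) x /\ slag (hess u x) = theta x.
  by move=> x1 /contrapT; apply.
have TayS := Taylor u theta Nn Nn0 du1 glip thold solN.
pose S := [set p | enorm p < 1 / 2 /\ ~ Nn p].
have dense x e : enorm x < 1 / 2 -> 0 < e -> exists2 p, S p & enorm (p - x) < e.
  move=> x12 e0; have m0 : 0 < Num.min e (1 / 2 - enorm x) by rewrite lt_min e0 subr_gt0.
  have [p Np] := negligible_dense x Nn0 m0; rewrite lt_min => /andP[pe px].
  by exists p => //; split => //; have := enormD (p - x) x; rewrite subrK; lra.
have all_taylor i x : enorm x < 1 / 2 ->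
    differentiable (partial i u) x /\
    taylor1 alpha (101 * C) (partial i u) x (hess u x i 0) (hess u x i 1).
  move=> x12; have [||[p q] /= Txpq] := @taylor1_extend R alpha halpha0 halpha1 S C (partial i u)
    (fun p => hess u p i 0) (fun p => hess u p i 1) C0 _ dense _ x x12.
  - by move=> p [].
  - by move=> p [p12 Np]; exact: TayS.
  have x1 : enorm x < 1 by lra.
  have [dx E0 E1] := pdiff_diff (taylor1_pdiff halpha0 K0 x1 Txpq).
  by split=> //; rewrite !mxE E0 E1.
have pL i x : enorm x < 1 / 2 -> forall z, enorm z < 1 ->
    `|partial i u z - partial i u x| <= L * enorm (z - x).
  move=> x12 z z1; have [->|zx] := eqVneq z x.
    by rewrite subrr normr0 mulr_ge0 ?enorm_ge0 ?(ltW L0).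
  apply: le_trans (_ : _ <= mxnorm2 (grad u z - grad u x)) _; last first.
    by apply: glip => //; exact: sub.
  by rewrite grad_cabs; move: i; apply: ord2;
    [apply: le_trans (cre_le _)|apply: le_trans (cim_le _)]; rewrite !cE.
have hbound x : eball (1 / 2) x -> mxnorm2 (hess u x) <= 2 * (L + 101 * C).
  move=> x12; apply: mxnorm2_le => i; have [_ Ti] := all_taylor i x x12.
  have [b0 b1] := taylor1_bound halpha0 K0 (ltW L0) x12 (pL i x x12) Ti.
  exact: ord2.
have hhold x y : eball (1 / 2) x -> eball (1 / 2) y -> x != y ->
    mxnorm2 (hess u x - hess u y) <= 2 * (12 * (101 * C)) * enorm (x - y) `^ alpha.
  move=> x12 y12 xy; rewrite -mulrA; apply: mxnorm2_le => i.
  have [_ Tx] := all_taylor i x x12; have [_ Ty] := all_taylor i y y12.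
  have [b0 b1] := taylor1_holder halpha0 halpha1 K0 xy x12 y12 Tx Ty.
  have E j : (hess u x - hess u y) i j = hess u x i j - hess u y i j.
    by rewrite [LHS]mxE; congr (_ + _); rewrite mxE.
  by apply: ord2; rewrite E.
have hn := holder_norm_le (N := @mxnorm2 R 2 2) hbound hhold.
split=> //; split.
- move=> x x12; split; first by apply: du; exact: sub.
  by apply/grad_diff; split; [have [] := all_taylor 0 x x12|have [] := all_taylor 1 x x12].
- apply: le_lt_trans _ uL; apply: ereal_sup_le => _ [x x12 <-]; exists x => //; exact: sub.
- apply: (@le_lt_trans _ _ Lambda%:E); last by rewrite ltry.
  apply: (@sup_norm_le R _ (@mxnorm2 R 1 2)) => x x12; have x1 := sub _ x12.
  (* A companion point, as [holder_norm_fin] asks for two distinct ones. *)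
  have [y y1 xy] : exists2 y, eball 1 y & x != y.
    have [->|x0] := eqVneq x 0.
      exists (1 / 2, 0); first by rewrite /eball /= enorm_hor; lra.
      by apply/eqP => /(congr1 fst) /=; lra.
    by exists 0 => //; rewrite /eball /= enormE /= cabs0.
  by have [] := holder_norm_fin (@mxnorm2_ge0 R 1 2) gLam x1 y1 xy.
- by apply: le_lt_trans hn _; rewrite ltry.
Qed.
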